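(* Let $K$ be an unconstrained Sierpinski carpet and $(\mathcal{E},\mathcal{F})$ a self-similar $D_4$-symmetric resistance form on $K$ with renormalization factor $r$, whose resistance metric $R$ is jointly continuous on $K\times K$ and satisfies $R(L_2,L_4)=1$. Let $n\ge0$. Then $\{f|_{\partial_nK}:f\in\mathcal{F}\}=\Lambda^{\sigma(r)}_{2,2}(\partial_nK)$. Moreover, there are $C_1,C_2>0$ depending only on $k$ such that $C_1[[h|_{\partial_nK}]]^2_{\Lambda^{\sigma(r)}_{2,2}(\partial_nK)}\le\mathcal{E}(h)\le C_2[[h|_{\partial_nK}]]^2_{\Lambda^{\sigma(r)}_{2,2}(\partial_nK)}$ for every $h\in\mathcal{H}_n$, where $\mathcal{H}_n=\{h\in\mathcal{F}:\mathcal{E}(h)=\inf\{\mathcal{E}(f):f\in\mathcal{F},f|_{\partial_nK}=h|_{\partial_nK}\}\}$.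
   Context: USC: $\square=[0,1]^2$, $q_1=(0,0),q_2=(1,0),q_3=(1,1),q_4=(0,1)$; integers $k\ge3$, $4(k-1)\le N\le k^2-1$; maps $\Psi_i(x)=x/k+c_i$ ($1\le i\le N$) with pairwise intersections of the squares $\Psi_i(\square)$ a segment, point or empty, $\bigcup_i\Psi_i(\square)$ connected and invariant under the group $\mathscr G$ of 8 isometries of $\square$, and $\overline{q_1,q_2}\subset\bigcup_i\Psi_i(\square)\subset\square$; $K$ is the compact set with $K=\bigcup_i\Psi_iK$. Sides $L_1=\overline{q_1,q_2},L_2=\overline{q_2,q_3},L_3=\overline{q_3,q_4},L_4=\overline{q_4,q_1}$, $\partial_0K=\bigcup_{i=1}^4L_i$. Words: $W_n=\{1,\dots,N\}^n$ ($W_0=\{\emptyset\}$), $\Psi_w=\Psi_{w_1}\circ\cdots\circ\Psi_{w_n}$, $\partial_nK=\bigcup_{w\in W_n}\Psi_w\partial_0K$. Resistance form, effective resistance $R(A,B)=\sup\{\mathcal{E}(f)^{-1}:f|_A=0,f|_B=1\}$, resistance metric; self-similar with factor $r$: $\mathcal{F}=\{f:f\circ\Psi_i\in\mathcal{F}\ \forall i\}$ and $\mathcal{E}(f)=\sum_ir^{-1}\mathcal{E}(f\circ\Psi_i)$; $D_4$-symmetric: $f\circ\Gamma\in\mathcal{F}$, $\mathcal{E}(f\circ\Gamma)=\mathcal{E}(f)$ for $\Gamma\in\mathscr G$; jointly continuous: $R$ continuous on $K\times K$ in the Euclidean topology. Besov norms: $\sigma(r)=-\frac{\log r}{2\log k}+\frac12$.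 For $u\in C[0,1]$, $[[u]]^2_{\Lambda^{\sigma}_{2,2}[0,1]}=\sum_{m\ge0}k^{(2\sigma-1)m}\sum_{l=0}^{k^m-1}(u(l/k^m)-u((l+1)/k^m))^2$ (so for $\sigma=\sigma(r)$ the weight is $r^{-m}$). For a segment $\overline{x,y}$ with $\gamma(t)=(1-t)x+ty$ and $u\in C(\overline{x,y})$, $[[u]]_{\Lambda^\sigma_{2,2}(\overline{x,y})}=|\overline{x,y}|^{1/2-\sigma}[[u\circ\gamma]]_{\Lambda^\sigma_{2,2}[0,1]}$. For $u\in C(\partial_nK)$, $[[u]]^2_{\Lambda^{\sigma(r)}_{2,2}(\partial_nK)}=\sum_{w\in W_n}\sum_{i=1}^4[[u|_{\Psi_wL_i}]]^2_{\Lambda^{\sigma(r)}_{2,2}(\Psi_wL_i)}$ and $\Lambda^{\sigma(r)}_{2,2}(\partial_nK)=\{u\in C(\partial_nK):[[u]]_{\Lambda^{\sigma(r)}_{2,2}(\partial_nK)}<\infty\}$. *)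

(* Defs.v *)
From Stdlib Require Import Reals Lra List.
From Coquelicot Require Import Coquelicot.
Import ListNotations.
Open Scope R_scope.

Definition pt := (R * R)%type.

Definition edist (p q : pt) : R :=
  sqrt ((fst p - fst q) ^ 2 + (snd p - snd q) ^ 2).

Definition opn2 (U : pt -> Prop) : Prop :=
  forall p, U p -> exists eps, 0 < eps /\ forall q, edist p q < eps -> U q.

Definition cpt2 (S : pt -> Prop) : Prop :=
  forall (I : Type) (U : I -> pt -> Prop),
    (forall i, opn2 (U i)) -> (forall p, S p -> exists i, U i p) ->
    exists l : list I, forall p, S p -> exists i, In i l /\ U i p.

Definition conn2 (S : pt -> Prop) : Prop :=
  forall U V, opn2 U -> opn2 V ->
    (forall p, S p -> U p \/ V p) ->
    (exists p, S p /\ U p) -> (exists p, S p /\ V p) ->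
    exists p, S p /\ U p /\ V p.

Definition cont_on (S : pt -> Prop) (u : pt -> R) : Prop :=
  forall x, S x -> forall eps, 0 < eps -> exists del, 0 < del /\
    forall y, S y -> edist x y < del -> Rabs (u y - u x) < eps.

Definition gamma (x y : pt) (t : R) : pt :=
  ((1 - t) * fst x + t * fst y, (1 - t) * snd x + t * snd y).

Definition seg (a b : pt) (p : pt) : Prop :=
  exists t, 0 <= t <= 1 /\ p = gamma a b t.

Definition sq0 (p : pt) : Prop := 0 <= fst p <= 1 /\ 0 <= snd p <= 1.

Definition q1 : pt := (0, 0).
Definition q2 : pt := (1, 0).
Definition q3 : pt := (1, 1).
Definition q4 : pt := (0, 1).

Definition qq (i : nat) : pt :=
  match i with 0%nat => q1 | 1%nat => q2 | 2%nat => q3 | _ => q4 end.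

Definition L1 := seg q1 q2.
Definition L2 := seg q2 q3.
Definition L3 := seg q3 q4.
Definition L4 := seg q4 q1.

Definition D4 : list (pt -> pt) :=
  [ (fun p => p);
    (fun p => (1 - fst p, snd p));
    (fun p => (fst p, 1 - snd p));
    (fun p => (1 - fst p, 1 - snd p));
    (fun p => (snd p, fst p));
    (fun p => (1 - snd p, fst p));
    (fun p => (snd p, 1 - fst p));
    (fun p => (1 - snd p, 1 - fst p)) ].

(** * The IFS Psi_i(x) = x/k + c_i, i = 0..N-1 (paper: 1..N) *)
Definition Psi (k : nat) (c : nat -> pt) (i : nat) (x : pt) : pt :=
  (fst x / INR k + fst (c i), snd x / INR k + snd (c i)).

Definition PsiW (k : nat) (c : nat -> pt) (w : list nat) : pt -> pt :=
  fold_right (fun i g x => Psi k c i (g x)) (fun x => x) w.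

Fixpoint words (N n : nat) : list (list nat) :=
  match n with
  | 0%nat => [ [] ]
  | S n' => flat_map (fun i => map (cons i) (words N n')) (seq 0 N)
  end.

Definition cell (k : nat) (c : nat -> pt) (i : nat) (p : pt) : Prop :=
  exists x, sq0 x /\ p = Psi k c i x.

Definition cells (k N : nat) (c : nat -> pt) (p : pt) : Prop :=
  exists i, (i < N)%nat /\ cell k c i p.

Definition USC (k N : nat) (c : nat -> pt) : Prop :=
  (3 <= k)%nat /\ (4 * (k - 1) <= N)%nat /\ (N <= k * k - 1)%nat /\
  (forall i j, (i < N)%nat -> (j < N)%nat -> i <> j ->
     (forall p, ~ (cell k c i p /\ cell k c j p)) \/
     (exists a b, forall p, (cell k c i p /\ cell k c j p) <-> seg a b p)) /\
  conn2 (cells k N c) /\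
  (forall g, In g D4 -> forall p, cells k N c p <-> cells k N c (g p)) /\
  (forall p, L1 p -> cells k N c p) /\
  (forall p, cells k N c p -> sq0 p).

Definition attractor (k N : nat) (c : nat -> pt) (K : pt -> Prop) : Prop :=
  (exists p, K p) /\ cpt2 K /\
  forall p, K p <-> exists i x, (i < N)%nat /\ K x /\ p = Psi k c i x.

(* partial_n K = U_{w in W_n} Psi_w (partial_0 K) *)
Definition bdry (k N : nat) (c : nat -> pt) (n : nat) (p : pt) : Prop :=
  exists w i, In w (words N n) /\ (i < 4)%nat /\
    seg (PsiW k c w (qq i)) (PsiW k c w (qq (S i mod 4))) p.

(** * Resistance forms (Kigami), on functions pt -> R, seen through their
    restriction to K: F is saturated under agreement on K, and Eb only
    depends on the restrictions to K. *)
Definition agree (S : pt -> Prop) (f g : pt -> R) : Prop :=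
  forall x, S x -> f x = g x.

Record resistance_form (K : pt -> Prop) (F : (pt -> R) -> Prop)
    (Eb : (pt -> R) -> (pt -> R) -> R) : Prop := {
  rf_local_F : forall u v, F u -> agree K u v -> F v;
  rf_local_E : forall u v w, F u -> F v -> F w -> agree K u v -> Eb u w = Eb v w;
  rf_lin : forall a u v, F u -> F v -> F (fun x => a * u x + v x);
  rf_const : forall a : R, F (fun _ => a);
  rf_bilin : forall a u v w, F u -> F v -> F w ->
     Eb (fun x => a * u x + v x) w = a * Eb u w + Eb v w;
  rf_sym : forall u v, F u -> F v -> Eb u v = Eb v u;
  rf_nonneg : forall u, F u -> 0 <= Eb u u;
  rf_zero : forall u, F u -> (Eb u u = 0 <-> exists a, agree K u (fun _ => a));
  (* RF2: F / constants is a Hilbert space *)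
  rf_complete : forall u : nat -> pt -> R, (forall n, F (u n)) ->
     (forall eps, 0 < eps -> exists M, forall m n, (M <= m)%nat -> (M <= n)%nat ->
        Eb (fun x => u n x - u m x) (fun x => u n x - u m x) < eps) ->
     exists v, F v /\ forall eps, 0 < eps -> exists M, forall n, (M <= n)%nat ->
        Eb (fun x => u n x - v x) (fun x => u n x - v x) < eps;
  rf_interp : forall (V : list pt) (v : pt -> R), (forall x, In x V -> K x) ->
     exists u, F u /\ forall x, In x V -> u x = v x;
  rf_bounded : forall x y, K x -> K y -> exists M, forall u, F u -> 0 < Eb u u ->
     (u x - u y) ^ 2 / Eb u u <= M;
  rf_markov : forall u, F u ->
     F (fun x => Rmin (Rmax (u x) 0) 1) /\
     Eb (fun x => Rmin (Rmax (u x) 0) 1) (fun x => Rmin (Rmax (u x) 0) 1) <= Eb u u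
}.

Definition sumR (l : list R) : R := fold_right Rplus 0 l.

Definition self_similar (k N : nat) (c : nat -> pt) (F : (pt -> R) -> Prop)
    (Eb : (pt -> R) -> (pt -> R) -> R) (r : R) : Prop :=
  0 < r /\
  (forall f, F f <-> forall i, (i < N)%nat -> F (fun x => f (Psi k c i x))) /\
  (forall f, F f -> Eb f f =
     sumR (map (fun i => / r * Eb (fun x => f (Psi k c i x)) (fun x => f (Psi k c i x)))
              (seq 0 N))).

Definition D4_symmetric (F : (pt -> R) -> Prop)
    (Eb : (pt -> R) -> (pt -> R) -> R) : Prop :=
  forall g, In g D4 -> forall f, F f ->
    F (fun x => f (g x)) /\ Eb (fun x => f (g x)) (fun x => f (g x)) = Eb f f.

Definition eff_res_is (F : (pt -> R) -> Prop) (Eb : (pt -> R) -> (pt -> R) -> R)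
    (A B : pt -> Prop) (t : R) : Prop :=
  is_lub (fun s => exists f, F f /\ agree A f (fun _ => 0) /\ agree B f (fun _ => 1)
                          /\ s = / Eb f f) t.

Definition jointly_continuous (K : pt -> Prop) (F : (pt -> R) -> Prop)
    (Eb : (pt -> R) -> (pt -> R) -> R) : Prop :=
  exists rho : pt -> pt -> R,
    (forall x y, K x -> K y ->
       (x = y -> rho x y = 0) /\
       (x <> y -> eff_res_is F Eb (fun z => z = x) (fun z => z = y) (rho x y))) /\
    (forall x y, K x -> K y -> forall eps, 0 < eps -> exists del, 0 < del /\
       forall x' y', K x' -> K y' -> edist x x' < del -> edist y y' < del ->
         Rabs (rho x' y' - rho x y) < eps).

Definition sigma_r (k : nat) (r : R) : R := - ln r / (2 * ln (INR k)) + / 2.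

Definition besov01_term (k : nat) (s : R) (g : R -> R) (m : nat) : R :=
  Rpower (INR k) ((2 * s - 1) * INR m) *
  sumR (map (fun l => (g (INR l / INR (k ^ m)) - g (INR (l + 1) / INR (k ^ m))) ^ 2)
            (seq 0 (k ^ m))).

Definition besov01_sq (k : nat) (s : R) (g : R -> R) : R :=
  Series (besov01_term k s g).

Definition besov_seg_sq (k : nat) (s : R) (x y : pt) (u : pt -> R) : R :=
  (Rpower (edist x y) (/ 2 - s)) ^ 2 * besov01_sq k s (fun t => u (gamma x y t)).

Definition besov_bdry_sq (k N : nat) (c : nat -> pt) (s : R) (n : nat) (u : pt -> R) : R :=
  sumR (map (fun w => sumR (map (fun i =>
          besov_seg_sq k s (PsiW k c w (qq i)) (PsiW k c w (qq (S i mod 4))) u)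
          (seq 0 4)))
       (words N n)).

(* u|_{partial_n K} in Lambda^s_{2,2}(partial_n K): continuous and
   [[u]] < infinity, i.e. every one of the finitely many series converges *)
Definition in_Lambda (k N : nat) (c : nat -> pt) (s : R) (n : nat) (u : pt -> R) : Prop :=
  cont_on (bdry k N c n) u /\
  forall w i, In w (words N n) -> (i < 4)%nat ->
    ex_series (besov01_term k s
      (fun t => u (gamma (PsiW k c w (qq i)) (PsiW k c w (qq (S i mod 4))) t))).

Definition is_inf (S : R -> Prop) (a : R) : Prop :=
  (forall x, S x -> a <= x) /\ (forall b, (forall x, S x -> b <= x) -> b <= a).

Definition harmonic_n (k N : nat) (c : nat -> pt) (F : (pt -> R) -> Prop)
    (Eb : (pt -> R) -> (pt -> R) -> R) (n : nat) (h : pt -> R) : Prop :=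
  F h /\ is_inf (fun e => exists f, F f /\ agree (bdry k N c n) f h /\ e = Eb f f) (Eb h h).

(* Main.v *)
Require Import Defs.
From Stdlib Require Import Reals List Lra Lia Permutation ClassicalEpsilon.
From Coquelicot Require Import Coquelicot.
Import ListNotations.
Open Scope R_scope.

(* The weight in the Besov seminorm is r^{-m}, and both halves reduce by self-similarity to n = 0 and
   to one side L of the square.

   Trace: climbing vertically from two neighbouring k-adic points of L, and crossing above,
   one uses only cells that do not touch L, and these differ from one generation to the next.
   Since r < 1, the resulting series of energies is summed by an induction on the number of
   generations, for the functional C E(f) - lam * (squared drops of f along the two vertical sides).

   Extension: starting from a function h with values 0 and 1 on opposite sides, lattice
   operations give explicit profiles on the cells touching L; those on neighbouring cells
   have matching traces, so the pieces can be glued generation by generation, at the cost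
   of differences of the data at neighbouring points only.

   The constants depend only on k, because 1/k <= r <= 1 - 1/k^2 and R(q1, q2) <= C(k).
   For the last bound, a row of k^p cells along L is folded onto one square
   and compared with R(L2, L4) = 1. *)

(** * Sums and the discrete Besov energy *)

(** The normalization R(L_2,L_4) = 1 concerns whole sides, whereas traces are controlled through
    resistances between points, for which only some finite bound is given. That bound is improved by
    halving: if R(q_1,q_2) <= rho with rho large, a function of energy below 2/rho varies little
    along the sides of small cells, so corner values stand for whole sides and the normalization
    applies. Both this argument and the trace induction need 1 - r bounded below in terms of k. The
    bound r <= 1 - 1/k^2 reflects N <= k^2 - 1: once the trace of a coordinate function extends with
    finite energy, it can be reproduced inside all N cells at a cost N/(r k^2) per generation. This
    is why the extension precedes the trace estimate. The trace induction closes because passing to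
    the corner cells multiplies squared drops by 1/r, a gain larger than the loss incurred in
    separating them from the climb above. *)

Definition rsum (n : nat) (f : nat -> R) : R := sumR (map f (seq 0 n)).

Lemma sumR_app l l' : sumR (l ++ l') = sumR l + sumR l'.
Proof. induction l as [|a l IH]; simpl; [ring|rewrite IH; ring]. Qed.

Lemma sumR_perm l l' : Permutation l l' -> sumR l = sumR l'.
Proof. induction 1; simpl; lra. Qed.

Lemma sumR_map_ext {A} (f g : A -> R) l :
  (forall x, In x l -> f x = g x) -> sumR (map f l) = sumR (map g l).
Proof.
  induction l as [|a l IH]; simpl; intros H; [reflexivity|].
  rewrite H, IH; auto.
Qed.

Lemma sumR_map_le {A} (f g : A -> R) l :
  (forall x, In x l -> f x <= g x) -> sumR (map f l) <= sumR (map g l).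
Proof.
  induction l as [|a l IH]; simpl; intros H; [lra|].
  apply Rplus_le_compat; auto.
Qed.

Lemma sumR_map_scal {A} a (f : A -> R) l :
  sumR (map (fun x => a * f x) l) = a * sumR (map f l).
Proof. induction l as [|b l IH]; simpl; [ring|rewrite IH; ring]. Qed.

Lemma sumR_flat_map {A B} (f : B -> R) (g : A -> list B) l :
  sumR (map f (flat_map g l)) = sumR (map (fun x => sumR (map f (g x))) l).
Proof.
  induction l as [|a l IH]; simpl; [reflexivity|].
  rewrite map_app, sumR_app, IH; reflexivity.
Qed.

Lemma sumR_map_filter {A} (q : A -> R) (p : A -> bool) l :
  sumR (map (fun x => if p x then q x else 0) l) = sumR (map q (filter p l)).
Proof.
  induction l as [|a l IH]; simpl; [reflexivity|].
  destruct (p a); simpl; rewrite IH; ring.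
Qed.

Lemma rsum_0 f : rsum 0 f = 0.
Proof. reflexivity. Qed.

Lemma rsum_S n f : rsum (S n) f = rsum n f + f n.
Proof.
  unfold rsum. rewrite seq_S, map_app, sumR_app. simpl. ring.
Qed.

Lemma rsum_1 f : rsum 1 f = f 0%nat.
Proof. unfold rsum; simpl; ring. Qed.

Lemma rsum_ext n f g :
  (forall i, (i < n)%nat -> f i = g i) -> rsum n f = rsum n g.
Proof.
  intros H. apply sumR_map_ext. intros i Hi. apply in_seq in Hi. apply H; lia.
Qed.

Lemma rsum_le n f g :
  (forall i, (i < n)%nat -> f i <= g i) -> rsum n f <= rsum n g.
Proof.
  intros H. apply sumR_map_le. intros i Hi. apply in_seq in Hi. apply H; lia.
Qed.

Lemma rsum_plus n f g : rsum n (fun i => f i + g i) = rsum n f + rsum n g.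
Proof. induction n as [|n IH]; [unfold rsum; simpl; ring|rewrite !rsum_S, IH; ring]. Qed.

Lemma rsum_scal n a f : rsum n (fun i => a * f i) = a * rsum n f.
Proof. apply sumR_map_scal. Qed.

Lemma rsum_const n a : rsum n (fun _ => a) = INR n * a.
Proof.
  induction n as [|n IH]; [unfold rsum; simpl; ring|].
  rewrite rsum_S, IH, S_INR; ring.
Qed.

Lemma rsum_nonneg n f : (forall i, (i < n)%nat -> 0 <= f i) -> 0 <= rsum n f.
Proof.
  intros H. replace 0 with (rsum n (fun _ => 0)) by (rewrite rsum_const; ring).
  now apply rsum_le.
Qed.

Lemma rsum_S_first n f : rsum (S n) f = f 0%nat + rsum n (fun i => f (S i)).
Proof.
  induction n as [|n IH]; [unfold rsum; simpl; ring|].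
  rewrite rsum_S, IH, rsum_S; ring.
Qed.

Lemma rsum_add a b f : rsum (a + b) f = rsum a f + rsum b (fun i => f (a + i)%nat).
Proof.
  induction b as [|b IH]; [rewrite Nat.add_0_r; unfold rsum; simpl; ring|].
  rewrite Nat.add_succ_r, !rsum_S, IH; ring.
Qed.

Lemma rsum_mono l n f : (l <= n)%nat -> (forall i, 0 <= f i) -> rsum l f <= rsum n f.
Proof.
  intros Hl Hf. replace n with (l + (n - l))%nat by lia. rewrite rsum_add.
  pose proof (rsum_nonneg (n - l) (fun i => f (l + i)%nat) (fun i _ => Hf _)). lra.
Qed.

Lemma rsum_mul a b f :
  rsum (a * b) f = rsum a (fun i => rsum b (fun l => f (i * b + l)%nat)).
Proof.
  induction a as [|a IH]; [reflexivity|].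
  rewrite rsum_S, <- IH. replace (S a * b)%nat with (a * b + b)%nat by lia.
  apply rsum_add.
Qed.

Lemma rsum_exchange m n (f : nat -> nat -> R) :
  rsum m (fun i => rsum n (f i)) = rsum n (fun j => rsum m (fun i => f i j)).
Proof.
  induction m as [|m IH].
  - rewrite rsum_0. symmetry. rewrite (rsum_ext n _ (fun _ => 0)) by reflexivity.
    rewrite rsum_const; ring.
  - rewrite rsum_S, IH, <- rsum_plus. apply rsum_ext; intros j _. now rewrite rsum_S.
Qed.

Lemma rsum_term_le n f i :
  (i < n)%nat -> (forall j, (j < n)%nat -> 0 <= f j) -> f i <= rsum n f.
Proof.
  induction n as [|n IH]; intros Hi Hf; [lia|]. rewrite rsum_S.
  pose proof (rsum_nonneg n f (fun j Hj => Hf j ltac:(lia))).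
  pose proof (Hf n ltac:(lia)).
  destruct (Nat.eq_dec i n) as [->|]; [lra|].
  specialize (IH ltac:(lia) (fun j Hj => Hf j ltac:(lia))). lra.
Qed.

Lemma rsum_sum_n n f : rsum (S n) f = sum_n f n.
Proof.
  induction n as [|n IH]; [rewrite rsum_1, sum_O; reflexivity|].
  rewrite rsum_S, IH, sum_Sn; reflexivity.
Qed.

Definition Dm (k m : nat) (u : R -> R) : R :=
  rsum (k ^ m) (fun l => (u (INR l / INR (k ^ m)) - u (INR (l + 1) / INR (k ^ m))) ^ 2).

(* Partial sums of the squared seminorm on [0,1] for sigma = sigma(r). *)
Definition Tn (k : nat) (r : R) (n : nat) (u : R -> R) : R :=
  rsum n (fun m => / r ^ m * Dm k m u).

Lemma Dm_nonneg k m u : 0 <= Dm k m u.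
Proof. apply rsum_nonneg; intros; apply pow2_ge_0. Qed.

Lemma Dm_0 k u : Dm k 0 u = (u 0 - u 1) ^ 2.
Proof.
  unfold Dm. simpl (k ^ 0)%nat. rewrite rsum_1. simpl INR.
  replace (0 / 1) with 0 by field. now replace (1 / 1) with 1 by field.
Qed.

Lemma INR_pow_pos k m : (0 < k)%nat -> 0 < INR (k ^ m).
Proof.
  intros Hk. apply lt_0_INR. induction m; simpl; [lia|].
  apply Nat.mul_pos_pos; assumption.
Qed.

Lemma Dm_ext k m u v : (0 < k)%nat ->
  (forall t, 0 <= t <= 1 -> u t = v t) -> Dm k m u = Dm k m v.
Proof.
  intros Hk H. unfold Dm. apply rsum_ext; intros l Hl.
  pose proof (INR_pow_pos k m Hk) as Hp.
  rewrite !H; [reflexivity| |]; split.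
  - apply Rmult_le_pos; [apply pos_INR|left; now apply Rinv_0_lt_compat].
  - apply (Rmult_le_reg_r (INR (k ^ m))); [easy|].
    unfold Rdiv; rewrite Rmult_assoc, Rinv_l, Rmult_1_r, Rmult_1_l by lra.
    apply le_INR; lia.
  - apply Rmult_le_pos; [apply pos_INR|left; now apply Rinv_0_lt_compat].
  - apply (Rmult_le_reg_r (INR (k ^ m))); [easy|].
    unfold Rdiv; rewrite Rmult_assoc, Rinv_l, Rmult_1_r, Rmult_1_l by lra.
    apply le_INR; lia.
Qed.

Lemma Dm_S k m u : (0 < k)%nat ->
  Dm k (S m) u = rsum k (fun i => Dm k m (fun t => u (INR i / INR k + t / INR k))).
Proof.
  intros Hk. unfold Dm at 1. simpl (k ^ S m)%nat. rewrite rsum_mul.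
  apply rsum_ext; intros i _. apply rsum_ext; intros l _.
  pose proof (INR_pow_pos k m Hk). pose proof (lt_0_INR k Hk).
  assert (Ha : forall a, INR (i * k ^ m + a) / INR (k * k ^ m) =
               INR i / INR k + INR a / INR (k ^ m) / INR k).
  { intros a. rewrite plus_INR, !mult_INR. field; lra. }
  rewrite <- Nat.add_assoc, !Ha. reflexivity.
Qed.

Lemma Tn_mono k r n m u : 0 < r -> (n <= m)%nat -> Tn k r n u <= Tn k r m u.
Proof.
  intros Hr H; induction H as [|m H IH]; [lra|].
  unfold Tn in *. rewrite rsum_S.
  assert (0 <= / r ^ m * Dm k m u); [|lra].
  apply Rmult_le_pos; [|apply Dm_nonneg]. left; apply Rinv_0_lt_compat, pow_lt, Hr.
Qed.

(** Grouping the intervals of generation m + 1 by their first digit in base k gives the same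
    recursion as the self-similarity of the energy; all inductions on the number of generations rest
    on this. *)
Lemma Tn_S k r n u : (0 < k)%nat -> 0 < r ->
  Tn k r (S n) u = Dm k 0 u +
    / r * rsum k (fun i => Tn k r n (fun t => u (INR i / INR k + t / INR k))).
Proof.
  intros Hk Hr. unfold Tn. rewrite rsum_S_first. f_equal.
  - simpl; field.
  - rewrite rsum_exchange, <- rsum_scal. apply rsum_ext; intros m _.
    rewrite Dm_S by easy. rewrite rsum_scal. simpl.
    assert (r ^ m <> 0) by (apply pow_nonzero; lra). field; lra.
Qed.

Lemma Tn_1 k r u : Tn k r 1 u = Dm k 0 u.
Proof. unfold Tn. rewrite rsum_1. simpl; field. Qed.

Lemma Tn_ext k r n u v : (0 < k)%nat ->
  (forall t, 0 <= t <= 1 -> u t = v t) -> Tn k r n u = Tn k r n v.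
Proof.
  intros Hk H. apply rsum_ext; intros m _. f_equal. now apply Dm_ext.
Qed.

(** * Geometry of the cells *)

Lemma cell_iff k c i p : (0 < k)%nat ->
  cell k c i p <-> (fst (c i) <= fst p <= fst (c i) + / INR k /\
                    snd (c i) <= snd p <= snd (c i) + / INR k).
Proof.
  intros Hk. pose proof (lt_0_INR k Hk) as Hp. pose proof (Rinv_0_lt_compat _ Hp) as Hi.
  split.
  - intros [x [[[H1 H2] [H3 H4]] ->]]. unfold Psi; simpl.
    assert (forall a, 0 <= a <= 1 -> 0 <= a / INR k <= / INR k).
    { intros a Ha. unfold Rdiv. split; [apply Rmult_le_pos; lra|].
      rewrite <- (Rmult_1_l (/ INR k)) at 2. apply Rmult_le_compat_r; lra. }
    pose proof (H (fst x) (conj H1 H2)). pose proof (H (snd x) (conj H3 H4)). lra.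
  - intros [Hx Hy].
    assert (Hb : forall a b, b <= a <= b + / INR k -> 0 <= INR k * (a - b) <= 1).
    { intros a b Hab. split; [apply Rmult_le_pos; lra|].
      rewrite <- (Rinv_r (INR k)) by lra. apply Rmult_le_compat_l; lra. }
    exists (INR k * (fst p - fst (c i)), INR k * (snd p - snd (c i))).
    split; [split; simpl; apply Hb; easy|].
    destruct p as [p1 p2]. unfold Psi; simpl. f_equal; field; lra.
Qed.

Lemma seg_collinear a b p q s : seg a b p -> seg a b q -> seg a b s ->
  (fst q - fst p) * (snd s - snd p) = (snd q - snd p) * (fst s - fst p).
Proof.
  intros [t [_ ->]] [t' [_ ->]] [t'' [_ ->]]. unfold gamma; simpl. ring.
Qed.

(** If both coordinates differ by less than 1/k, the two squares share a nondegenerate rectangle,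
    three corners of which are not collinear, so the intersection is neither empty nor a segment. *)
Lemma cells_separated k N c i j : USC k N c -> (i < N)%nat -> (j < N)%nat -> i <> j ->
  / INR k <= Rabs (fst (c i) - fst (c j)) \/ / INR k <= Rabs (snd (c i) - snd (c j)).
Proof.
  intros (Hk & _ & _ & Hd & _) Hi Hj Hij.
  destruct (Rle_dec (/ INR k) (Rabs (fst (c i) - fst (c j)))) as [|H1]; [now left|].
  destruct (Rle_dec (/ INR k) (Rabs (snd (c i) - snd (c j)))) as [|H2]; [now right|].
  exfalso. apply Rnot_le_lt in H1, H2. apply Rabs_def2 in H1, H2.
  assert (Hk0 : (0 < k)%nat) by lia.
  set (a1 := Rmax (fst (c i)) (fst (c j))). set (b1 := Rmin (fst (c i)) (fst (c j)) + / INR k).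
  set (a2 := Rmax (snd (c i)) (snd (c j))). set (b2 := Rmin (snd (c i)) (snd (c j)) + / INR k).
  assert (A1 : a1 < b1 /\ fst (c i) <= a1 /\ fst (c j) <= a1 /\
     b1 <= fst (c i) + / INR k /\ b1 <= fst (c j) + / INR k).
  { unfold a1, b1, Rmax, Rmin.
    destruct (Rle_dec (fst (c i)) (fst (c j))); lra. }
  assert (A2 : a2 < b2 /\ snd (c i) <= a2 /\ snd (c j) <= a2 /\
     b2 <= snd (c i) + / INR k /\ b2 <= snd (c j) + / INR k).
  { unfold a2, b2, Rmax, Rmin.
    destruct (Rle_dec (snd (c i)) (snd (c j))); lra. }
  assert (Hc : forall x y, a1 <= x <= b1 -> a2 <= y <= b2 ->
            cell k c i (x, y) /\ cell k c j (x, y)).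
  { intros x y Hx Hy. rewrite !cell_iff by easy; simpl; lra. }
  destruct (Hd i j Hi Hj Hij) as [He|[a [b Hs]]].
  - apply (He (a1, a2)). apply Hc; lra.
  - assert (S1 : seg a b (a1, a2)) by (apply Hs, Hc; lra).
    assert (S2 : seg a b (b1, a2)) by (apply Hs, Hc; lra).
    assert (S3 : seg a b (a1, b2)) by (apply Hs, Hc; lra).
    pose proof (seg_collinear _ _ _ _ _ S1 S2 S3) as E. simpl in E.
    assert (0 < (b1 - a1) * (b2 - a2)) by (apply Rmult_lt_0_compat; lra). lra.
Qed.

(** * The row of cells along one side; stated for any placement [c], so that it also serves
    reflected and rotated placements *)

Section Rows.
Variables (k N : nat) (c : nat -> pt).
Hypothesis Hk : (3 <= k)%nat.
Hypothesis Hsep : forall i j, (i < N)%nat -> (j < N)%nat -> i <> j ->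
  / INR k <= Rabs (fst (c i) - fst (c j)) \/ / INR k <= Rabs (snd (c i) - snd (c j)).
Hypothesis Hin : forall i, (i < N)%nat ->
  0 <= fst (c i) <= 1 - / INR k /\ 0 <= snd (c i) <= 1 - / INR k.
Hypothesis Hcov : forall t, 0 <= t <= 1 ->
  exists i, (i < N)%nat /\ snd (c i) = 0 /\ fst (c i) <= t <= fst (c i) + / INR k.

Let Hkp : 0 < INR k.
Proof. apply lt_0_INR; lia. Qed.

Let Hki : 0 < / INR k.
Proof. now apply Rinv_0_lt_compat. Qed.

Lemma row_apart i j : (i < N)%nat -> (j < N)%nat -> snd (c i) = 0 -> snd (c j) = 0 ->
  fst (c i) < fst (c j) -> fst (c i) + / INR k <= fst (c j).
Proof.
  intros Hi Hj Ei Ej Hlt.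
  assert (i <> j) by (intros ->; lra).
  destruct (Hsep i j Hi Hj H) as [H0|H0].
  - rewrite Rabs_left in H0; lra.
  - rewrite Ei, Ej, Rminus_diag, Rabs_R0 in H0. lra.
Qed.

(** Cells are not placed on a grid by definition. Along a side it is forced: intervals of length 1/k
    that do not overlap and cover [0,1] from within start exactly at the points l/k. *)
Lemma row_exists l : (l < k)%nat -> exists i, (i < N)%nat /\ c i = (INR l / INR k, 0).
Proof.
  induction l as [|l IH]; intros Hl.
  - destruct (Hcov 0) as [i [Hi [H1 H2]]]; [lra|]. exists i; split; [easy|].
    destruct (Hin i Hi) as [H3 _]. destruct (c i) as [x y]; simpl in *.
    f_equal; [|easy]. unfold Rdiv; lra.
  - destruct IH as [j [Hj Ej]]; [lia|].
    assert (HS : INR (S l) / INR k = INR l / INR k + / INR k)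
      by (rewrite S_INR; field; lra).
    set (x := INR l / INR k) in *.
    assert (Hx0 : 0 <= x) by (apply Rmult_le_pos; [apply pos_INR|lra]).
    assert (Hx1 : x + / INR k + / INR k <= 1).
    { replace (x + / INR k + / INR k) with (INR (S (S l)) / INR k)
        by (unfold x; rewrite !S_INR; field; lra).
      apply (Rmult_le_reg_r (INR k)); [easy|].
      unfold Rdiv; rewrite Rmult_assoc, Rinv_l, Rmult_1_r, Rmult_1_l by lra.
      apply le_INR; lia. }
    assert (Hj1 : fst (c j) = x) by now rewrite Ej.
    assert (Hj2 : snd (c j) = 0) by now rewrite Ej.
    assert (Hstep : forall t, x + / INR k < t < x + / INR k + / INR k ->
       exists i, (i < N)%nat /\ snd (c i) = 0 /\ x + / INR k <= fst (c i) <= t).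
    { intros t Ht. destruct (Hcov t) as [i [Hi [H1 H2]]]; [lra|].
      exists i; repeat split; [easy|easy| |lra].
      rewrite <- Hj1. apply row_apart; try easy; lra. }
    (* A cell over a point just right of the previous cell starts at [x + / INR k] or later. If
       strictly later, a cell over a point of the gap would start less than 1/k before it. *)
    destruct (Hstep (x + / INR k + / INR k / 2)) as [i [Hi [Ei Hti]]]; [lra|].
    exists i; split; [easy|].
    destruct (Req_dec (fst (c i)) (x + / INR k)) as [E|Hne].
    + destruct (c i) as [y z]; simpl in *. f_equal; lra.
    + exfalso.
      destruct (Hstep ((x + / INR k + fst (c i)) / 2)) as [i' [Hi' [Ei' Hti']]]; [lra|].
      assert (fst (c i') + / INR k <= fst (c i)) by (apply row_apart; try easy; lra).
      lra.
Qed.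

Lemma floor_cell x : 0 <= x < 1 -> exists l, (l < k)%nat /\
  INR l / INR k <= x < INR l / INR k + / INR k.
Proof.
  intros Hx. destruct (nfloor_ex (x * INR k)) as [l Hl]; [apply Rmult_le_pos; lra|].
  exists l. split.
  - apply INR_lt. apply Rle_lt_trans with (x * INR k); [easy|].
    rewrite <- (Rmult_1_l (INR k)) at 2. apply Rmult_lt_compat_r; lra.
  - replace (INR l / INR k + / INR k) with ((INR l + 1) / INR k) by (field; lra).
    split.
    + apply (Rmult_le_reg_r (INR k)); [easy|]. unfold Rdiv.
      rewrite Rmult_assoc, Rinv_l by lra. lra.
    + apply (Rmult_lt_reg_r (INR k)); [easy|]. unfold Rdiv.
      rewrite Rmult_assoc, Rinv_l by lra. lra.
Qed.

(** A cell starting below height 1/k is less than 1/k away, in both coordinates, from the cell of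
    the row at the floor of its abscissa, so separation identifies the two. *)
Lemma row_dichotomy i : (i < N)%nat ->
  (exists l, (l < k)%nat /\ c i = (INR l / INR k, 0)) \/ / INR k <= snd (c i).
Proof.
  intros Hi. destruct (Rle_dec (/ INR k) (snd (c i))) as [|H]; [now right|left].
  destruct (Hin i Hi) as [H1 H2].
  destruct (floor_cell (fst (c i))) as [l [Hl Hx]]; [lra|].
  destruct (row_exists l Hl) as [j [Hj Ej]].
  exists l; split; [easy|]. destruct (Nat.eq_dec i j) as [->|Hij]; [easy|].
  exfalso. destruct (Hsep i j Hi Hj Hij) as [A|A]; rewrite Ej in A; simpl in A.
  - rewrite Rabs_right in A; lra.
  - rewrite Rabs_right in A; lra.
Qed.

End Rows.

(** * Compact subsets of the plane *)

Lemma Rabs_fst_edist p q : Rabs (fst p - fst q) <= edist p q.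
Proof.
  unfold edist. rewrite <- sqrt_Rsqr_abs. apply sqrt_le_1_alt.
  unfold Rsqr. pose proof (pow2_ge_0 (snd p - snd q)). lra.
Qed.

Lemma Rabs_snd_edist p q : Rabs (snd p - snd q) <= edist p q.
Proof.
  unfold edist. rewrite <- sqrt_Rsqr_abs. apply sqrt_le_1_alt.
  unfold Rsqr. pose proof (pow2_ge_0 (fst p - fst q)). lra.
Qed.

Lemma edist_le p q : edist p q <= Rabs (fst p - fst q) + Rabs (snd p - snd q).
Proof.
  pose proof (Rabs_pos (fst p - fst q)). pose proof (Rabs_pos (snd p - snd q)).
  unfold edist. rewrite <- (sqrt_Rsqr (Rabs (fst p - fst q) + Rabs (snd p - snd q))) by lra.
  apply sqrt_le_1_alt. unfold Rsqr.
  rewrite <- (pow2_abs (fst p - fst q)), <- (pow2_abs (snd p - snd q)).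
  assert (0 <= Rabs (fst p - fst q) * Rabs (snd p - snd q)) by now apply Rmult_le_pos.
  nra.
Qed.

Lemma open_coord_lt (a : pt -> R) n :
  (forall p q, Rabs (a p - a q) <= edist p q) -> opn2 (fun p => a p < n).
Proof.
  intros Ha p Hp. exists (n - a p); split; [lra|]. intros q Hq.
  specialize (Ha p q). apply Rabs_le_between in Ha. lra.
Qed.

Lemma open_coord_gt (a : pt -> R) n :
  (forall p q, Rabs (a p - a q) <= edist p q) -> opn2 (fun p => n < a p).
Proof.
  intros Ha p Hp. exists (a p - n); split; [lra|]. intros q Hq.
  specialize (Ha p q). apply Rabs_le_between in Ha. lra.
Qed.

Lemma open_or U V : opn2 U -> opn2 V -> opn2 (fun p => U p \/ V p).
Proof.
  intros HU HV p [H|H]; [destruct (HU p H) as [e [He H']]|destruct (HV p H) as [e [He H']]];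
  exists e; auto.
Qed.

Lemma open_and U V : opn2 U -> opn2 V -> opn2 (fun p => U p /\ V p).
Proof.
  intros HU HV p [H1 H2].
  destruct (HU p H1) as [e [He H]], (HV p H2) as [e' [He' H']].
  exists (Rmin e e'); split; [now apply Rmin_pos|].
  intros q Hq; split; [apply H|apply H']; eapply Rlt_le_trans; try exact Hq;
    [apply Rmin_l|apply Rmin_r].
Qed.

Lemma list_nat_bound (l : list nat) : exists n, forall i, In i l -> (i <= n)%nat.
Proof.
  induction l as [|a l [n IH]]; [now exists 0%nat|].
  exists (Nat.max a n). intros i [->|H]; [lia|]. specialize (IH i H); lia.
Qed.

Lemma compact_bounded A : cpt2 A ->
  exists B, forall p, A p -> Rabs (fst p) <= B /\ Rabs (snd p) <= B.
Proof.
  intros HS.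
  destruct (HS nat (fun n p => (fst p < INR n /\ - INR n < fst p) /\
                               (snd p < INR n /\ - INR n < snd p))) as [l Hl].
  - intros n. repeat apply open_and; try apply open_coord_lt; try apply open_coord_gt;
      auto using Rabs_fst_edist, Rabs_snd_edist.
  - intros p _. destruct (nfloor_ex (Rabs (fst p) + Rabs (snd p))) as [n Hn].
    { pose proof (Rabs_pos (fst p)); pose proof (Rabs_pos (snd p)); lra. }
    exists (S n). rewrite S_INR.
    pose proof (Rabs_pos (fst p)); pose proof (Rabs_pos (snd p)).
    assert (Rabs (fst p) < INR n + 1) by lra. assert (Rabs (snd p) < INR n + 1) by lra.
    apply Rabs_def2 in H1, H2. lra.
  - destruct (list_nat_bound l) as [n Hn]. exists (INR n). intros p Hp.
    destruct (Hl p Hp) as [i [Hi H]]. apply Hn, le_INR in Hi.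
    split; apply Rabs_le; lra.
Qed.

(** If [p] were outside [A], the complements of the closed squares of radius 1/(n+1) around [p]
    would cover [A] without a finite subcover. *)
Lemma compact_closed A p : cpt2 A ->
  (forall eps, 0 < eps -> exists x, A x /\ Rabs (fst x - fst p) < eps /\
     Rabs (snd x - snd p) < eps) -> A p.
Proof.
  intros HS H. destruct (classic (A p)) as [|Hp]; [easy|exfalso].
  destruct (HS nat (fun n x => (fst x < fst p - / INR (n + 1) \/ fst p + / INR (n + 1) < fst x) \/
     (snd x < snd p - / INR (n + 1) \/ snd p + / INR (n + 1) < snd x))) as [l Hl].
  - intros n. repeat apply open_or; try apply open_coord_lt; try apply open_coord_gt;
      auto using Rabs_fst_edist, Rabs_snd_edist.
  - intros x Hx.
    assert (Hd : 0 < Rmax (Rabs (fst x - fst p)) (Rabs (snd x - snd p))).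
    { destruct (Req_dec (fst x) (fst p)) as [E1|E1].
      - destruct (Req_dec (snd x) (snd p)) as [E2|E2].
        + exfalso; apply Hp. destruct x, p; simpl in *; subst; easy.
        + apply Rlt_le_trans with (Rabs (snd x - snd p)); [apply Rabs_pos_lt; lra|apply Rmax_r].
      - apply Rlt_le_trans with (Rabs (fst x - fst p)); [apply Rabs_pos_lt; lra|apply Rmax_l]. }
    destruct (archimed_cor1 _ Hd) as [n [Hn Hn0]].
    exists n.
    assert (Hn2 : / INR (n + 1) < Rmax (Rabs (fst x - fst p)) (Rabs (snd x - snd p))).
    { eapply Rle_lt_trans; [|exact Hn]. apply Rinv_le_contravar;
        [now apply lt_0_INR|apply le_INR; lia]. }
    revert Hn2. generalize (/ INR (n + 1)); intros e.
    unfold Rmax, Rabs; destruct (Rle_dec _ _), (Rcase_abs (fst x - fst p)),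
      (Rcase_abs (snd x - snd p)); lra.
  - destruct (list_nat_bound l) as [n Hn].
    destruct (H (/ INR (n + 1))) as [x [Hx [H1 H2]]].
    { apply Rinv_0_lt_compat, lt_0_INR; lia. }
    destruct (Hl x Hx) as [i [Hi Hc]]. apply Hn in Hi.
    assert (/ INR (n + 1) <= / INR (i + 1)).
    { apply Rinv_le_contravar; [apply lt_0_INR; lia|apply le_INR; lia]. }
    apply Rabs_def2 in H1, H2. lra.
Qed.

Lemma geometric_small q B eps : 0 <= q < 1 -> 0 <= B -> 0 < eps ->
  exists n, B * q ^ n < eps.
Proof.
  intros Hq HB He.
  destruct (pow_lt_1_zero q ltac:(rewrite Rabs_right; lra) (eps / (B + 1))) as [n Hn].
  { apply Rdiv_lt_0_compat; lra. }
  exists n. specialize (Hn n (le_n n)). apply Rabs_def2 in Hn.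
  assert (q ^ n * (B + 1) < eps).
  { replace eps with (eps / (B + 1) * (B + 1)) by (field; lra).
    apply Rmult_lt_compat_r; lra. }
  pose proof (pow_le q n (proj1 Hq)). lra.
Qed.

Lemma le_of_geometric q B a b : 0 <= q < 1 -> 0 <= B ->
  (forall n, a <= b + B * q ^ n) -> a <= b.
Proof.
  intros Hq HB H. apply le_epsilon; intros e He.
  destruct (geometric_small q B e Hq HB He) as [n Hn]. specialize (H n). lra.
Qed.

Section Carpet.

Variables (k N : nat) (c : nat -> pt) (K : pt -> Prop).
Variables (F : (pt -> R) -> Prop) (Eb : (pt -> R) -> (pt -> R) -> R) (r : R).
Hypothesis HU : USC k N c.
Hypothesis HK : attractor k N c K.
Hypothesis HR : resistance_form K F Eb.
Hypothesis HS : self_similar k N c F Eb r.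
Hypothesis HD : D4_symmetric F Eb.
Hypothesis HJ : jointly_continuous K F Eb.
Hypothesis HE : eff_res_is F Eb L2 L4 1.

Notation E f := (Eb f f).
Notation Ps := (Psi k c).
Notation ik := (/ INR k).

Lemma k_ge3 : (3 <= k)%nat.
Proof. apply HU. Qed.

Lemma k_pos : (0 < k)%nat.
Proof. pose proof k_ge3; lia. Qed.

Lemma kR_ge3 : 3 <= INR k.
Proof. replace 3 with (INR 3) by (simpl; ring). apply le_INR, k_ge3. Qed.

Lemma kR_sq_ge : 9 <= INR k ^ 2.
Proof.
  pose proof kR_ge3. replace 9 with (3 ^ 2) by ring. apply pow_incr; lra.
Qed.

Lemma ik_range : 0 < ik <= / 3.
Proof.
  pose proof kR_ge3. split; [apply Rinv_0_lt_compat; lra|apply Rinv_le_contravar; lra].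
Qed.

Lemma k_ik : INR k * ik = 1.
Proof. pose proof kR_ge3. field; lra. Qed.

Lemma r_pos : 0 < r.
Proof. apply HS. Qed.

Lemma fst_Ps i x : fst (Ps i x) = fst x * ik + fst (c i).
Proof. reflexivity. Qed.

Lemma snd_Ps i x : snd (Ps i x) = snd x * ik + snd (c i).
Proof. reflexivity. Qed.

Lemma c_range i : (i < N)%nat ->
  0 <= fst (c i) <= 1 - ik /\ 0 <= snd (c i) <= 1 - ik.
Proof.
  intros Hi. destruct HU as (_ & _ & _ & _ & _ & _ & _ & Hsq).
  pose proof ik_range.
  assert (H1 : cells k N c (c i)).
  { exists i; split; [easy|]. apply cell_iff; [apply k_pos|]. lra. }
  assert (H2 : cells k N c (fst (c i) + ik, snd (c i) + ik)).
  { exists i; split; [easy|]. apply cell_iff; [apply k_pos|]. simpl; lra. }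
  apply Hsq in H1, H2. unfold sq0 in *; simpl in *. lra.
Qed.

Lemma D4_swap : In (fun p : pt => (snd p, fst p)) D4.
Proof. simpl; tauto. Qed.

Lemma D4_refx : In (fun p : pt => (1 - fst p, snd p)) D4.
Proof. simpl; tauto. Qed.

Lemma D4_refy : In (fun p : pt => (fst p, 1 - snd p)) D4.
Proof. simpl; tauto. Qed.

Lemma cover_D4 g t : In g D4 -> 0 <= t <= 1 -> exists i, (i < N)%nat /\
  fst (c i) <= fst (g (t, 0)) <= fst (c i) + ik /\
  snd (c i) <= snd (g (t, 0)) <= snd (c i) + ik.
Proof.
  intros Hg Ht. destruct HU as (_ & _ & _ & _ & _ & Hinv & HL & _).
  assert (H : cells k N c (t, 0)).
  { apply HL. exists t; split; [easy|]. unfold gamma; simpl. f_equal; ring. }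
  apply (Hinv g Hg) in H. destruct H as [i [Hi Hc]]. exists i; split; [easy|].
  apply cell_iff in Hc; [easy|apply k_pos].
Qed.

Lemma separated i j : (i < N)%nat -> (j < N)%nat -> i <> j ->
  ik <= Rabs (fst (c i) - fst (c j)) \/ ik <= Rabs (snd (c i) - snd (c j)).
Proof. apply (cells_separated k N c i j HU). Qed.

Lemma bottom_cover t : 0 <= t <= 1 ->
  exists i, (i < N)%nat /\ snd (c i) = 0 /\ fst (c i) <= t <= fst (c i) + ik.
Proof.
  intros Ht. destruct (cover_D4 (fun p => p) t) as [i [Hi H]]; [simpl; tauto|easy|].
  simpl in H. exists i. pose proof (c_range i Hi). repeat split; try easy; lra.
Qed.

Lemma bottom_exists l : (l < k)%nat -> exists i, (i < N)%nat /\ c i = (INR l / INR k, 0).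
Proof.
  apply row_exists; [apply k_ge3|apply separated|apply c_range|apply bottom_cover].
Qed.

Lemma bottom_dichotomy i : (i < N)%nat ->
  (exists l, (l < k)%nat /\ c i = (INR l / INR k, 0)) \/ ik <= snd (c i).
Proof.
  apply row_dichotomy; [apply k_ge3|apply separated|apply c_range|apply bottom_cover].
Qed.

Lemma top_row :
  (forall l, (l < k)%nat -> exists i, (i < N)%nat /\ c i = (INR l / INR k, 1 - ik)) /\
  (forall i, (i < N)%nat ->
    (exists l, (l < k)%nat /\ c i = (INR l / INR k, 1 - ik)) \/ snd (c i) <= 1 - 2 * ik).
Proof.
  (* Placement reflected in the horizontal midline; the extra [ik] appears because [c] records lower
     left corners. *)
  set (c' := fun i => (fst (c i), 1 - ik - snd (c i))).
  assert (A1 : forall i j, (i < N)%nat -> (j < N)%nat -> i <> j ->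
    ik <= Rabs (fst (c' i) - fst (c' j)) \/ ik <= Rabs (snd (c' i) - snd (c' j))).
  { intros i j Hi Hj Hij. unfold c'; simpl.
    replace (1 - ik - snd (c i) - (1 - ik - snd (c j))) with (- (snd (c i) - snd (c j))) by ring.
    rewrite Rabs_Ropp. now apply separated. }
  assert (A2 : forall i, (i < N)%nat ->
    0 <= fst (c' i) <= 1 - ik /\ 0 <= snd (c' i) <= 1 - ik).
  { intros i Hi. pose proof (c_range i Hi). unfold c'; simpl. lra. }
  assert (A3 : forall t, 0 <= t <= 1 ->
    exists i, (i < N)%nat /\ snd (c' i) = 0 /\ fst (c' i) <= t <= fst (c' i) + ik).
  { intros t Ht. destruct (cover_D4 _ t D4_refy Ht) as [i [Hi H]]. simpl in H.
    exists i. pose proof (c_range i Hi). unfold c'; simpl. repeat split; try easy; lra. }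
  split.
  - intros l Hl. destruct (row_exists k N c' k_ge3 A1 A2 A3 l Hl) as [i [Hi H]].
    exists i; split; [easy|]. unfold c' in H. inversion H as [[H1 H2]].
    destruct (c i) as [a b]; simpl in *. f_equal; lra.
  - intros i Hi. destruct (row_dichotomy k N c' k_ge3 A1 A2 A3 i Hi) as [[l [Hl H]]|H].
    + left. exists l; split; [easy|]. unfold c' in H. inversion H as [[H1 H2]].
      destruct (c i) as [a b]; simpl in *. f_equal; lra.
    + right. unfold c' in H; simpl in H. lra.
Qed.

Lemma left_exists l : (l < k)%nat -> exists i, (i < N)%nat /\ c i = (0, INR l / INR k).
Proof.
  set (c' := fun i => (snd (c i), fst (c i))). intros Hl.
  destruct (row_exists k N c' k_ge3) with (l := l) as [i [Hi H]]; try easy.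
  - intros i j Hi Hj Hij. unfold c'; simpl. destruct (separated i j Hi Hj Hij); tauto.
  - intros i Hi. pose proof (c_range i Hi). unfold c'; simpl. lra.
  - intros t Ht. destruct (cover_D4 _ t D4_swap Ht) as [i [Hi H]]. simpl in H.
    exists i. pose proof (c_range i Hi). unfold c'; simpl. repeat split; try easy; lra.
  - exists i; split; [easy|]. unfold c' in H. inversion H as [[H1 H2]].
    destruct (c i) as [a b]; simpl in *. now subst.
Qed.

Lemma right_exists l : (l < k)%nat -> exists i, (i < N)%nat /\ c i = (1 - ik, INR l / INR k).
Proof.
  set (c' := fun i => (snd (c i), 1 - ik - fst (c i))). intros Hl.
  destruct (row_exists k N c' k_ge3) with (l := l) as [i [Hi H]]; try easy.
  - intros i j Hi Hj Hij. unfold c'; simpl.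
    replace (1 - ik - fst (c i) - (1 - ik - fst (c j))) with (- (fst (c i) - fst (c j))) by ring.
    rewrite Rabs_Ropp. destruct (separated i j Hi Hj Hij); tauto.
  - intros i Hi. pose proof (c_range i Hi). unfold c'; simpl. lra.
  - intros t Ht.
    destruct (cover_D4 (fun p => (1 - snd p, fst p)) t) as [i [Hi H]]; [simpl; tauto|easy|].
    simpl in H.
    exists i. pose proof (c_range i Hi). unfold c'; simpl. repeat split; try easy; lra.
  - exists i; split; [easy|]. unfold c' in H. inversion H as [[H1 H2]].
    destruct (c i) as [a b]; simpl in *. f_equal; lra.
Qed.

(** * The attractor *)

Lemma K_image i x : (i < N)%nat -> K x -> K (Ps i x).
Proof. intros Hi Hx. destruct HK as (_ & _ & H). apply H. now exists i, x. Qed.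

Lemma K_preimage p : K p -> exists i x, (i < N)%nat /\ K x /\ p = Ps i x.
Proof. intros Hp. destruct HK as (_ & _ & H). now apply H. Qed.

(** Compactness gives some excess over the unit square, and self-similarity divides it by k at every
    generation. *)
Lemma K_in_square p : K p -> 0 <= fst p <= 1 /\ 0 <= snd p <= 1.
Proof.
  destruct HK as (_ & HC & _). destruct (compact_bounded K HC) as [B HB].
  pose proof ik_range as Hik.
  assert (H : forall n p, K p -> (- (B * ik ^ n) <= fst p <= 1 + B * ik ^ n) /\
                                 (- (B * ik ^ n) <= snd p <= 1 + B * ik ^ n)).
  { induction n as [|n IH]; intros q Hq.
    - destruct (HB q Hq) as [H1 H2]. apply Rabs_le_between in H1, H2. simpl. lra.
    - destruct (K_preimage q Hq) as [i [x [Hi [Hx ->]]]].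
      destruct (IH x Hx) as [[A1 A2] [A3 A4]]. pose proof (c_range i Hi) as Hc.
      rewrite fst_Ps, snd_Ps. simpl.
      assert (forall a, - (B * ik ^ n) <= a -> - (B * (ik * ik ^ n)) <= a * ik).
      { intros a Ha. apply Rmult_le_compat_r with (r := ik) in Ha; lra. }
      assert (forall a, a <= 1 + B * ik ^ n -> a * ik <= ik + B * (ik * ik ^ n)).
      { intros a Ha. apply Rmult_le_compat_r with (r := ik) in Ha; lra. }
      pose proof (H _ A1). pose proof (H _ A3). pose proof (H0 _ A2). pose proof (H0 _ A4).
      lra. }
  intros Hp.
  assert (HB0 : 0 <= B) by (destruct (HB p Hp); pose proof (Rabs_pos (fst p)); lra).
  repeat split; apply (le_of_geometric ik B); try lra; intros n;
    destruct (H n p Hp); lra.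
Qed.

(** The point lies in bottom cells of every generation, and each of them contains a point of [K];
    closedness concludes. *)
Lemma bottom_in_K t : 0 <= t <= 1 -> K (t, 0).
Proof.
  intros Ht. destruct HK as ((x0 & Hx0) & HC & _). apply compact_closed; [easy|].
  pose proof ik_range as Hik. pose proof k_ik as Hkik. pose proof kR_ge3.
  assert (H1 : forall n t, 0 <= t <= 1 -> exists x, K x /\
     Rabs (fst x - t) <= 1 * ik ^ n /\ Rabs (snd x - 0) <= 1 * ik ^ n).
  { induction n as [|n IH]; intros s Hs.
    - exists x0; split; [easy|]. pose proof (K_in_square x0 Hx0).
      simpl; split; apply Rabs_le; lra.
    - destruct (bottom_cover s Hs) as [i [Hi [Ei His]]].
      destruct (IH (INR k * (s - fst (c i)))) as [x [Hx [A B]]].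
      { split; [apply Rmult_le_pos; lra|]. rewrite <- k_ik. apply Rmult_le_compat_l; lra. }
      exists (Ps i x). split; [now apply K_image|]. rewrite fst_Ps, snd_Ps, Ei.
      replace (fst x * ik + fst (c i) - s) with (ik * (fst x - INR k * (s - fst (c i))))
        by (field; lra).
      replace (snd x * ik + 0 - 0) with (ik * (snd x - 0)) by ring.
      rewrite !Rabs_mult, (Rabs_right ik) by lra. simpl.
      split; (replace (1 * (ik * ik ^ n)) with (ik * (1 * ik ^ n)) by ring);
        apply Rmult_le_compat_l; lra. }
  intros e He. destruct (geometric_small ik 1 e) as [n Hn]; try lra.
  destruct (H1 n t Ht) as [x [Hx [A B]]]. exists x. simpl. split; [easy|split; lra].
Qed.

(** * Resistance forms *)

Lemma F_local u v : F u -> agree K u v -> F v.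
Proof. apply (rf_local_F _ _ _ HR). Qed.

Lemma E_local u v : F u -> agree K u v -> E u = E v.
Proof.
  intros Hu Ha. assert (Hv : F v) by (eapply F_local; eauto).
  rewrite (rf_local_E _ _ _ HR u v u) by easy.
  rewrite (rf_sym _ _ _ HR) by easy. now apply (rf_local_E _ _ _ HR).
Qed.

Lemma F_const a : F (fun _ => a).
Proof. apply (rf_const _ _ _ HR). Qed.

Lemma E_nonneg u : F u -> 0 <= E u.
Proof. apply (rf_nonneg _ _ _ HR). Qed.

Lemma E_const a : E (fun _ => a) = 0.
Proof. apply (rf_zero _ _ _ HR); [apply F_const|]. now exists a. Qed.

Lemma F_lin a u v : F u -> F v -> F (fun x => a * u x + v x).
Proof. apply (rf_lin _ _ _ HR). Qed.

Lemma E_lin a u v : F u -> F v ->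
  E (fun x => a * u x + v x) = a ^ 2 * E u + 2 * a * Eb u v + E v.
Proof.
  intros Hu Hv. assert (Hw := F_lin a u v Hu Hv).
  rewrite (rf_bilin _ _ _ HR) by easy.
  rewrite (rf_sym _ _ _ HR u), (rf_sym _ _ _ HR v) by easy.
  rewrite !(rf_bilin _ _ _ HR) by easy. rewrite (rf_sym _ _ _ HR v u) by easy. ring.
Qed.

(** Constants have energy 0, so [t ^ 2 * E u + 2 * t * b] is nonnegative for all t, which forces
    [b = 0]. *)
Lemma Eb_const u a : F u -> Eb u (fun _ => a) = 0.
Proof.
  intros Hu. set (b := Eb u (fun _ => a)).
  assert (H : forall t, 0 <= t ^ 2 * E u + 2 * t * b).
  { intros t. pose proof (E_nonneg _ (F_lin t u _ Hu (F_const a))) as H.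
    rewrite E_lin, E_const in H by (try apply F_const; easy). fold b in H. lra. }
  destruct (Req_dec b 0) as [|Hb]; [easy|exfalso].
  (* Adding 1 to the denominator covers the case [E u = 0] as well. *)
  pose proof (E_nonneg u Hu) as He. specialize (H (- b / (E u + 1))).
  assert (Hb2 : 0 < b ^ 2) by (apply pow2_gt_0; easy).
  assert (Hq : (- b / (E u + 1)) ^ 2 * E u + 2 * (- b / (E u + 1)) * b =
     - (b ^ 2 * (E u + 2) / (E u + 1) ^ 2)) by (field; lra).
  rewrite Hq in H.
  assert (0 < b ^ 2 * (E u + 2) / (E u + 1) ^ 2).
  { apply Rdiv_lt_0_compat; [apply Rmult_lt_0_compat; lra|apply pow_lt; lra]. }
  lra.
Qed.

Lemma F_aff a b u : F u -> F (fun x => a * u x + b).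
Proof. intros Hu. now apply (F_lin a u (fun _ => b)), F_const. Qed.

Lemma E_aff a b u : F u -> E (fun x => a * u x + b) = a ^ 2 * E u.
Proof.
  intros Hu. rewrite (E_lin a u (fun _ => b)), Eb_const, E_const by (try apply F_const; easy).
  ring.
Qed.

Lemma F_plus u v : F u -> F v -> F (fun x => u x + v x).
Proof.
  intros Hu Hv. apply F_local with (fun x => 1 * u x + v x); [now apply F_lin|].
  intros x _; ring.
Qed.

Lemma F_scal a u : F u -> F (fun x => a * u x).
Proof.
  intros Hu. apply F_local with (fun x => a * u x + 0); [now apply F_aff|].
  intros x _; ring.
Qed.

Lemma E_scal a u : F u -> E (fun x => a * u x) = a ^ 2 * E u.
Proof.
  intros Hu. rewrite <- (E_aff a 0 u Hu). apply E_local; [now apply F_scal|].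
  intros x _; ring.
Qed.

Lemma F_minus u v : F u -> F v -> F (fun x => u x - v x).
Proof.
  intros Hu Hv. apply F_local with (fun x => (-1) * v x + u x); [now apply F_lin|].
  intros x _; ring.
Qed.

Lemma parallelogram u v : F u -> F v ->
  E (fun x => u x + v x) + E (fun x => u x - v x) = 2 * E u + 2 * E v.
Proof.
  intros Hu Hv.
  rewrite (E_local (fun x => u x + v x) (fun x => 1 * v x + u x));
    [|now apply F_plus|intros x _; ring].
  rewrite (E_local (fun x => u x - v x) (fun x => (-1) * v x + u x));
    [|now apply F_minus|intros x _; ring].
  rewrite !E_lin by easy. ring.
Qed.

Lemma E_plus_le u v : F u -> F v -> E (fun x => u x + v x) <= 2 * E u + 2 * E v.
Proof.
  intros Hu Hv. pose proof (parallelogram u v Hu Hv).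
  pose proof (E_nonneg _ (F_minus u v Hu Hv)). lra.
Qed.

Lemma E_minus_le u v : F u -> F v -> E (fun x => u x - v x) <= 2 * E u + 2 * E v.
Proof.
  intros Hu Hv. pose proof (parallelogram u v Hu Hv).
  pose proof (E_nonneg _ (F_plus u v Hu Hv)). lra.
Qed.

Lemma F_mean u v : F u -> F v -> F (fun x => (u x + v x) / 2).
Proof.
  intros Hu Hv. apply F_local with (fun x => / 2 * (u x + v x)).
  - now apply F_scal, F_plus.
  - intros x _; field.
Qed.

Lemma E_mean_le u v : F u -> F v -> E (fun x => (u x + v x) / 2) <= (E u + E v) / 2.
Proof.
  intros Hu Hv. rewrite <- (E_local (fun x => / 2 * (u x + v x))).
  - rewrite E_scal by now apply F_plus. pose proof (E_plus_le u v Hu Hv). lra.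
  - now apply F_scal, F_plus.
  - intros x _; field.
Qed.

Definition clip (u : pt -> R) (x : pt) : R := Rmin (Rmax (u x) 0) 1.

Lemma F_clip u : F u -> F (clip u).
Proof. intros Hu. apply (rf_markov _ _ _ HR u Hu). Qed.

Lemma E_clip u : F u -> E (clip u) <= E u.
Proof. intros Hu. apply (rf_markov _ _ _ HR u Hu). Qed.

Lemma clip_range u x : 0 <= clip u x <= 1.
Proof.
  unfold clip, Rmin, Rmax. destruct (Rle_dec (u x) 0), (Rle_dec _ 1); lra.
Qed.

Lemma clip_le0 u x : u x <= 0 -> clip u x = 0.
Proof. intros H. unfold clip, Rmin, Rmax. destruct (Rle_dec (u x) 0), (Rle_dec _ 1); lra. Qed.

Lemma clip_ge1 u x : 1 <= u x -> clip u x = 1.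
Proof. intros H. unfold clip, Rmin, Rmax. destruct (Rle_dec (u x) 0), (Rle_dec _ 1); lra. Qed.

Definition unit_valued (u : pt -> R) : Prop := forall x, K x -> 0 <= u x <= 1.

(** The minimum is [u] minus the positive part of [u - v]. For unit-valued functions this positive
    part is at most 1, hence equals the unit clip, to which the Markov property applies. *)
Lemma F_min u v : F u -> F v -> unit_valued u -> unit_valued v ->
  F (fun x => Rmin (u x) (v x)) /\
  E (fun x => Rmin (u x) (v x)) <= 6 * (E u + E v).
Proof.
  intros Hu Hv Iu Iv.
  assert (Hw : F (fun x => u x - v x)) by now apply F_minus.
  assert (Ha : agree K (fun x => u x - clip (fun x => u x - v x) x) (fun x => Rmin (u x) (v x))).
  { intros x Hx. specialize (Iu x Hx); specialize (Iv x Hx).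
    unfold clip, Rmin, Rmax. destruct (Rle_dec (u x - v x) 0), (Rle_dec (u x) (v x));
      destruct (Rle_dec _ 1); lra. }
  assert (Hm : F (fun x => u x - clip (fun x => u x - v x) x)).
  { apply F_minus; [easy|]. now apply F_clip. }
  split; [eapply F_local; eauto|].
  rewrite <- (E_local _ _ Hm Ha).
  pose proof (E_minus_le u _ Hu (F_clip _ Hw)). pose proof (E_clip _ Hw).
  pose proof (E_minus_le u v Hu Hv). pose proof (E_nonneg u Hu). pose proof (E_nonneg v Hv).
  lra.
Qed.

Lemma F_D4 g f : In g D4 -> F f -> F (fun p => f (g p)).
Proof. intros Hg Hf. now apply HD. Qed.

Lemma E_D4 g f : In g D4 -> F f -> E (fun p => f (g p)) = E f.
Proof. intros Hg Hf. now apply HD. Qed.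

Lemma D4_injective g x y : In g D4 -> g x = g y -> x = y.
Proof.
  intros Hg H. destruct x as [x1 x2], y as [y1 y2]. simpl in Hg.
  repeat destruct Hg as [<-|Hg]; try easy; simpl in H; inversion H; f_equal; lra.
Qed.

(* The indicator of a point outside K is 0 in F, and composing it with g would
   otherwise give a non-constant function of energy 0. *)
Lemma K_D4 g p : In g D4 -> K p -> K (g p).
Proof.
  intros Hg Hp. destruct (classic (K (g p))) as [|Hn]; [easy|exfalso].
  set (w := fun x : pt => if excluded_middle_informative (x = g p) then 1 else 0).
  assert (Ha : agree K (fun _ => 0) w).
  { intros x Hx. unfold w. destruct (excluded_middle_informative _) as [->|]; easy. }
  assert (Hw : F w) by (eapply F_local; [apply (F_const 0)|easy]).
  assert (Ew : E w = 0).
  { rewrite <- (E_local (fun _ => 0) w); [apply E_const|apply F_const|easy]. }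
  assert (H0 : E (fun x => w (g x)) = 0) by now rewrite E_D4.
  apply (rf_zero _ _ _ HR) in H0; [|now apply F_D4].
  destruct H0 as [a Hc].
  assert (H1 : a = 1).
  { rewrite <- (Hc p Hp). unfold w. now destruct (excluded_middle_informative _). }
  assert (H2 : forall x, K x -> x = p).
  { intros x Hx. specialize (Hc x Hx). unfold w in Hc.
    destruct (excluded_middle_informative _) as [He|]; [|lra].
    now apply (D4_injective g). }
  assert (A : (0, 0) = (1, 0) :> pt).
  { rewrite (H2 (0, 0)), (H2 (1, 0)); try easy; apply bottom_in_K; lra. }
  inversion A; lra.
Qed.

(** * The boundary of the square and the contacts between cells *)

Definition on_bdry (p : pt) : Prop :=
  (0 <= fst p <= 1 /\ (snd p = 0 \/ snd p = 1)) \/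
  (0 <= snd p <= 1 /\ (fst p = 0 \/ fst p = 1)).

Lemma bdry_in_K p : on_bdry p -> K p.
Proof.
  destruct p as [x y]; intros [[Hx [Hy|Hy]]|[Hy [Hx|Hx]]]; simpl in *; subst.
  - now apply bottom_in_K.
  - pose proof (K_D4 _ _ D4_refy (bottom_in_K x Hx)) as H; simpl in H.
    now replace (1 - 0) with 1 in H by ring.
  - apply (K_D4 _ _ D4_swap (bottom_in_K y Hy)).
  - pose proof (K_D4 (fun p => (1 - snd p, fst p)) (y, 0) ltac:(simpl; tauto) (bottom_in_K y Hy)) as H.
    simpl in H. now replace (1 - 0) with 1 in H by ring.
Qed.

Lemma edges_meet a b ca cb : 0 <= a <= 1 -> 0 <= b <= 1 -> a * ik + ca = b * ik + cb ->
  ik <= Rabs (ca - cb) -> (a = 0 /\ b = 1) \/ (a = 1 /\ b = 0).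
Proof.
  intros Ha Hb H Hc. pose proof ik_range.
  replace (ca - cb) with ((b - a) * ik) in Hc by lra.
  rewrite Rabs_mult, (Rabs_right ik) in Hc by lra.
  assert (H1 : 1 <= Rabs (b - a)) by (apply (Rmult_le_reg_r ik); lra).
  unfold Rabs in H1; destruct (Rcase_abs (b - a)); lra.
Qed.

(** Distinct cells meet only along their edges; compatibility of glued pieces therefore needs to be
    checked on the boundary of the square only. *)
Lemma common_point i j x y : (i < N)%nat -> (j < N)%nat -> K x -> K y -> i <> j ->
  Ps i x = Ps j y -> on_bdry x /\ on_bdry y.
Proof.
  intros Hi Hj Hx Hy Hij He.
  assert (E1 : fst (Ps i x) = fst (Ps j y)) by now rewrite He.
  assert (E2 : snd (Ps i x) = snd (Ps j y)) by now rewrite He.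
  rewrite !fst_Ps in E1. rewrite !snd_Ps in E2.
  pose proof (K_in_square x Hx) as [X1 X2]. pose proof (K_in_square y Hy) as [Y1 Y2].
  unfold on_bdry.
  destruct (separated i j Hi Hj Hij) as [H|H].
  - destruct (edges_meet _ _ _ _ X1 Y1 E1 H); tauto.
  - destruct (edges_meet _ _ _ _ X2 Y2 E2 H); tauto.
Qed.

(** * The bottom row and the splitting of the energy *)

Lemma c_injective i j : (i < N)%nat -> (j < N)%nat -> c i = c j -> i = j.
Proof.
  intros Hi Hj H. destruct (Nat.eq_dec i j) as [|Hij]; [easy|exfalso].
  pose proof ik_range. destruct (separated i j Hi Hj Hij) as [A|A];
    rewrite H, Rminus_diag, Rabs_R0 in A; lra.
Qed.

Lemma bottom_exists_total l :
  exists i, (l < k)%nat -> (i < N)%nat /\ c i = (INR l / INR k, 0).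
Proof.
  destruct (Nat.lt_ge_cases l k) as [H|H]; [|exists 0%nat; lia].
  destruct (bottom_exists l H) as [i Hi]. now exists i.
Qed.

Definition bot (l : nat) : nat :=
  proj1_sig (constructive_indefinite_description _ (bottom_exists_total l)).

Lemma bot_spec l : (l < k)%nat -> (bot l < N)%nat /\ c (bot l) = (INR l / INR k, 0).
Proof.
  intros Hl. unfold bot. destruct (constructive_indefinite_description _ _) as [i Hi].
  now apply Hi.
Qed.

Lemma Ps_bot l x : (l < k)%nat ->
  Ps (bot l) x = (INR l / INR k + fst x / INR k, snd x / INR k).
Proof.
  intros Hl. destruct (bot_spec l Hl) as [_ H]. unfold Psi. rewrite H. simpl.
  f_equal; ring.
Qed.

(** Up to a permutation the indices of height 0 are [bot 0], ..., [bot (k-1)]. This passes from the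
    arbitrary numbering of the cells to their order along the side. *)
Lemma rsum_bottom q :
  rsum N (fun i => if Req_EM_T (snd (c i)) 0 then q i else 0) = rsum k (fun l => q (bot l)).
Proof.
  set (p := fun i => if Req_EM_T (snd (c i)) 0 then true else false).
  rewrite (rsum_ext N _ (fun i => if p i then q i else 0)).
  2:{ intros i _. unfold p. now destruct (Req_EM_T (snd (c i)) 0). }
  unfold rsum. rewrite sumR_map_filter, <- (map_map bot q). apply sumR_perm, Permutation_map.
  apply NoDup_Permutation.
  - apply NoDup_filter, seq_NoDup.
  - apply NoDup_map_NoDup_ForallPairs; [|apply seq_NoDup].
    intros a b Ha Hb Hab. apply in_seq in Ha, Hb.
    destruct (bot_spec a) as [_ A]; [lia|]. destruct (bot_spec b) as [_ B]; [lia|].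
    rewrite Hab, B in A. inversion A as [A'].
    apply Rmult_eq_reg_r in A'; [now apply INR_eq in A'|pose proof ik_range; lra].
  - intros i. rewrite filter_In, in_map_iff, in_seq. unfold p. split.
    + intros [Hi Hp]. destruct (Req_EM_T (snd (c i)) 0) as [E0|]; [|easy].
      destruct (bottom_dichotomy i) as [[l [Hl Hc]]|H]; [lia| |pose proof ik_range; lra].
      exists l. rewrite in_seq; split; [|lia]. destruct (bot_spec l Hl) as [Hb Hbc].
      apply c_injective; [easy|lia|congruence].
    + intros [l [<- Hl]]. apply in_seq in Hl. destruct (bot_spec l) as [Hb Hc]; [lia|].
      split; [lia|]. rewrite Hc; simpl. destruct (Req_EM_T 0 0) as [|n]; [easy|now elim n].
Qed.

Lemma F_Ps f i : F f -> (i < N)%nat -> F (fun x => f (Ps i x)).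
Proof. intros Hf Hi. destruct HS as (_ & H & _). exact (proj1 (H f) Hf i Hi). Qed.

Lemma E_self_similar f : F f -> E f = / r * rsum N (fun i => E (fun x => f (Ps i x))).
Proof. intros Hf. destruct HS as (_ & _ & H). rewrite (H f Hf). apply rsum_scal. Qed.

(** Taken over the bottom cells of successive generations and suitably weighted, these energies
    belong to disjoint families of cells, so their sum stays below the total energy. *)
Definition nonbottom_energy (f : pt -> R) : R :=
  / r * rsum N (fun i => if Req_EM_T (snd (c i)) 0 then 0 else E (fun x => f (Ps i x))).

Lemma E_split f : F f ->
  E f = / r * rsum k (fun l => E (fun x => f (Ps (bot l) x))) + nonbottom_energy f.
Proof.
  intros Hf. rewrite (E_self_similar f Hf). unfold nonbottom_energy.
  rewrite <- (rsum_bottom (fun i => E (fun x => f (Ps i x)))).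
  rewrite <- Rmult_plus_distr_l, <- rsum_plus. f_equal. apply rsum_ext; intros i _.
  destruct (Req_EM_T _ _); ring.
Qed.

Lemma r_inv_pos : 0 < / r.
Proof. apply Rinv_0_lt_compat, r_pos. Qed.

Lemma E_Ps_nonneg f i : F f -> (i < N)%nat -> 0 <= E (fun x => f (Ps i x)).
Proof. intros. now apply E_nonneg, F_Ps. Qed.

Lemma nonbottom_nonneg f : F f -> 0 <= nonbottom_energy f.
Proof.
  intros Hf. apply Rmult_le_pos; [left; apply r_inv_pos|].
  apply rsum_nonneg; intros i Hi. destruct (Req_EM_T _ _); [lra|now apply E_Ps_nonneg].
Qed.

Lemma bottom_le f : F f -> / r * rsum k (fun l => E (fun x => f (Ps (bot l) x))) <= E f.
Proof. intros Hf. rewrite (E_split f Hf). pose proof (nonbottom_nonneg f Hf). lra. Qed.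

Lemma E_Ps_nonbottom f i : F f -> (i < N)%nat -> snd (c i) <> 0 ->
  E (fun x => f (Ps i x)) <= r * nonbottom_energy f.
Proof.
  intros Hf Hi Hc. unfold nonbottom_energy. pose proof r_pos.
  rewrite <- Rmult_assoc, Rinv_r, Rmult_1_l by lra.
  set (g := fun j => if Req_EM_T (snd (c j)) 0 then 0 else E (fun x => f (Ps j x))).
  replace (E (fun x => f (Ps i x))) with (g i).
  - apply rsum_term_le; [easy|]. intros j Hj. unfold g.
    destruct (Req_EM_T _ _); [lra|now apply E_Ps_nonneg].
  - unfold g. now destruct (Req_EM_T _ _).
Qed.

Lemma E_Ps_le f i : F f -> (i < N)%nat -> E (fun x => f (Ps i x)) <= r * E f.
Proof.
  intros Hf Hi. rewrite (E_self_similar f Hf). pose proof r_pos.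
  rewrite <- Rmult_assoc, Rinv_r, Rmult_1_l by lra.
  apply (rsum_term_le N (fun i => E (fun x => f (Ps i x)))); [easy|].
  intros j Hj. now apply E_Ps_nonneg.
Qed.

(** * Gluing *)

Definition compatible (f : nat -> pt -> R) : Prop :=
  forall i j x y, (i < N)%nat -> (j < N)%nat -> K x -> K y ->
    i <> j -> Ps i x = Ps j y -> f i x = f j y.

(** A cell and a preimage are chosen for each point of [K]; compatibility makes the value
    independent of the choice. *)
Definition glue (f : nat -> pt -> R) (p : pt) : R :=
  match excluded_middle_informative (exists i x, (i < N)%nat /\ K x /\ p = Ps i x) with
  | left H => let s := constructive_indefinite_description _ H in
              f (proj1_sig s) (proj1_sig (constructive_indefinite_description _ (proj2_sig s)))
  | right _ => 0
  end.

Lemma Ps_injective i x y : Ps i x = Ps i y -> x = y.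
Proof.
  intros H. pose proof ik_range. inversion H as [[H1 H2]].
  destruct x as [x1 x2], y as [y1 y2]; simpl in *. unfold Rdiv in *.
  f_equal; apply (Rmult_eq_reg_r ik); lra.
Qed.

Lemma glue_spec f i x : compatible f -> (i < N)%nat -> K x -> glue f (Ps i x) = f i x.
Proof.
  intros Hc Hi Hx. unfold glue.
  destruct (excluded_middle_informative _) as [H|H]; [|exfalso; apply H; now exists i, x].
  destruct (constructive_indefinite_description _ H) as [j Hj]; simpl.
  destruct (constructive_indefinite_description _ Hj) as [y (Hj1 & Hy & He)]; simpl.
  destruct (Nat.eq_dec i j) as [->|Hij].
  - apply Ps_injective in He. now subst.
  - symmetry. now apply (Hc i j x y).
Qed.

Lemma glue_Ps f i : compatible f -> (i < N)%nat -> agree K (f i) (fun x => glue f (Ps i x)).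
Proof. intros Hc Hi x Hx. symmetry. now apply glue_spec. Qed.

Lemma F_glue f : compatible f -> (forall i, (i < N)%nat -> F (f i)) -> F (glue f).
Proof.
  intros Hc Hf. destruct HS as (_ & H & _). apply H. intros i Hi.
  apply F_local with (f i); [now apply Hf|now apply glue_Ps].
Qed.

Lemma E_glue f : compatible f -> (forall i, (i < N)%nat -> F (f i)) ->
  E (glue f) = / r * rsum N (fun i => E (f i)).
Proof.
  intros Hc Hf. rewrite (E_self_similar _ (F_glue f Hc Hf)). f_equal.
  apply rsum_ext; intros i Hi. symmetry. apply E_local; [now apply Hf|now apply glue_Ps].
Qed.

(** * Continuity, and the two sides of the normalization R(L_2,L_4) = 1 *)

Lemma point_bound x y : K x -> K y ->
  exists M, 0 <= M /\ forall u, F u -> (u x - u y) ^ 2 <= M * E u.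
Proof.
  intros Hx Hy. destruct (rf_bounded _ _ _ HR x y Hx Hy) as [M HM].
  exists (Rmax M 0). split; [apply Rmax_r|]. intros u Hu.
  pose proof (E_nonneg u Hu) as He.
  destruct (Req_dec (E u) 0) as [E0|E0].
  - apply (rf_zero _ _ _ HR u Hu) in E0 as [a Ha].
    rewrite (Ha x Hx), (Ha y Hy), Rminus_diag.
    assert (0 <= Rmax M 0 * E u) by (apply Rmult_le_pos; [apply Rmax_r|easy]). simpl; lra.
  - assert (He' : 0 < E u) by lra. specialize (HM u Hu He').
    apply Rle_trans with (M * E u).
    + apply (Rmult_le_compat_r (E u)) in HM; [|easy]. unfold Rdiv in HM.
      rewrite Rmult_assoc, Rinv_l in HM by easy. lra.
    + apply Rmult_le_compat_r; [easy|apply Rmax_l].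
Qed.

Lemma E_pos u x y : F u -> K x -> K y -> u x <> u y -> 0 < E u.
Proof.
  intros Hu Hx Hy Hne. destruct (Rle_lt_or_eq_dec _ _ (E_nonneg u Hu)) as [|E0]; [easy|].
  symmetry in E0. apply (rf_zero _ _ _ HR u Hu) in E0 as [a Ha].
  exfalso; apply Hne. now rewrite (Ha x Hx), (Ha y Hy).
Qed.

(** The square of [f x - f y] is at most [rho x y * E f], and the resistance metric is continuous
    and vanishes on the diagonal. *)
Lemma F_continuous f : F f -> cont_on K f.
Proof.
  intros Hf x Hx eps Heps. destruct HJ as (rho & Hrho & Hcont).
  pose proof (E_nonneg f Hf) as He.
  destruct (Hcont x x Hx Hx (eps ^ 2 / (E f + 1))) as [del [Hdel Hc]].
  { apply Rdiv_lt_0_compat; [apply pow_lt|]; lra. }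
  exists del; split; [easy|]. intros y Hy Hxy.
  destruct (Req_dec (f x) (f y)) as [Hfe|Hfe]; [rewrite Hfe, Rminus_diag, Rabs_R0; lra|].
  assert (Hne : x <> y) by (intros ->; easy).
  destruct (Hrho x x Hx Hx) as [H0 _]. destruct (Hrho x y Hx Hy) as [_ H1].
  specialize (H0 eq_refl). specialize (H1 Hne). destruct H1 as [H1 _].
  assert (Hxx : edist x x < del).
  { unfold edist. rewrite !Rminus_diag. replace (0 ^ 2 + 0 ^ 2) with 0 by ring.
    now rewrite sqrt_0. }
  specialize (Hc x y Hx Hy Hxx Hxy). rewrite H0, Rminus_0_r in Hc.
  apply Rabs_def2 in Hc as [Hc _].
  set (d := f y - f x). assert (Hd : d <> 0) by (unfold d; lra).
  (* Affine normalization with value 0 at [x] and 1 at [y], a competitor in the definition of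
     [rho x y]. *)
  set (g := fun z => / d * f z + - (f x / d)).
  assert (Hg : F g) by now apply F_aff.
  assert (Eg : E g = E f / d ^ 2) by (unfold g; rewrite E_aff by easy; field; easy).
  assert (HEf : 0 < E f) by now apply (E_pos f x y).
  assert (Hd2 : 0 < d ^ 2) by now apply pow2_gt_0.
  assert (H2 : d ^ 2 / E f <= rho x y).
  { apply H1. exists g. split; [easy|]. split; [|split].
    - intros z ->. unfold g; field; easy.
    - intros z ->. unfold g, d; field; easy.
    - rewrite Eg. field; split; lra. }
  assert (H3 : d ^ 2 < eps ^ 2).
  { assert (H3 : d ^ 2 / E f < eps ^ 2 / (E f + 1)) by lra.
    apply (Rmult_lt_compat_r (E f)) in H3; [|easy].
    replace (d ^ 2 / E f * E f) with (d ^ 2) in H3 by (field; lra).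
    apply Rlt_le_trans with (1 := H3).
    replace (eps ^ 2) with (eps ^ 2 / (E f + 1) * (E f + 1)) at 2 by (field; lra).
    apply Rmult_le_compat_l; [|lra]. left; apply Rdiv_lt_0_compat; [apply pow_lt|]; lra. }
  rewrite <- (Rabs_right eps) by lra. apply Rsqr_lt_abs_0. unfold Rsqr.
  fold d. simpl in H3. lra.
Qed.

(** After an affine change and a clip, [f] competes for R(L_2,L_4) = 1, so the clipped function has
    energy at least 1. *)
Lemma E_separates_sides f a b : F f -> b < a ->
  (forall y, 0 <= y <= 1 -> a <= f (0, y)) -> (forall y, 0 <= y <= 1 -> f (1, y) <= b) ->
  (a - b) ^ 2 <= E f.
Proof.
  intros Hf Hab Hl Hr. set (g := fun p => / (a - b) * f p + - (b / (a - b))).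
  assert (Hi : 0 < / (a - b)) by (apply Rinv_0_lt_compat; lra).
  assert (Hg : F g) by now apply F_aff.
  destruct HE as [Hub _].
  assert (H0 : agree L2 (clip g) (fun _ => 0)).
  { intros p [t [Ht ->]]. apply clip_le0. unfold g, gamma; simpl.
    replace ((1 - t) * 1 + t * 1) with 1 by ring. replace ((1 - t) * 0 + t * 1) with t by ring.
    apply (Rmult_le_reg_l (a - b)); [lra|].
    specialize (Hr t Ht). field_simplify; lra. }
  assert (H1 : agree L4 (clip g) (fun _ => 1)).
  { intros p [t [Ht ->]]. apply clip_ge1. unfold g, gamma; simpl.
    replace ((1 - t) * 0 + t * 0) with 0 by ring.
    replace ((1 - t) * 1 + t * 0) with (1 - t) by ring.
    apply (Rmult_le_reg_l (a - b)); [lra|].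
    specialize (Hl (1 - t) ltac:(lra)). field_simplify; lra. }
  assert (Hle : / E (clip g) <= 1).
  { apply Hub. exists (clip g). split; [now apply F_clip|easy]. }
  assert (Hp : 0 < E (clip g)).
  { apply (E_pos _ (0, 0) (1, 0)).
    - now apply F_clip.
    - apply bottom_in_K; lra.
    - apply bottom_in_K; lra.
    - assert (A : clip g (0, 0) = 1).
      { apply H1. exists 1. split; [lra|]. unfold gamma; simpl; f_equal; ring. }
      assert (B : clip g (1, 0) = 0).
      { apply H0. exists 0. split; [lra|]. unfold gamma; simpl; f_equal; ring. }
      rewrite A, B; lra. }
  assert (Hge : 1 <= E (clip g)).
  { apply Rinv_le_contravar in Hle; [|now apply Rinv_0_lt_compat].
    rewrite Rinv_inv, Rinv_1 in Hle. easy. }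
  pose proof (E_clip g Hg) as Hcg. unfold g in Hcg at 3 4. rewrite E_aff in Hcg by easy.
  assert (Hq : 1 <= (/ (a - b)) ^ 2 * E f) by lra.
  apply (Rmult_le_compat_l ((a - b) ^ 2)) in Hq; [|apply pow2_ge_0].
  replace ((a - b) ^ 2 * ((/ (a - b)) ^ 2 * E f)) with (E f) in Hq by (field; lra). lra.
Qed.

(** A nearly optimal potential between the vertical sides, symmetrized; the bound 2 instead of 1
    avoids asking whether the supremum in R(L_2,L_4) is attained. Equal top and bottom traces allow
    gluing of copies, and the antisymmetry of the trace matches values at opposite ends of a
    side. *)
Definition horizontal_brick (h : pt -> R) : Prop :=
  F h /\ unit_valued h /\
  (forall y, 0 <= y <= 1 -> h (0, y) = 0 /\ h (1, y) = 1) /\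
  (forall t, 0 <= t <= 1 -> h (t, 1) = h (t, 0)) /\
  (forall t, 0 <= t <= 1 -> h (1 - t, 0) = 1 - h (t, 0)) /\
  E h <= 2.

Lemma horizontal_brick_exists : exists h, horizontal_brick h.
Proof.
  assert (H : exists f, F f /\ agree L2 f (fun _ => 0) /\ agree L4 f (fun _ => 1) /\ E f <= 2).
  { destruct (classic (exists f, F f /\ agree L2 f (fun _ => 0) /\
      agree L4 f (fun _ => 1) /\ E f <= 2)) as [|Hn]; [easy|exfalso].
    destruct HE as [_ Hlub]. assert (1 <= / 2); [|lra].
    apply Hlub. intros s (f & Hf & H0 & H1 & ->).
    apply Rinv_le_contravar; [lra|]. apply Rnot_lt_le; intros Hlt.
    apply Hn. exists f; repeat split; try easy; lra. }
  destruct H as (f & Hf & H2 & H4 & Ef).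
  (* The competitor equals 1 on the left side and 0 on the right one; this reverses it. *)
  set (f' := fun p => (-1) * f p + 1).
  assert (Ff' : F f') by now apply F_aff.
  assert (Ef' : E f' <= 2) by (unfold f'; rewrite E_aff by easy; lra).
  set (h0 := clip f').
  assert (Fh0 : F h0) by now apply F_clip.
  assert (Eh0 : E h0 <= 2) by (pose proof (E_clip f' Ff'); unfold h0; lra).
  (* Averaging with the vertical mirror image equalizes the top and bottom traces; averaging
     afterwards with [g2] gives the antisymmetry. Neither raises the energy bound, by convexity and
     symmetry. *)
  set (h1 := fun p => (h0 p + h0 (fst p, 1 - snd p)) / 2).
  assert (Fg1 : F (fun p => h0 (fst p, 1 - snd p))) by now apply (F_D4 _ _ D4_refy).
  assert (Fh1 : F h1) by now apply F_mean.
  assert (Eh1 : E h1 <= 2).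
  { pose proof (E_mean_le h0 _ Fh0 Fg1) as A. cbv beta in A.
    rewrite (E_D4 _ _ D4_refy Fh0) in A. fold h1 in A. lra. }
  set (g2 := fun p => (-1) * h1 (1 - fst p, snd p) + 1).
  assert (Fg2' : F (fun p => h1 (1 - fst p, snd p))) by now apply (F_D4 _ _ D4_refx).
  assert (Fg2 : F g2) by now apply F_aff.
  assert (Eg2 : E g2 <= 2).
  { unfold g2. rewrite (E_aff _ _ _ Fg2'), (E_D4 _ _ D4_refx Fh1). lra. }
  assert (B0 : forall y, 0 <= y <= 1 -> h0 (0, y) = 0 /\ h0 (1, y) = 1).
  { intros y Hy. split; [apply clip_le0|apply clip_ge1]; unfold f'.
    - rewrite H4; [lra|]. exists (1 - y). split; [lra|]. unfold gamma; simpl; f_equal; ring.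
    - rewrite H2; [lra|]. exists y. split; [lra|]. unfold gamma; simpl; f_equal; ring. }
  assert (B1 : forall y, 0 <= y <= 1 -> h1 (0, y) = 0 /\ h1 (1, y) = 1).
  { intros y Hy. unfold h1; simpl. destruct (B0 y Hy) as [-> ->].
    destruct (B0 (1 - y)) as [-> ->]; [lra|]. lra. }
  assert (R1 : forall p, 0 <= h1 p <= 1).
  { intros p. unfold h1. pose proof (clip_range f' p).
    pose proof (clip_range f' (fst p, 1 - snd p)). unfold h0. lra. }
  exists (fun p => (h1 p + g2 p) / 2). split; [now apply F_mean|]. split; [|split; [|split; [|split]]].
  - intros x _. unfold g2. pose proof (R1 x). pose proof (R1 (1 - fst x, snd x)). lra.
  - intros y Hy. unfold g2; simpl. replace (1 - 0) with 1 by ring.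
    replace (1 - 1) with 0 by ring. destruct (B1 y Hy) as [-> ->]. lra.
  - intros t Ht. unfold g2, h1; simpl. replace (1 - 1) with 0 by ring.
    replace (1 - 0) with 1 by ring. lra.
  - intros t Ht. unfold g2; simpl. replace (1 - (1 - t)) with t by ring. lra.
  - pose proof (E_mean_le h1 g2 Fh1 Fg2). lra.
Qed.

(** * Lower bound for the renormalization factor *)

Lemma rsum_telescope n (g : nat -> R) : rsum n (fun l => g l - g (S l)) = g 0%nat - g n.
Proof. induction n as [|n IH]; [unfold rsum; simpl; ring|rewrite rsum_S, IH; ring]. Qed.

Lemma rsum_square n a : (rsum n a) ^ 2 <= INR n * rsum n (fun i => a i ^ 2).
Proof.
  induction n as [|n IH]; [unfold rsum; simpl; lra|].
  rewrite !rsum_S, S_INR. set (s := rsum n a) in *. set (q := rsum n (fun i => a i ^ 2)) in *.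
  destruct n as [|n].
  - unfold s, q, rsum; simpl; lra.
  - set (m := INR (S n)) in *.
    assert (Hm : 0 < m) by (apply lt_0_INR; lia).
    assert (H0 : 2 * s * a (S n) <= s ^ 2 / m + m * a (S n) ^ 2).
    { assert (H : 0 <= (s / m - a (S n)) ^ 2 * m) by (apply Rmult_le_pos; [apply pow2_ge_0|lra]).
      replace ((s / m - a (S n)) ^ 2 * m) with (s ^ 2 / m - 2 * s * a (S n) + m * a (S n) ^ 2)
        in H by (field; lra). lra. }
    assert (H1 : s ^ 2 / m <= q).
    { apply (Rmult_le_reg_r m); [easy|]. unfold Rdiv. rewrite Rmult_assoc, Rinv_l by lra. lra. }
    replace ((s + a (S n)) ^ 2) with (s ^ 2 + 2 * s * a (S n) + a (S n) ^ 2) by ring. lra.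
Qed.

(** This is R(q_1,q_2) <= rho, written without the supremum. *)
Definition corner_bound (rho : R) : Prop :=
  forall f, F f -> (f (0, 0) - f (1, 0)) ^ 2 <= rho * E f.

Lemma corner_bound_exists : exists rho, 0 <= rho /\ corner_bound rho.
Proof.
  destruct (point_bound (0, 0) (1, 0)) as [M [HM H]]; try (apply bottom_in_K; lra).
  now exists M.
Qed.

Lemma Ps_bot_grid l (f : pt -> R) t : (l < k)%nat ->
  f (Ps (bot l) (t, 0)) = f ((INR l + t) / INR k, 0).
Proof.
  intros Hl. rewrite Ps_bot by easy. simpl. f_equal. f_equal; unfold Rdiv; ring.
Qed.

(** Series law: the two corners are joined by the k bottom cells, each contributing resistance at
    most [r * rho]. *)
Lemma corner_bound_step rho : 0 <= rho -> corner_bound rho -> corner_bound (INR k * r * rho).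
Proof.
  intros Hrho H f Hf. pose proof kR_ge3. pose proof r_pos.
  assert (Ht : f (0, 0) - f (1, 0) =
    rsum k (fun l => f (Ps (bot l) (0, 0)) - f (Ps (bot l) (1, 0)))).
  { rewrite (rsum_ext k _ (fun l => f (INR l / INR k, 0) - f (INR (S l) / INR k, 0))).
    - rewrite (rsum_telescope k (fun l => f (INR l / INR k, 0))). simpl INR at 1.
      f_equal; [|f_equal]; f_equal; f_equal; field; lra.
    - intros l Hl. rewrite !Ps_bot_grid by easy. rewrite S_INR, Rplus_0_r. reflexivity. }
  rewrite Ht. eapply Rle_trans; [apply rsum_square|].
  rewrite !Rmult_assoc. apply Rmult_le_compat_l; [lra|].
  apply Rle_trans with (rsum k (fun l => rho * E (fun x => f (Ps (bot l) x)))).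
  - apply rsum_le; intros l Hl. apply (H (fun x => f (Ps (bot l) x))).
    apply F_Ps; [easy|now apply bot_spec].
  - rewrite rsum_scal. pose proof (bottom_le f Hf) as A.
    apply (Rmult_le_compat_l r) in A; [|lra].
    rewrite <- Rmult_assoc, Rinv_r, Rmult_1_l in A by lra.
    apply (Rmult_le_compat_l rho) in A; [|easy]. lra.
Qed.

(** If k r < 1, iterating the series law would give R(q_1,q_2) = 0, although some function of [F]
    takes different values at the two corners. *)
Lemma r_lower : ik <= r.
Proof.
  destruct (Rle_dec ik r) as [|Hn]; [easy|exfalso]. apply Rnot_le_lt in Hn.
  pose proof kR_ge3. pose proof r_pos. pose proof k_ik.
  set (q := INR k * r).
  assert (Hq : 0 <= q < 1).
  { unfold q; split; [apply Rmult_le_pos; lra|]. rewrite <- k_ik. apply Rmult_lt_compat_l; lra. }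
  destruct corner_bound_exists as [rho [Hrho Hcb]].
  assert (Hn' : forall n, corner_bound (q ^ n * rho)).
  { induction n as [|n IH]; [simpl; now rewrite Rmult_1_l|].
    simpl. unfold q at 1. rewrite Rmult_assoc. apply corner_bound_step; [|easy].
    apply Rmult_le_pos; [apply pow_le|]; easy. }
  destruct (rf_interp _ _ _ HR [(0, 0); (1, 0)] fst) as [u [Hu Hv]].
  { intros x [<-|[<-|[]]]; apply bottom_in_K; lra. }
  assert (A : 1 <= 0); [|lra].
  apply (le_of_geometric q (rho * E u)); [easy|apply Rmult_le_pos; [easy|now apply E_nonneg]|].
  intros n. specialize (Hn' n u Hu). rewrite !Hv in Hn' by (simpl; tauto). simpl in Hn'. lra.
Qed.

Lemma r_inv_le : / r <= INR k.
Proof.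
  pose proof ik_range. pose proof r_lower.
  rewrite <- (Rinv_inv (INR k)). apply Rinv_le_contravar; lra.
Qed.

Lemma N_le : INR N <= INR k ^ 2.
Proof.
  destruct HU as (_ & _ & H & _). replace (INR k ^ 2) with (INR (k * k)) by (rewrite mult_INR; ring).
  apply le_INR; lia.
Qed.

Lemma top_dichotomy i : (i < N)%nat -> snd (c i) = 1 - ik \/ snd (c i) <= 1 - 2 * ik.
Proof.
  intros Hi. destruct top_row as [_ H]. destruct (H i Hi) as [[l [_ ->]]|]; [left; easy|now right].
Qed.

(** * Extension from one side *)

Section Extension.

Variable h : pt -> R.
Hypothesis Hh : horizontal_brick h.

Notation phi t := (h (t, 0)).

Lemma brick_F : F h.
Proof. apply Hh. Qed.

Lemma brick_unit : unit_valued h.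
Proof. apply Hh. Qed.

Lemma brick_left y : 0 <= y <= 1 -> h (0, y) = 0.
Proof. intros Hy. now apply Hh. Qed.

Lemma brick_right y : 0 <= y <= 1 -> h (1, y) = 1.
Proof. intros Hy. now apply Hh. Qed.

Lemma brick_top t : 0 <= t <= 1 -> h (t, 1) = phi t.
Proof. intros Hy. now apply Hh. Qed.

Lemma brick_E : E h <= 2.
Proof. apply Hh. Qed.

(** Pieces of a vertical cutoff supported in the top row: a brick turned to rise upwards there, 0
    elsewhere. The turned brick has equal traces on its left and right sides, so the copies match
    along the row. *)
Definition cut_piece (i : nat) : pt -> R :=
  if Req_EM_T (snd (c i)) (1 - ik) then fun p => h (snd p, fst p) else fun _ => 0.

Lemma cut_compatible : compatible cut_piece.
Proof.
  intros i j x y Hi Hj Hx Hy Hij He.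
  assert (E1 : fst (Ps i x) = fst (Ps j y)) by now rewrite He.
  assert (E2 : snd (Ps i x) = snd (Ps j y)) by now rewrite He.
  rewrite !fst_Ps in E1. rewrite !snd_Ps in E2.
  pose proof (K_in_square x Hx) as [X1 X2]. pose proof (K_in_square y Hy) as [Y1 Y2].
  pose proof ik_range as Hik. destruct x as [x1 x2], y as [y1 y2]; simpl in *.
  unfold cut_piece. destruct (Req_EM_T (snd (c i)) (1 - ik)) as [Ti|Ti];
    destruct (Req_EM_T (snd (c j)) (1 - ik)) as [Tj|Tj]; simpl; [| | |easy].
  - assert (x2 = y2) as -> by (apply (Rmult_eq_reg_r ik); lra).
    destruct (separated i j Hi Hj Hij) as [H|H].
    + destruct (edges_meet _ _ _ _ X1 Y1 E1 H) as [[-> ->]|[-> ->]];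
        rewrite brick_top by easy; easy.
    + rewrite Ti, Tj, Rminus_diag, Rabs_R0 in H; lra.
  - destruct (top_dichotomy j Hj) as [|Hj2]; [easy|].
    assert (y2 * ik <= 1 * ik) by (apply Rmult_le_compat_r; lra).
    assert (x2 = 0) as ->.
    { apply (Rmult_eq_reg_r ik); [|lra].
      assert (0 <= x2 * ik) by (apply Rmult_le_pos; lra). lra. }
    now apply brick_left.
  - destruct (top_dichotomy i Hi) as [|Hi2]; [easy|].
    assert (x2 * ik <= 1 * ik) by (apply Rmult_le_compat_r; lra).
    assert (y2 = 0) as ->.
    { apply (Rmult_eq_reg_r ik); [|lra].
      assert (0 <= y2 * ik) by (apply Rmult_le_pos; lra). lra. }
    symmetry; now apply brick_left.
Qed.

Lemma F_swap f : F f -> F (fun p => f (snd p, fst p)).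
Proof. apply (F_D4 _ f D4_swap). Qed.

Lemma E_swap f : F f -> E (fun p => f (snd p, fst p)) = E f.
Proof. apply (E_D4 _ f D4_swap). Qed.

Lemma cut_piece_F i : (i < N)%nat -> F (cut_piece i).
Proof.
  intros Hi. unfold cut_piece. destruct (Req_EM_T _ _); [apply F_swap, brick_F|apply F_const].
Qed.

Definition cut : pt -> R := glue cut_piece.

Lemma cut_F : F cut.
Proof. apply F_glue; [apply cut_compatible|apply cut_piece_F]. Qed.

Lemma cut_E : E cut <= 2 * INR k ^ 3.
Proof.
  unfold cut. rewrite E_glue; [|apply cut_compatible|apply cut_piece_F].
  (* At most N <= k^2 pieces of energy at most 2, and 1/r <= k. *)
  apply Rle_trans with (/ r * (INR N * 2)).
  - apply Rmult_le_compat_l; [left; apply r_inv_pos|]. rewrite <- rsum_const.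
    apply rsum_le; intros i Hi. unfold cut_piece. destruct (Req_EM_T _ _).
    + rewrite E_swap by apply brick_F. apply brick_E.
    + rewrite E_const; lra.
  - replace (2 * INR k ^ 3) with (INR k * (INR k ^ 2 * 2)) by ring.
    apply Rmult_le_compat; [left; apply r_inv_pos| |apply r_inv_le|pose proof N_le; lra].
    apply Rmult_le_pos; [apply pos_INR|lra].
Qed.

Lemma cut_Ps i x : (i < N)%nat -> K x -> cut (Ps i x) = cut_piece i x.
Proof. apply glue_spec, cut_compatible. Qed.

Lemma K_swap p : K p -> K (snd p, fst p).
Proof. apply (K_D4 _ p D4_swap). Qed.

Lemma cut_unit : unit_valued cut.
Proof.
  intros p Hp. destruct (K_preimage p Hp) as [i [x [Hi [Hx ->]]]].
  rewrite cut_Ps by easy. unfold cut_piece. destruct (Req_EM_T _ _); [|lra].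
  now apply brick_unit, K_swap.
Qed.

Lemma cut_low p : K p -> snd p <= 1 - ik -> cut p = 0.
Proof.
  intros Hp Hlow. destruct (K_preimage p Hp) as [i [x [Hi [Hx ->]]]].
  rewrite cut_Ps by easy. unfold cut_piece. destruct (Req_EM_T _ _) as [Hc|]; [|easy].
  rewrite snd_Ps in Hlow. pose proof (K_in_square x Hx) as [X1 X2]. pose proof ik_range.
  assert (snd x = 0) as ->; [|now apply brick_left].
  apply (Rmult_eq_reg_r ik); [|lra].
  assert (0 <= snd x * ik) by (apply Rmult_le_pos; lra). lra.
Qed.

Lemma top_preimage p i x : (i < N)%nat -> K x -> p = Ps i x -> 1 - ik < snd p ->
  snd (c i) = 1 - ik /\ snd x = INR k * (snd p - 1) + 1.
Proof.
  intros Hi Hx -> Hp. rewrite snd_Ps in *. pose proof (K_in_square x Hx) as [X1 X2].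
  pose proof ik_range. pose proof kR_ge3.
  assert (snd x * ik <= 1 * ik) by (apply Rmult_le_compat_r; lra).
  destruct (top_dichotomy i Hi) as [Hc|]; [|lra]. split; [easy|]. rewrite Hc. field; lra.
Qed.

(** Common trace of [cut] on the vertical lines at 0, 1/k and 1: zero below the top row, then the
    brick trace compressed to it. *)
Definition psi (y : R) : R := if Rle_dec y (1 - ik) then 0 else phi (INR k * (y - 1) + 1).

Lemma psi_low y : y <= 1 - ik -> psi y = 0.
Proof. intros H. unfold psi. destruct (Rle_dec _ _); [easy|lra]. Qed.

Lemma cut_top p : K p -> snd p = 1 -> cut p = 1.
Proof.
  intros Hp Hs. destruct (K_preimage p Hp) as [i [x [Hi [Hx He]]]].
  pose proof ik_range. pose proof (K_in_square x Hx) as [X1 X2].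
  destruct (top_preimage p i x Hi Hx He) as [Hc Hsx]; [lra|].
  rewrite He, cut_Ps by easy. unfold cut_piece. destruct (Req_EM_T _ _); [|easy].
  rewrite Hsx, Hs. replace (INR k * (1 - 1) + 1) with 1 by ring. now apply brick_right.
Qed.

(** These lines run along sides of cells of the top row. The abscissa 1/k is included for the
    swapped cutoff, which is evaluated on the horizontal line at height 1/k. *)
Lemma cut_vertical p : K p -> fst p = 0 \/ fst p = ik \/ fst p = 1 -> cut p = psi (snd p).
Proof.
  intros Hp Hf. unfold psi. destruct (Rle_dec (snd p) (1 - ik)) as [Hl|Hl];
    [now apply cut_low|]. apply Rnot_le_lt in Hl.
  destruct (K_preimage p Hp) as [i [x [Hi [Hx He]]]].
  pose proof ik_range. pose proof (K_in_square x Hx) as [X1 X2]. pose proof (c_range i Hi) as [C1 _].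
  destruct (top_preimage p i x Hi Hx He Hl) as [Hc Hsx].
  assert (Hfst : fst p = fst x * ik + fst (c i)) by (rewrite He; apply fst_Ps).
  assert (Hx01 : fst x = 0 \/ fst x = 1).
  { assert (0 <= fst x * ik) by (apply Rmult_le_pos; lra).
    assert (fst x * ik <= 1 * ik) by (apply Rmult_le_compat_r; lra).
    destruct Hf as [Hf|[Hf|Hf]].
    - left. apply (Rmult_eq_reg_r ik); lra.
    - destruct top_row as [Ht _]. destruct (Ht 0%nat k_pos) as [j [Hj Ej]].
      simpl in Ej. unfold Rdiv in Ej; rewrite Rmult_0_l in Ej.
      destruct (Nat.eq_dec i j) as [->|Hij].
      + right. rewrite Ej in Hfst; simpl in Hfst. apply (Rmult_eq_reg_r ik); lra.
      + left. destruct (separated i j Hi Hj Hij) as [A|A]; rewrite Ej in A; simpl in A.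
        * rewrite Rabs_right in A by lra. apply (Rmult_eq_reg_r ik); lra.
        * rewrite Hc, Rminus_diag, Rabs_R0 in A; lra.
    - right. apply (Rmult_eq_reg_r ik); lra. }
  rewrite He at 1. rewrite cut_Ps by easy. unfold cut_piece. destruct (Req_EM_T _ _); [|easy].
  rewrite <- Hsx. destruct Hx01 as [-> | ->]; [easy|]. now apply brick_top.
Qed.

(** This function has the brick trace on top and vanishes below the top row. Its companion
    [side_step] rises to the right within distance 1/k of the right side, and vanishes on top. On
    the right side their traces are [psi] and one minus [psi]. *)
Definition top_bump (p : pt) : R := Rmin (h p) (cut p).

Definition side_step (p : pt) : R := Rmin (cut (snd p, fst p)) ((-1) * cut p + 1).

Lemma swap_cut_unit : unit_valued (fun p => cut (snd p, fst p)).
Proof. intros p Hp. now apply cut_unit, K_swap. Qed.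

Lemma cut_complement_unit : unit_valued (fun p => (-1) * cut p + 1).
Proof. intros p Hp. pose proof (cut_unit p Hp). lra. Qed.

Lemma k_cube_ge : 1 <= INR k ^ 3.
Proof. apply pow_R1_Rle. pose proof kR_ge3; lra. Qed.

Lemma top_bump_F : F top_bump /\ E top_bump <= 24 * INR k ^ 3.
Proof.
  destruct (F_min h cut brick_F cut_F brick_unit cut_unit) as [H1 H2]. split; [easy|].
  eapply Rle_trans; [exact H2|]. pose proof brick_E. pose proof cut_E. pose proof k_cube_ge. lra.
Qed.

Lemma side_step_F : F side_step /\ E side_step <= 24 * INR k ^ 3.
Proof.
  destruct (F_min (fun p => cut (snd p, fst p)) (fun p => (-1) * cut p + 1)) as [H1 H2];
    [apply F_swap, cut_F|apply F_aff, cut_F|apply swap_cut_unit|apply cut_complement_unit|].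
  split; [easy|]. eapply Rle_trans; [exact H2|].
  rewrite E_swap, E_aff by apply cut_F. pose proof cut_E. lra.
Qed.

Lemma side_step_unit : unit_valued side_step.
Proof.
  intros p Hp. unfold side_step. pose proof (swap_cut_unit p Hp). cbv beta in H.
  pose proof (cut_complement_unit p Hp). cbv beta in H0.
  unfold Rmin; destruct (Rle_dec _ _); lra.
Qed.

(* [a], [b] are the values at the left and right ends, [am], [ap] those at the top corners. *)
Definition form (am ap a b : R) (p : pt) : R :=
  a + (am - a) * cut p + (ap - am) * top_bump p + (b - a) * side_step p.

Definition qform (am ap a b : R) : R := (am - a) ^ 2 + (ap - am) ^ 2 + (b - a) ^ 2.

Lemma form_F am ap a b : F (form am ap a b).
Proof.
  unfold form. repeat apply F_plus; try apply F_const; apply F_scal;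
    [apply cut_F|apply top_bump_F|apply side_step_F].
Qed.

(** Two applications of [E_plus_le] cost a factor 4, on pieces of energy at most 24 k^3 times a
    squared difference; the additive constant costs nothing. *)
Lemma form_E am ap a b : E (form am ap a b) <= 96 * INR k ^ 3 * qform am ap a b.
Proof.
  set (u := fun p => (am - a) * cut p). set (v := fun p => (ap - am) * top_bump p).
  set (w := fun p => (b - a) * side_step p).
  assert (Fu : F u) by apply F_scal, cut_F.
  assert (Fv : F v) by apply F_scal, top_bump_F.
  assert (Fw : F w) by apply F_scal, side_step_F.
  assert (Fuv : F (fun p => u p + v p)) by now apply F_plus.
  assert (Fs : F (fun p => (u p + v p) + w p)) by now apply (F_plus (fun p => u p + v p) w).
  rewrite <- (E_local (fun p => 1 * ((u p + v p) + w p) + a)).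
  - rewrite (E_aff 1 a _ Fs). pose proof (E_plus_le _ w Fuv Fw) as H1.
    pose proof (E_plus_le u v Fu Fv) as H2.
    unfold u, v, w in *. rewrite !E_scal in * by
      (apply cut_F || apply top_bump_F || apply side_step_F).
    destruct top_bump_F as [_ H3]. destruct side_step_F as [_ H4]. pose proof cut_E as H5.
    pose proof k_cube_ge.
    apply (Rmult_le_compat_l ((am - a) ^ 2)) in H5; [|apply pow2_ge_0].
    apply (Rmult_le_compat_l ((ap - am) ^ 2)) in H3; [|apply pow2_ge_0].
    apply (Rmult_le_compat_l ((b - a) ^ 2)) in H4; [|apply pow2_ge_0].
    assert (0 <= INR k ^ 3 * (am - a) ^ 2) by (apply Rmult_le_pos; [lra|apply pow2_ge_0]).
    assert (0 <= INR k ^ 3 * (b - a) ^ 2) by (apply Rmult_le_pos; [lra|apply pow2_ge_0]).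
    unfold qform. cbv beta in *. lra.
  - apply (F_aff 1 a _ Fs).
  - intros p _. unfold u, v, w, form. ring.
Qed.

Lemma form_top am ap a b p : K p -> snd p = 1 ->
  form am ap a b p = am + (ap - am) * phi (fst p).
Proof.
  intros Hp Hs. unfold form, top_bump, side_step. rewrite (cut_top p Hp Hs).
  pose proof (brick_unit p Hp) as H1. pose proof (swap_cut_unit p Hp) as H2; cbv beta in H2.
  rewrite (Rmin_left (h p)) by lra. rewrite Rmin_right by lra.
  pose proof (K_in_square p Hp).
  replace (h p) with (phi (fst p)); [ring|].
  destruct p as [x y]; simpl in *; subst. symmetry; now apply brick_top.
Qed.

(** Only the values at the two ends of the left side enter. The same holds on the right, so
    neighbours agreeing at the ends of a common side agree on all of it. *)
Lemma form_left am ap a b p : K p -> fst p = 0 ->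
  form am ap a b p = a + (am - a) * psi (snd p).
Proof.
  intros Hp Hf. unfold form, top_bump, side_step. pose proof (K_in_square p Hp).
  pose proof (cut_unit p Hp) as H1. pose proof ik_range.
  rewrite (cut_low (snd p, fst p)) by (try apply K_swap; simpl; try easy; lra).
  replace (h p) with 0.
  2:{ destruct p as [x y]; simpl in *; subst. symmetry; now apply brick_left. }
  rewrite !Rmin_left by lra. rewrite cut_vertical by tauto. ring.
Qed.

Lemma form_right am ap a b p : K p -> fst p = 1 ->
  form am ap a b p = b + (ap - b) * psi (snd p).
Proof.
  intros Hp Hf. unfold form, top_bump, side_step. pose proof (K_in_square p Hp).
  pose proof (cut_unit p Hp) as H1.
  rewrite (cut_top (snd p, fst p)) by (try apply K_swap; easy).
  replace (h p) with 1.
  2:{ destruct p as [x y]; simpl in *; subst. symmetry; now apply brick_right. }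
  rewrite !Rmin_right by lra. rewrite cut_vertical by tauto. ring.
Qed.

Lemma form_low am ap a b p : K p -> snd p <= 1 - ik ->
  form am ap a b p = a + (b - a) * side_step p.
Proof.
  intros Hp Hs. unfold form, top_bump. rewrite (cut_low p Hp Hs).
  pose proof (brick_unit p Hp). rewrite Rmin_right by lra. ring.
Qed.

Lemma side_step_row p : K p -> snd p = ik -> side_step p = psi (fst p).
Proof.
  intros Hp Hs. unfold side_step. pose proof ik_range.
  rewrite (cut_low p Hp) by lra. pose proof (swap_cut_unit p Hp) as H2; cbv beta in H2.
  rewrite Rmin_left by lra. rewrite cut_vertical; [easy|now apply K_swap|simpl; tauto].
Qed.

Lemma bottom_not_last i : (i < N)%nat -> snd (c i) = 0 -> fst (c i) <> 1 - ik ->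
  fst (c i) <= 1 - 2 * ik.
Proof.
  intros Hi Hs Hf. pose proof ik_range. pose proof kR_ge3. pose proof k_ik.
  destruct (bottom_dichotomy i Hi) as [[l [Hl Hc]]|]; [|lra].
  rewrite Hc in *; simpl in *.
  assert (Hlk : (S (S l) <= k)%nat).
  { destruct (Nat.eq_dec (S l) k) as [He|]; [|lia]. exfalso; apply Hf.
    assert (INR k = INR l + 1) by (rewrite <- S_INR; now f_equal).
    replace (INR l) with (INR k - 1) by lra. field; lra. }
  apply le_INR in Hlk. rewrite !S_INR in Hlk.
  unfold Rdiv. apply (Rmult_le_compat_r ik) in Hlk; lra.
Qed.

(** On the line at height 1/k the coarse profile equals [u 0], except over the last cell, where it
    follows the brick trace from [u 0] to [u 1]. These are the top values handed to the bottom
    cells; the other cells keep the coarse profile. *)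
Definition ext_step (rec : R -> R -> (R -> R) -> pt -> R) (am ap : R) (u : R -> R)
    (i : nat) : pt -> R :=
  if Req_EM_T (snd (c i)) 0
  then rec (u 0) (if Req_EM_T (fst (c i)) (1 - ik) then u 1 else u 0)
           (fun t => u (fst (c i) + t / INR k))
  else fun x => form am ap (u 0) (u 1) (Ps i x).

(* The cells of generation at most [M] that touch the bottom side are filled in by the
   explicit profile [form], whose traces on the sides shared by two such cells agree. *)
Fixpoint ext (M : nat) (am ap : R) (u : R -> R) : pt -> R :=
  match M with
  | O => form am ap (u 0) (u 1)
  | S M' => glue (ext_step (ext M') am ap u)
  end.

(** Traces on the three sides away from the data are those of [form] at any depth. This invariant is
    what permits the gluing of the next generation. *)
Definition good_traces (rec : R -> R -> (R -> R) -> pt -> R) : Prop :=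
  forall am ap u, F (rec am ap u) /\ forall p, K p ->
    (snd p = 1 -> rec am ap u p = am + (ap - am) * phi (fst p)) /\
    (fst p = 0 -> rec am ap u p = u 0 + (am - u 0) * psi (snd p)) /\
    (fst p = 1 -> rec am ap u p = u 1 + (ap - u 1) * psi (snd p)).

Lemma psi_last s : 0 <= s <= 1 -> psi (s * ik + (1 - ik)) = phi s.
Proof.
  intros Hs. pose proof ik_range. pose proof kR_ge3. unfold psi. destruct (Rle_dec _ _) as [H1|H1].
  - assert (0 <= s * ik) by (apply Rmult_le_pos; lra).
    assert (s = 0) as -> by (apply (Rmult_eq_reg_r ik); lra).
    symmetry. apply brick_left; lra.
  - f_equal. f_equal. field; lra.
Qed.

(** The left one of two neighbours is not the last cell, so both have top value [u 0] at the common
    corner; at the bottom corner both use the same value of [u]. *)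
Lemma ext_step_adjacent rec am ap u i j x y : good_traces rec ->
  (i < N)%nat -> (j < N)%nat -> K x -> K y -> snd (c i) = 0 -> snd (c j) = 0 ->
  fst x = 1 -> fst y = 0 -> Ps i x = Ps j y ->
  ext_step rec am ap u i x = ext_step rec am ap u j y.
Proof.
  intros Hrec Hi Hj Hx Hy Ci Cj X1 Y1 He. unfold ext_step.
  destruct (Req_EM_T (snd (c i)) 0); [|easy]. destruct (Req_EM_T (snd (c j)) 0); [|easy].
  assert (E1 : fst (Ps i x) = fst (Ps j y)) by now rewrite He.
  assert (E2 : snd (Ps i x) = snd (Ps j y)) by now rewrite He.
  rewrite !fst_Ps, X1, Y1 in E1. rewrite !snd_Ps in E2. pose proof ik_range.
  assert (Hs : snd x = snd y) by (apply (Rmult_eq_reg_r ik); lra).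
  pose proof (c_range j Hj) as [[_ Cj1] _].
  destruct (Req_EM_T (fst (c i)) (1 - ik)) as [A|A]; [lra|].
  destruct (Hrec (u 0) (u 0) (fun t => u (fst (c i) + t / INR k))) as [_ Hx'].
  destruct (Hx' x Hx) as (_ & _ & Hr). rewrite (Hr X1).
  destruct (Hrec (u 0) (if Req_EM_T (fst (c j)) (1 - ik) then u 1 else u 0)
    (fun t => u (fst (c j) + t / INR k))) as [_ Hy'].
  destruct (Hy' y Hy) as (_ & Hl & _). rewrite (Hl Y1), Hs.
  replace (fst (c i) + 1 / INR k) with (fst (c j) + 0 / INR k); [reflexivity|].
  unfold Rdiv; lra.
Qed.

Lemma ext_step_above rec am ap u i j x y : good_traces rec ->
  (i < N)%nat -> (j < N)%nat -> K x -> K y -> snd (c i) = 0 -> snd (c j) <> 0 ->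
  Ps i x = Ps j y -> ext_step rec am ap u i x = ext_step rec am ap u j y.
Proof.
  intros Hrec Hi Hj Hx Hy Ci Cj He. unfold ext_step.
  destruct (Req_EM_T (snd (c i)) 0); [|easy]. destruct (Req_EM_T (snd (c j)) 0); [easy|].
  rewrite <- He. assert (E2 : snd (Ps i x) = snd (Ps j y)) by now rewrite He.
  rewrite !snd_Ps in E2. pose proof ik_range.
  pose proof (K_in_square x Hx) as [X1 X2]. pose proof (K_in_square y Hy) as [Y1 Y2].
  destruct (bottom_dichotomy j Hj) as [[l [Hl Hc]]|Hc]; [rewrite Hc in Cj; easy|].
  assert (0 <= snd y * ik) by (apply Rmult_le_pos; lra).
  assert (snd x * ik <= 1 * ik) by (apply Rmult_le_compat_r; lra).
  assert (Sx : snd x = 1) by (apply (Rmult_eq_reg_r ik); lra).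
  pose proof (K_image i x Hi Hx) as HKp.
  assert (Sp : snd (Ps i x) = ik) by (rewrite snd_Ps, Sx; lra).
  rewrite form_low by (try easy; lra). rewrite (side_step_row _ HKp Sp), fst_Ps.
  match goal with |- rec ?a ?b ?v x = _ => destruct (Hrec a b v) as [_ Hx'] end.
  destruct (Hx' x Hx) as (Ht & _). rewrite (Ht Sx).
  destruct (Req_EM_T (fst (c i)) (1 - ik)) as [A|A].
  - rewrite A, psi_last by easy. ring.
  - pose proof (bottom_not_last i Hi Ci A).
    assert (fst x * ik <= 1 * ik) by (apply Rmult_le_compat_r; lra).
    rewrite psi_low by lra. ring.
Qed.

Lemma ext_step_compatible rec am ap u : good_traces rec -> compatible (ext_step rec am ap u).
Proof.
  intros Hrec i j x y Hi Hj Hx Hy Hij He.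
  destruct (Req_dec (snd (c i)) 0) as [Ci|Ci]; destruct (Req_dec (snd (c j)) 0) as [Cj|Cj].
  - assert (E1 : fst (Ps i x) = fst (Ps j y)) by now rewrite He.
    rewrite !fst_Ps in E1. pose proof ik_range.
    pose proof (K_in_square x Hx) as [X1 X2]. pose proof (K_in_square y Hy) as [Y1 Y2].
    destruct (separated i j Hi Hj Hij) as [H0|H0].
    + destruct (edges_meet _ _ _ _ X1 Y1 E1 H0) as [[A B]|[A B]].
      * symmetry. now apply ext_step_adjacent.
      * now apply ext_step_adjacent.
    + rewrite Ci, Cj, Rminus_diag, Rabs_R0 in H0; lra.
  - now apply ext_step_above.
  - symmetry. now apply ext_step_above.
  - unfold ext_step. destruct (Req_EM_T (snd (c i)) 0); [easy|].
    destruct (Req_EM_T (snd (c j)) 0); [easy|]. now rewrite He.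
Qed.

Lemma ext_step_F rec am ap u i : good_traces rec -> (i < N)%nat -> F (ext_step rec am ap u i).
Proof.
  intros Hrec Hi. unfold ext_step. destruct (Req_EM_T _ _).
  - apply Hrec.
  - apply F_Ps; [apply form_F|easy].
Qed.

Lemma ext_good M : good_traces (ext M).
Proof.
  induction M as [|M IH]; intros am ap u; simpl.
  - split; [apply form_F|]. intros p Hp.
    split; [|split]; [now apply form_top|now apply form_left|now apply form_right].
  - assert (HC : compatible (ext_step (ext M) am ap u)) by now apply ext_step_compatible.
    split; [apply F_glue; [easy|intros i Hi; now apply ext_step_F]|].
    intros p Hp. destruct (K_preimage p Hp) as [i [x [Hi [Hx ->]]]].
    rewrite (glue_spec _ i x HC Hi Hx). pose proof (K_image i x Hi Hx) as HKp.
    pose proof (K_in_square x Hx) as [X1 X2]. pose proof (c_range i Hi) as [C1 C2].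
    pose proof ik_range.
    assert (0 <= fst x * ik) by (apply Rmult_le_pos; lra).
    assert (fst x * ik <= 1 * ik) by (apply Rmult_le_compat_r; lra).
    assert (0 <= snd x * ik) by (apply Rmult_le_pos; lra).
    assert (snd x * ik <= 1 * ik) by (apply Rmult_le_compat_r; lra).
    unfold ext_step. destruct (Req_EM_T (snd (c i)) 0) as [Cz|Cz].
    2:{ split; [|split]; intros Hv; [now apply form_top|now apply form_left|now apply form_right]. }
    match goal with |- context [ext M ?a ?b ?v x] => destruct (IH a b v) as [_ Hx'] end.
    destruct (Hx' x Hx) as (_ & Hl & Hr).
    rewrite fst_Ps, snd_Ps. split; [|split]; intros Hv.
    + exfalso; lra.
    (* At height at most 1/k the profile [psi] vanishes, so the required trace is constant; the
       child has [u 0] at both ends of this side. *)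
    + assert (Xz : fst x = 0) by (apply (Rmult_eq_reg_r ik); lra).
      assert (Cf : fst (c i) = 0) by (rewrite Xz in Hv; lra). rewrite (Hl Xz), (psi_low (snd x * ik + snd (c i))) by lra.
      rewrite Cf. replace (0 + 0 / INR k) with 0 by (unfold Rdiv; ring). ring.
    + assert (Xo : fst x = 1) by (apply (Rmult_eq_reg_r ik); lra).
      assert (Cf : fst (c i) = 1 - ik) by (rewrite Xo in Hv; lra). rewrite (Hr Xo), (psi_low (snd x * ik + snd (c i))) by lra.
      destruct (Req_EM_T (fst (c i)) (1 - ik)); [|easy]. rewrite Cf.
      replace (1 - ik + 1 / INR k) with 1 by (unfold Rdiv; ring). ring.
Qed.

Lemma ext_F M am ap u : F (ext M am ap u).
Proof. apply ext_good. Qed.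

Lemma ext_Ps M am ap u i x : (i < N)%nat -> K x ->
  ext (S M) am ap u (Ps i x) = ext_step (ext M) am ap u i x.
Proof. apply glue_spec, ext_step_compatible, ext_good. Qed.

(** On the bottom side the approximations interpolate data taken within k^(-M), so continuity of [u]
    identifies their limit. *)
Lemma ext_bottom M : forall am ap u p, K p -> snd p = 0 -> exists a b s,
  0 <= a <= 1 /\ 0 <= b <= 1 /\ 0 <= s <= 1 /\
  Rabs (a - fst p) <= ik ^ M /\ Rabs (b - fst p) <= ik ^ M /\
  ext M am ap u p = u a + (u b - u a) * s.
Proof.
  pose proof ik_range.
  induction M as [|M IH]; intros am ap u p Hp Hs; simpl ext.
  - exists 0, 1, (side_step p). pose proof (side_step_unit p Hp).
    pose proof (K_in_square p Hp). simpl. rewrite form_low by (try easy; lra).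
    repeat split; try lra; apply Rabs_le; lra.
  - destruct (K_preimage p Hp) as [i [x [Hi [Hx ->]]]]. rewrite snd_Ps in Hs.
    change (glue (ext_step (ext M) am ap u) (Ps i x)) with (ext (S M) am ap u (Ps i x)).
    rewrite ext_Ps by easy. pose proof (K_in_square x Hx) as [X1 X2].
    pose proof (c_range i Hi) as [C1 C2].
    assert (0 <= snd x * ik) by (apply Rmult_le_pos; lra).
    assert (Cz : snd (c i) = 0) by lra.
    assert (Xz : snd x = 0) by (apply (Rmult_eq_reg_r ik); lra).
    unfold ext_step. destruct (Req_EM_T (snd (c i)) 0); [|easy].
    match goal with |- context [ext M ?a ?b ?v x] =>
      destruct (IH a b v x Hx Xz) as (a' & b' & s & Ha & Hb & Hsr & Da & Db & He) end.
    assert (Hscale : forall d, 0 <= d <= 1 -> Rabs (d - fst x) <= ik ^ M ->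
      0 <= fst (c i) + d / INR k <= 1 /\
      Rabs (fst (c i) + d / INR k - (fst x * ik + fst (c i))) <= ik ^ S M).
    { intros d Hd Hdx. unfold Rdiv.
      assert (0 <= d * ik) by (apply Rmult_le_pos; lra).
      assert (d * ik <= 1 * ik) by (apply Rmult_le_compat_r; lra). split; [lra|].
      replace (fst (c i) + d * ik - (fst x * ik + fst (c i))) with (ik * (d - fst x)) by ring.
      rewrite Rabs_mult, (Rabs_right ik) by lra. simpl. apply Rmult_le_compat_l; lra. }
    exists (fst (c i) + a' / INR k), (fst (c i) + b' / INR k), s.
    rewrite fst_Ps. pose proof (Hscale a' Ha Da). pose proof (Hscale b' Hb Db). tauto.
Qed.

Notation last_value u i := (if Req_EM_T (fst (c i)) (1 - ik) then u 1 else u 0).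

Lemma Dm1_chain u l : (l <= k)%nat -> (u 0 - u (INR l / INR k)) ^ 2 <= INR k * Dm k 1 u.
Proof.
  intros Hl. pose proof kR_ge3.
  assert (Ht : u 0 - u (INR l / INR k) =
     rsum l (fun i => u (INR i / INR k) - u (INR (i + 1) / INR k))).
  { rewrite (rsum_ext l _ (fun i => u (INR i / INR k) - u (INR (S i) / INR k))).
    - rewrite (rsum_telescope l (fun i => u (INR i / INR k))). simpl (INR 0).
      now replace (0 / INR k) with 0 by (field; lra).
    - intros i _. now rewrite Nat.add_1_r. }
  rewrite Ht. eapply Rle_trans; [apply rsum_square|].
  apply Rmult_le_compat; [apply pos_INR| |now apply le_INR|].
  - apply rsum_nonneg; intros; apply pow2_ge_0.
  - unfold Dm. rewrite Nat.pow_1_r.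
    apply (rsum_mono l k (fun i => (u (INR i / INR k) - u (INR (i + 1) / INR k)) ^ 2));
      [easy|intros; apply pow2_ge_0].
Qed.

(** For each of k cells, three differences are bounded through Cauchy-Schwarz along at most k steps
    of generation 1, whence the factor 3 k^2. *)
Lemma qform_sum u :
  rsum k (fun l => qform (u 0) (last_value u (bot l))
     (u (INR l / INR k + 0 / INR k)) (u (INR l / INR k + 1 / INR k)))
  <= 3 * INR k ^ 2 * Dm k 1 u.
Proof.
  pose proof kR_ge3. pose proof (Dm_nonneg k 1 u) as HD0.
  replace (3 * INR k ^ 2 * Dm k 1 u) with (INR k * (3 * INR k * Dm k 1 u)) by ring.
  rewrite <- rsum_const. apply rsum_le; intros l Hl. unfold qform.
  replace (INR l / INR k + 0 / INR k) with (INR l / INR k) by (field; lra).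
  replace (INR l / INR k + 1 / INR k) with (INR (l + 1) / INR k)
    by (rewrite plus_INR; simpl; field; lra).
  assert (H1 := Dm1_chain u l ltac:(lia)).
  assert (H2 : (last_value u (bot l) - u 0) ^ 2 <= INR k * Dm k 1 u).
  { pose proof (Dm1_chain u k (le_n k)) as A. unfold Rdiv in A. rewrite Rinv_r in A by lra.
    assert (0 <= INR k * Dm k 1 u) by (apply Rmult_le_pos; lra).
    destruct (Req_EM_T _ _).
    - replace (u 1 - u 0) with (- (u 0 - u 1)) by ring. rewrite <- Rsqr_pow2, <- Rsqr_neg, Rsqr_pow2.
      easy.
    - rewrite Rminus_diag. simpl; lra. }
  assert (H3 : (u (INR (l + 1) / INR k) - u (INR l / INR k)) ^ 2 <= Dm k 1 u).
  { replace ((u (INR (l + 1) / INR k) - u (INR l / INR k)) ^ 2)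
      with ((u (INR l / INR k) - u (INR (l + 1) / INR k)) ^ 2) by ring.
    unfold Dm. rewrite Nat.pow_1_r.
    apply (rsum_term_le k (fun l => (u (INR l / INR k) - u (INR (l + 1) / INR k)) ^ 2));
      [easy|]. intros; apply pow2_ge_0. }
  assert (Dm k 1 u <= INR k * Dm k 1 u).
  { rewrite <- (Rmult_1_l (Dm k 1 u)) at 1. apply Rmult_le_compat_r; lra. }
  lra.
Qed.

Notation Bf := (96 * INR k ^ 3).
Notation Cf := (3 * INR k ^ 2).

Lemma ext_step_bot M am ap u l : (l < k)%nat ->
  ext_step (ext M) am ap u (bot l) =
  ext M (u 0) (last_value u (bot l)) (fun t => u (INR l / INR k + t / INR k)).
Proof.
  intros Hl. unfold ext_step. destruct (bot_spec l Hl) as [_ Hc].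
  replace (INR l / INR k) with (fst (c (bot l))) by now rewrite Hc.
  destruct (Req_EM_T (snd (c (bot l))) 0) as [|n]; [easy|elim n; now rewrite Hc].
Qed.

(** Generation 0 is subtracted because [qform] accounts for it. In the induction step, the [qform]
    terms of the children add up to at most [Cf * Dm k 1 u], which is exactly what the generation-0
    terms subtracted for the children make available. *)
Lemma ext_E M : forall am ap u,
  E (ext M am ap u) <= Bf * (qform am ap (u 0) (u 1) + Cf * (Tn k r (S M) u - Dm k 0 u)).
Proof.
  pose proof k_cube_ge as Hk3. pose proof r_inv_pos as Hri.
  induction M as [|M IH]; intros am ap u.
  - rewrite Tn_1, Rminus_diag.
    rewrite Rmult_0_r, Rplus_0_r. apply form_E.
  - simpl ext. rewrite E_glue;
      [|apply ext_step_compatible, ext_good|intros; apply ext_step_F; [apply ext_good|easy]].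
    set (fm := form am ap (u 0) (u 1)).
    assert (Ffm : F fm) by apply form_F.
    assert (H1 : rsum N (fun i => E (ext_step (ext M) am ap u i)) <=
      rsum k (fun l => E (ext_step (ext M) am ap u (bot l))) +
      rsum N (fun i => E (fun x => fm (Ps i x)))).
    { rewrite <- (rsum_bottom (fun i => E (ext_step (ext M) am ap u i))), <- rsum_plus.
      apply rsum_le; intros i Hi. pose proof (E_Ps_nonneg fm i Ffm Hi) as A.
      destruct (Req_EM_T (snd (c i)) 0) as [Cz|Cz]; [lra|].
      unfold ext_step at 1 2. destruct (Req_EM_T (snd (c i)) 0); [easy|]. unfold fm. lra. }
    apply (Rmult_le_compat_l (/ r)) in H1; [|lra]. rewrite Rmult_plus_distr_l in H1.
    rewrite <- (E_self_similar fm Ffm) in H1.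
    eapply Rle_trans; [exact H1|].
    assert (H2 := form_E am ap (u 0) (u 1)). fold fm in H2.
    assert (H3 : rsum k (fun l => E (ext_step (ext M) am ap u (bot l))) <=
      Bf * (rsum k (fun l => qform (u 0) (last_value u (bot l))
        (u (INR l / INR k + 0 / INR k)) (u (INR l / INR k + 1 / INR k))) +
        Cf * (rsum k (fun l => Tn k r (S M) (fun t => u (INR l / INR k + t / INR k))) -
              Dm k 1 u))).
    { rewrite (Dm_S k 0) by apply k_pos.
      replace (rsum k (fun l => Tn k r (S M) (fun t => u (INR l / INR k + t / INR k))) -
        rsum k (fun i => Dm k 0 (fun t => u (INR i / INR k + t / INR k)))) with
       (rsum k (fun l => Tn k r (S M) (fun t => u (INR l / INR k + t / INR k)) +
          -1 * Dm k 0 (fun t => u (INR l / INR k + t / INR k)))).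
      2:{ rewrite rsum_plus, rsum_scal; ring. }
      rewrite <- rsum_scal, <- rsum_plus, <- rsum_scal.
      apply rsum_le; intros l Hl. rewrite ext_step_bot by easy.
      eapply Rle_trans; [apply IH|]. apply Req_le. ring. }
    assert (H4 := qform_sum u).
    rewrite (Tn_S k r (S M)) by (apply k_pos || apply r_pos).
    set (Q := rsum k (fun l => qform _ _ _ _)) in *.
    set (T := rsum k (fun l => Tn k r (S M) _)) in *.
    apply (Rmult_le_compat_l (/ r)) in H3; [|lra].
    apply (Rmult_le_compat_l (Bf * / r)) in H4; [|apply Rmult_le_pos; lra].
    lra.
Qed.

(** Both functions agree in every cell that leaves the bottom side before generation M, so the
    difference is a sum over bottom cells of generation M and costs a tail of the series. At M = 0
    nothing cancels and the term [qform] remains; from M = 1 on, [qform_sum] turns it into a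
    generation-1 term. *)
Lemma ext_diff_E M j : forall am ap u,
  E (fun x => ext M am ap u x - ext (M + j) am ap u x) <=
  4 * Bf * ((if Nat.eq_dec M 0 then qform am ap (u 0) (u 1) else 0) +
            Cf * (Tn k r (S (M + j)) u - Tn k r (Nat.max M 1) u)).
Proof.
  pose proof k_cube_ge as Hk3. pose proof r_inv_pos as Hri.
  assert (HCf : 0 <= Cf) by (pose proof (pow2_ge_0 (INR k)); lra).
  induction M as [|M IH]; intros am ap u.
  - change (Nat.max 0 1) with 1%nat. rewrite Tn_1. simpl (0 + j)%nat.
    destruct (Nat.eq_dec 0 0); [|easy].
    pose proof (E_minus_le _ _ (ext_F 0 am ap u) (ext_F j am ap u)) as H1.
    pose proof (ext_E 0 am ap u) as H2. pose proof (ext_E j am ap u) as H3.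
    rewrite Tn_1, Rminus_diag, Rmult_0_r, Rplus_0_r in H2.
    assert (0 <= Tn k r (S j) u - Dm k 0 u).
    { rewrite <- (Tn_1 k r). pose proof (Tn_mono k r 1 (S j) u r_pos ltac:(lia)). lra. }
    assert (0 <= Bf * (Cf * (Tn k r (S j) u - Dm k 0 u))).
    { apply Rmult_le_pos; [lra|]. now apply Rmult_le_pos. }
    lra.
  - destruct (Nat.eq_dec (S M) 0); [easy|].
    set (g := fun x => ext (S M) am ap u x - ext (S M + j) am ap u x).
    assert (Fg : F g) by (apply F_minus; apply ext_F).
    rewrite (E_self_similar g Fg).
    set (d := fun l x => ext M (u 0) (last_value u (bot l)) (fun t => u (INR l / INR k + t / INR k)) x -
      ext (M + j) (u 0) (last_value u (bot l)) (fun t => u (INR l / INR k + t / INR k)) x).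
    assert (H1 : rsum N (fun i => E (fun x => g (Ps i x))) = rsum k (fun l => E (d l))).
    { rewrite (rsum_ext N _ (fun i => if Req_EM_T (snd (c i)) 0
         then E (fun x => g (Ps i x)) else 0)).
      - rewrite (rsum_bottom (fun i => E (fun x => g (Ps i x)))).
        apply rsum_ext; intros l Hl. destruct (bot_spec l Hl) as [Hb _].
        apply E_local; [now apply F_Ps|]. intros x Hx. unfold g, d. simpl (S M + j)%nat.
        rewrite !ext_Ps, !ext_step_bot by easy. reflexivity.
      - intros i Hi. destruct (Req_EM_T (snd (c i)) 0) as [Cz|Cz]; [easy|].
        rewrite <- (E_const 0). symmetry. apply E_local; [apply F_const|].
        intros x Hx. unfold g. simpl (S M + j)%nat. rewrite !ext_Ps by easy. unfold ext_step.
        destruct (Req_EM_T (snd (c i)) 0); [easy|ring]. }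
    rewrite H1. clear H1.
    set (uu := fun l t => u (INR l / INR k + t / INR k)).
    set (q := fun l => qform (u 0) (last_value u (bot l))
        (u (INR l / INR k + 0 / INR k)) (u (INR l / INR k + 1 / INR k))).
    assert (H2 : rsum k (fun l => E (d l)) <= 4 * Bf *
      ((if Nat.eq_dec M 0 then rsum k q else 0) +
       Cf * (rsum k (fun l => Tn k r (S (M + j)) (uu l)) -
             rsum k (fun l => Tn k r (Nat.max M 1) (uu l))))).
    { replace (rsum k (fun l => Tn k r (S (M + j)) (uu l)) -
             rsum k (fun l => Tn k r (Nat.max M 1) (uu l))) with
        (rsum k (fun l => Tn k r (S (M + j)) (uu l) + -1 * Tn k r (Nat.max M 1) (uu l)))
        by (rewrite rsum_plus, rsum_scal; ring).
      replace (if Nat.eq_dec M 0 then rsum k q else 0) with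
        (rsum k (fun l => if Nat.eq_dec M 0 then q l else 0)).
      2:{ destruct (Nat.eq_dec M 0); [easy|]. rewrite rsum_const; ring. }
      rewrite <- rsum_scal, <- rsum_plus, <- rsum_scal.
      apply rsum_le; intros l Hl. eapply Rle_trans; [apply IH|].
      apply Req_le. unfold q, uu. ring. }
    apply (Rmult_le_compat_l (/ r)) in H2; [|lra].
    eapply Rle_trans; [exact H2|].
    replace (S (S M + j)) with (S (S (M + j))) by lia.
    replace (Nat.max (S M) 1) with (S M) by lia.
    rewrite (Tn_S k r (S (M + j))) by (apply k_pos || apply r_pos).
    pose proof (qform_sum u) as H4. fold q in H4.
    apply (Rmult_le_compat_l (4 * Bf * / r)) in H4; [|apply Rmult_le_pos; lra].
    destruct (Nat.eq_dec M 0) as [-> |HM].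
    + change (Nat.max 0 1) with 1%nat. rewrite Tn_1.
      rewrite (rsum_ext k (fun l => Tn k r 1 (uu l)) (fun l => Dm k 0 (uu l)))
        by (intros; apply Tn_1).
      rewrite (Dm_S k 0 u k_pos) in H4. unfold uu. lra.
    + replace (Nat.max M 1) with M by lia.
      rewrite (Tn_S k r M) by (apply k_pos || apply r_pos).
      unfold uu. apply Req_le. ring.
Qed.

Lemma Tn_cauchy u B eps : (forall n, Tn k r n u <= B) -> 0 < eps ->
  exists M, forall n m, (M <= n)%nat -> Tn k r m u - Tn k r n u <= eps.
Proof.
  intros HB He.
  destruct (completeness (fun x => exists n, x = Tn k r n u)) as [s [Hs1 Hs2]].
  - exists B. intros x [n ->]. apply HB.
  - exists (Tn k r 0 u). now exists 0%nat.
  - destruct (classic (exists n, s - eps < Tn k r n u)) as [[M HM]|Hn].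
    + exists M. intros n m Hnm. pose proof (Tn_mono k r M n u r_pos Hnm).
      assert (Tn k r m u <= s) by (apply Hs1; now exists m). lra.
    + exfalso. assert (s <= s - eps); [|lra]. apply Hs2. intros x [n ->].
      apply Rnot_lt_le. intros A. apply Hn. now exists n.
Qed.

Lemma abs_lt_of_sq x e : 0 < e -> x ^ 2 < e ^ 2 -> Rabs x < e.
Proof.
  intros He H. rewrite <- (Rabs_right e) by lra. apply Rsqr_lt_abs_0. unfold Rsqr. simpl in H. lra.
Qed.

Definition cont01 (u : R -> R) : Prop :=
  forall t, 0 <= t <= 1 -> forall eps, 0 < eps -> exists del, 0 < del /\
    forall s, 0 <= s <= 1 -> Rabs (s - t) < del -> Rabs (u s - u t) < eps.

Lemma extension_from_bottom u B : cont01 u -> (forall n, Tn k r n u <= B) ->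
  exists f, F f /\ (forall t, 0 <= t <= 1 -> f (t, 0) = u t) /\
    (forall t, 0 <= t <= 1 -> f (t, 1) = u 0 + (u 1 - u 0) * phi t) /\
    (forall y, 0 <= y <= 1 -> f (0, y) = u 0) /\
    (forall y, 0 <= y <= 1 -> f (1, y) = u 1) /\
    E f <= 960 * INR k ^ 5 * B.
Proof.
  (* With the end values repeated at the top corners, the traces on both vertical sides are
     constant. *)
  intros Hu HB. set (e := fun M => ext M (u 0) (u 1) u).
  assert (Fe : forall M, F (e M)) by (intros; apply ext_F).
  pose proof k_cube_ge as Hk3. pose proof kR_ge3 as Hk.
  assert (HC : 0 < 4 * Bf * Cf) by (assert (0 < INR k ^ 2) by (apply pow_lt; lra); apply Rmult_lt_0_compat; lra).
  assert (Hcau : forall eps, 0 < eps -> exists M, forall m n, (M <= m)%nat -> (M <= n)%nat ->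
        E (fun x => e n x - e m x) < eps).
  { intros eps Heps. destruct (Tn_cauchy u B (eps / 2 / (4 * Bf * Cf)) HB) as [M HM].
    { apply Rdiv_lt_0_compat; lra. }
    assert (Hle : forall m n, (S M <= m <= n)%nat -> E (fun x => e m x - e n x) < eps).
    { intros m n Hmn. replace n with (m + (n - m))%nat by lia.
      eapply Rle_lt_trans; [apply ext_diff_E|]. destruct (Nat.eq_dec m 0); [lia|].
      replace (Nat.max m 1) with m by lia. rewrite Rplus_0_l, <- Rmult_assoc.
      eapply Rle_lt_trans; [apply Rmult_le_compat_l; [lra|apply HM; lia]|].
      replace (4 * Bf * Cf * (eps / 2 / (4 * Bf * Cf))) with (eps / 2); [lra|].
      field. lra. }
    exists (S M). intros m n Hm Hn. destruct (Nat.le_ge_cases n m).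
    - apply Hle; lia.
    - rewrite <- (E_local (fun x => -1 * (e m x - e n x))).
      + rewrite E_scal by now apply F_minus. replace ((-1) ^ 2) with 1 by ring.
        rewrite Rmult_1_l. apply Hle; lia.
      + apply F_scal; now apply F_minus.
      + intros x _; ring. }
  destruct (rf_complete _ _ _ HR e Fe) as [v [Fv Hv]].
  { intros eps Heps. destruct (Hcau eps Heps) as [M HM]. exists M. intros m n Hm Hn.
    now apply HM. }
  (* Completeness gives the limit up to a constant, which is fixed at a corner where all
     approximations equal [u 0]. *)
  set (f := fun x => 1 * v x + (u 0 - v (0, 1))).
  assert (Ff : F f) by now apply F_aff.
  assert (K01 : K (0, 1)) by (apply bdry_in_K; left; simpl; lra).
  assert (e01 : forall M, e M (0, 1) = u 0).
  { intros M. destruct (ext_good M (u 0) (u 1) u) as [_ H].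
    destruct (H (0, 1) K01) as (Ht & _). unfold e. rewrite Ht by easy. simpl.
    rewrite brick_left by lra. ring. }
  assert (Hlim : forall x eps, K x -> 0 < eps -> exists M, forall n, (M <= n)%nat ->
     Rabs (e n x - f x) < eps).
  { intros x eps Hx Heps. destruct (point_bound x (0, 1) Hx K01) as [C [HC0 HCb]].
    destruct (Hv (eps ^ 2 / (C + 1))) as [M HM].
    { apply Rdiv_lt_0_compat; [apply pow_lt|]; lra. }
    exists M. intros n Hn. specialize (HM n Hn).
    specialize (HCb _ (F_minus _ _ (Fe n) Fv)). cbv beta in HCb. rewrite e01 in HCb.
    apply abs_lt_of_sq; [easy|]. unfold f.
    replace (e n x - (1 * v x + (u 0 - v (0, 1)))) with (e n x - v x - (u 0 - v (0, 1))) by ring.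
    eapply Rle_lt_trans; [exact HCb|].
    pose proof (E_nonneg _ (F_minus _ _ (Fe n) Fv)) as Hnn.
    apply Rle_lt_trans with ((C + 1) * E (fun y => e n y - v y)); [apply Rmult_le_compat_r; lra|].
    apply (Rmult_lt_compat_l (C + 1)) in HM; [|lra].
    replace ((C + 1) * (eps ^ 2 / (C + 1))) with (eps ^ 2) in HM by (field; lra). easy. }
  assert (Hconst : forall x a, K x -> (forall M, e M x = a) -> f x = a).
  { intros x a Hx Ha. apply cond_eq. intros eps Heps.
    destruct (Hlim x eps Hx Heps) as [M HM]. specialize (HM M (le_n M)).
    rewrite Ha, Rabs_minus_sym in HM. easy. }
  exists f. split; [easy|]. split; [|split; [|split; [|split]]].
  - intros t Ht. apply cond_eq. intros eps Heps.
    assert (Kt : K (t, 0)) by now apply bottom_in_K.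
    destruct (Hlim (t, 0) (eps / 2) Kt) as [M HM]; [lra|].
    destruct (Hu t Ht (eps / 2)) as [del [Hdel Hc]]; [lra|].
    pose proof ik_range. destruct (geometric_small ik 1 del) as [n Hn]; try lra.
    set (m := Nat.max M n). specialize (HM m ltac:(lia)).
    destruct (ext_bottom m (u 0) (u 1) u (t, 0) Kt eq_refl)
      as (a & b & s & Ha & Hb & Hs & Da & Db & He). fold (e m) in He. simpl in Da, Db.
    assert (Hpow : ik ^ m < del).
    { apply Rle_lt_trans with (ik ^ n); [|lra].
      replace m with (n + (m - n))%nat by lia. rewrite pow_add.
      rewrite <- (Rmult_1_r (ik ^ n)) at 2. apply Rmult_le_compat_l; [apply pow_le; lra|].
      rewrite <- (pow1 (m - n)). apply pow_incr; lra. }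
    pose proof (Hc a Ha ltac:(lra)) as Ua. pose proof (Hc b Hb ltac:(lra)) as Ub.
    apply Rabs_def2 in Ua, Ub, HM.
    assert (0 <= (1 - s) * (eps / 2 - (u a - u t)) + s * (eps / 2 - (u b - u t))).
    { apply Rplus_le_le_0_compat; apply Rmult_le_pos; lra. }
    assert (0 <= (1 - s) * (eps / 2 + (u a - u t)) + s * (eps / 2 + (u b - u t))).
    { apply Rplus_le_le_0_compat; apply Rmult_le_pos; lra. }
    apply Rabs_def1; lra.
  - intros t Ht. apply Hconst; [apply bdry_in_K; left; simpl; lra|]. intros M.
    destruct (ext_good M (u 0) (u 1) u) as [_ H].
    destruct (H (t, 1)) as (A & _); [apply bdry_in_K; left; simpl; lra|]. now apply A.
  - intros y Hy. apply Hconst; [apply bdry_in_K; right; simpl; lra|]. intros M.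
    destruct (ext_good M (u 0) (u 1) u) as [_ H].
    destruct (H (0, y)) as (_ & A & _); [apply bdry_in_K; right; simpl; lra|].
    unfold e. rewrite A by easy. ring.
  - intros y Hy. apply Hconst; [apply bdry_in_K; right; simpl; lra|]. intros M.
    destruct (ext_good M (u 0) (u 1) u) as [_ H].
    destruct (H (1, y)) as (_ & _ & A); [apply bdry_in_K; right; simpl; lra|].
    unfold e. rewrite A by easy. ring.
  - unfold f. rewrite E_aff by easy. replace (1 ^ 2) with 1 by ring. rewrite Rmult_1_l.
    apply le_epsilon. intros eps Heps. destruct (Hv (eps / 2)) as [M HM]; [lra|].
    specialize (HM M (le_n M)).
    pose proof (E_minus_le _ _ (Fe M) (F_minus _ _ (Fe M) Fv)) as H1. cbv beta in H1.
    rewrite (E_local (fun x => e M x - (e M x - v x)) v) in H1;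
      [|apply F_minus; [easy|now apply F_minus]|intros x _; ring].
    pose proof (ext_E M (u 0) (u 1) u) as H2. fold (e M) in H2.
    pose proof (HB (S M)) as HT. pose proof (HB 1%nat) as HT1.
    assert (Hq : qform (u 0) (u 1) (u 0) (u 1) = 2 * Dm k 0 u).
    { unfold qform. rewrite Dm_0. ring. }
    rewrite Hq in H2.
    assert (HD1 : Dm k 0 u <= B).
    { rewrite Tn_1 in HT1; lra. }
    pose proof (Dm_nonneg k 0 u).
    (* From 2 + 3 k^2 <= 5 k^2; multiplying by 96 k^3 and by the 2 of [E_minus_le] gives 960 k^5. *)
    assert (Hin : 2 * Dm k 0 u + Cf * (Tn k r (S M) u - Dm k 0 u) <= 5 * INR k ^ 2 * B).
    { assert (1 <= INR k ^ 2) by (apply pow_R1_Rle; lra).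
      assert (INR k ^ 2 * (Tn k r (S M) u - Dm k 0 u) <= INR k ^ 2 * B)
        by (apply Rmult_le_compat_l; lra).
      assert (1 * B <= INR k ^ 2 * B) by (apply Rmult_le_compat_r; lra). lra. }
    apply (Rmult_le_compat_l Bf) in Hin; [|lra].
    replace (960 * INR k ^ 5 * B) with (2 * (Bf * (5 * INR k ^ 2 * B))) by ring. lra.
Qed.

(** * Upper bound for the renormalization factor *)

Lemma geometric_sum_le q n : 0 <= q < 1 -> rsum n (fun m => q ^ m) <= / (1 - q).
Proof.
  intros Hq. apply (Rmult_le_reg_r (1 - q)); [lra|]. rewrite Rinv_l by lra.
  assert (H : rsum n (fun m => q ^ m) * (1 - q) = 1 - q ^ n).
  { induction n as [|n IH]; [unfold rsum; simpl; ring|].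
    rewrite rsum_S, Rmult_plus_distr_r, IH. simpl; ring. }
  rewrite H. pose proof (pow_le q n (proj1 Hq)). lra.
Qed.

Lemma Dm_id m : Dm k m (fun t => t) = ik ^ m.
Proof.
  pose proof (INR_pow_pos k m k_pos) as Hp. pose proof kR_ge3.
  unfold Dm. rewrite (rsum_ext _ _ (fun _ => (/ INR (k ^ m)) ^ 2)).
  - rewrite rsum_const, (pow_inv (INR k) m), <- pow_INR. field. lra.
  - intros l _. rewrite plus_INR. simpl (INR 1). field. lra.
Qed.

(** For the identity the series is geometric with ratio 1/(k r), hence the assumption on r. The
    one-sided extension has the brick trace on top; adding its mirror image and subtracting the
    brick restores the first coordinate on the whole boundary. *)
Lemma linear_trace_exists : ik < r ->
  exists l, F l /\ forall p, on_bdry p -> l p = fst p.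
Proof.
  intros Hr. pose proof ik_range. pose proof kR_ge3. pose proof k_ik. pose proof r_pos.
  set (q := ik / r).
  assert (Hq : 0 <= q < 1).
  { unfold q. split; [apply Rmult_le_pos; [lra|left; apply r_inv_pos]|].
    apply (Rmult_lt_reg_r r); [easy|]. unfold Rdiv. rewrite Rmult_assoc, Rinv_l; lra. }
  destruct (extension_from_bottom (fun t => t) (/ (1 - q))) as (f & Ff & Fb & Ft & Fl & Fr & _).
  - intros t _ eps He. now exists eps.
  - intros n. eapply Rle_trans; [|apply (geometric_sum_le q n Hq)].
    apply Req_le, rsum_ext. intros m _. rewrite Dm_id. unfold q, Rdiv.
    rewrite Rpow_mult_distr, !pow_inv. ring.
  - assert (Ff' : F (fun p => f (fst p, 1 - snd p))) by now apply (F_D4 _ _ D4_refy).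
    exists (fun p => (f p + f (fst p, 1 - snd p)) - h p). split.
    + apply (F_minus (fun p => f p + f (fst p, 1 - snd p)) h); [now apply F_plus|apply brick_F].
    + intros [x y] [[Hx [Hy|Hy]]|[Hy [Hx|Hx]]]; simpl in *; subst.
      * rewrite Rminus_0_r, Fb, Ft by lra. ring.
      * rewrite Rminus_diag, Fb, Ft, brick_top by lra. ring.
      * rewrite !Fl, brick_left by lra. ring.
      * rewrite !Fr, brick_right by lra. ring.
Qed.

Lemma bdry_preimage i x : (i < N)%nat -> K x -> on_bdry (Ps i x) -> on_bdry x.
Proof.
  intros Hi Hx Hb. pose proof (K_in_square x Hx) as [X1 X2].
  pose proof (c_range i Hi) as [C1 C2]. pose proof ik_range.
  assert (0 <= fst x * ik) by (apply Rmult_le_pos; lra).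
  assert (fst x * ik <= 1 * ik) by (apply Rmult_le_compat_r; lra).
  assert (0 <= snd x * ik) by (apply Rmult_le_pos; lra).
  assert (snd x * ik <= 1 * ik) by (apply Rmult_le_compat_r; lra).
  unfold on_bdry in *. rewrite fst_Ps, snd_Ps in Hb.
  destruct Hb as [[_ [Hb|Hb]]|[_ [Hb|Hb]]].
  - left; split; [easy|left]. apply (Rmult_eq_reg_r ik); lra.
  - left; split; [easy|right]. apply (Rmult_eq_reg_r ik); lra.
  - right; split; [easy|left]. apply (Rmult_eq_reg_r ik); lra.
  - right; split; [easy|right]. apply (Rmult_eq_reg_r ik); lra.
Qed.

(** The coordinate function satisfies x_1(Psi_i x) = x_1/k + c_i, so scaled and shifted copies of
    one extension glue to another extension of the same trace, with energy multiplied by N/(r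
    k^2). *)
Lemma linear_trace_iterate l n : F l -> (forall p, on_bdry p -> l p = fst p) ->
  exists g, F g /\ (forall p, on_bdry p -> g p = fst p) /\
    E g = (/ r * INR N * ik ^ 2) ^ n * E l.
Proof.
  intros Fl Hl. induction n as [|n (g & Fg & Hg & Eg)].
  - exists l. repeat split; try easy. simpl; ring.
  - set (f := fun i p => ik * g p + fst (c i)).
    assert (Ff : forall i, (i < N)%nat -> F (f i)) by (intros; now apply F_aff).
    assert (HC : compatible f).
    { intros i j x y Hi Hj Hx Hy Hij He.
      destruct (common_point i j x y Hi Hj Hx Hy Hij He) as [Bx By].
      unfold f. rewrite !Hg by easy.
      assert (E1 : fst (Ps i x) = fst (Ps j y)) by now rewrite He.
      rewrite !fst_Ps in E1. lra. }
    exists (glue f). split; [now apply F_glue|]. split.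
    + intros p Hp. pose proof (bdry_in_K p Hp) as Kp.
      destruct (K_preimage p Kp) as [i [x [Hi [Hx ->]]]]. rewrite glue_spec by easy.
      unfold f. rewrite Hg by now apply (bdry_preimage i). rewrite fst_Ps. ring.
    + rewrite E_glue by easy. rewrite (rsum_ext N _ (fun _ => ik ^ 2 * E g)).
      * rewrite rsum_const, Eg. simpl. ring.
      * intros i Hi. unfold f. now rewrite E_aff.
Qed.

(* If r > 1/k, the iterates above have unit drop across the square, hence energy at
   least 1, whatever the number of iterations; so N / (r k^2) >= 1. *)
Lemma r_upper_brick : r <= 1 - ik ^ 2.
Proof.
  pose proof ik_range. pose proof kR_ge3. pose proof k_ik. pose proof r_pos. pose proof r_inv_pos.
  destruct (Rle_dec r ik) as [Hr|Hr].
  - assert (ik ^ 2 <= / 3 * / 3).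
    { simpl. rewrite Rmult_1_r. apply Rmult_le_compat; lra. } lra.
  - destruct linear_trace_exists as (l & Fl & Hl); [lra|].
    set (q := / r * INR N * ik ^ 2).
    assert (Hik2 : 0 < ik ^ 2) by (apply pow_lt; lra).
    assert (Hq0 : 0 <= q).
    { unfold q. apply Rmult_le_pos; [apply Rmult_le_pos; [lra|apply pos_INR]|lra]. }
    assert (Hge : forall n, 1 <= q ^ n * E l).
    { intros n. destruct (linear_trace_iterate l n Fl Hl) as (g & Fg & Hg & Eg).
      fold q in Eg. rewrite <- Eg.
      assert (Hs : (0 - -1) ^ 2 <= E (fun p => -1 * g p)).
      { apply E_separates_sides; [now apply F_scal|lra| |]; intros y Hy.
        - rewrite Hg by (right; simpl; lra). simpl; lra.
        - rewrite Hg by (right; simpl; lra). simpl; lra. }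
      rewrite E_scal in Hs by easy. lra. }
    assert (Hq1 : 1 <= q).
    { apply Rnot_lt_le. intros Hlt.
      destruct (geometric_small q (E l) 1) as [n Hn]; [easy|now apply E_nonneg|lra|].
      specialize (Hge n). lra. }
    assert (HN : INR N * ik ^ 2 <= 1 - ik ^ 2).
    { destruct HU as (_ & _ & HN & _).
      assert (HN' : INR N <= INR k ^ 2 - 1).
      { replace (INR k ^ 2 - 1) with (INR (k * k - 1)).
        - now apply le_INR.
        - pose proof k_pos. rewrite minus_INR, mult_INR by nia. simpl; ring. }
      apply (Rmult_le_compat_r (ik ^ 2)) in HN'; [|lra].
      replace ((INR k ^ 2 - 1) * ik ^ 2) with (1 - ik ^ 2) in HN' by (field; lra). easy. }
    unfold q in Hq1. apply (Rmult_le_compat_l r) in Hq1; [|lra].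
    replace (r * (/ r * INR N * ik ^ 2)) with (INR N * ik ^ 2) in Hq1 by (field; lra). lra.
Qed.

(** * Extension from the boundary of the square *)

(** Subtracting the brick that interpolates the end values removes the traces on the other three
    sides, so corrections for different sides do not interfere. *)
Lemma side_correction v B : cont01 v -> (forall n, Tn k r n v <= B) ->
  exists W, F W /\ (forall t, 0 <= t <= 1 -> W (t, 0) = v t - (v 0 + (v 1 - v 0) * phi t)) /\
    (forall t, 0 <= t <= 1 -> W (t, 1) = 0 /\ W (0, t) = 0 /\ W (1, t) = 0) /\
    E W <= 2000 * INR k ^ 5 * B.
Proof.
  intros Hv HB. destruct (extension_from_bottom v B Hv HB) as (f & Ff & Fb & Ft & Fl & Fr & Ef).
  assert (Fg : F (fun p => (v 1 - v 0) * h p + v 0)) by apply F_aff, brick_F.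
  exists (fun p => f p - ((v 1 - v 0) * h p + v 0)). split; [now apply F_minus|].
  split; [|split].
  - intros t Ht. rewrite Fb by easy. ring.
  - intros t Ht. rewrite Ft, Fl, Fr, brick_top, brick_left, brick_right by easy.
    repeat split; ring.
  - pose proof (E_minus_le f _ Ff Fg) as H1. cbv beta in H1.
    rewrite (E_aff _ _ h brick_F) in H1. pose proof brick_E as H2.
    apply (Rmult_le_compat_l ((v 1 - v 0) ^ 2)) in H2; [|apply pow2_ge_0].
    pose proof (HB 1%nat) as H3. rewrite Tn_1, Dm_0 in H3.
    replace ((v 0 - v 1) ^ 2) with ((v 1 - v 0) ^ 2) in H3 by ring.
    pose proof (pow2_ge_0 (v 1 - v 0)).
    assert (1 <= INR k ^ 5) by (apply pow_R1_Rle; pose proof kR_ge3; lra).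
    assert (1 * B <= INR k ^ 5 * B) by (apply Rmult_le_compat_r; lra). lra.
Qed.

(** The minimum of the brick and its transpose is 1 at one corner, has the brick trace on the two
    sides through it, and vanishes on the others. *)
Lemma corner_brick : exists b, F b /\ E b <= 24 /\ forall t, 0 <= t <= 1 ->
  b (t, 0) = 0 /\ b (t, 1) = phi t /\ b (0, t) = 0 /\ b (1, t) = phi t.
Proof.
  assert (Iv : unit_valued (fun p => h (snd p, fst p))).
  { intros p Hp. now apply brick_unit, K_swap. }
  destruct (F_min h (fun p => h (snd p, fst p)) brick_F (F_swap h brick_F) brick_unit Iv)
    as [Fb Eb0]. cbv beta in Eb0. rewrite (E_swap h brick_F) in Eb0. pose proof brick_E.
  exists (fun p => Rmin (h p) (h (snd p, fst p))). split; [easy|]. split; [lra|].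
  intros t Ht. simpl.
  assert (U : 0 <= phi t <= 1) by now apply brick_unit, bottom_in_K.
  rewrite !brick_left, !brick_right, !brick_top by lra.
  repeat split; [apply Rmin_right|apply Rmin_left|apply Rmin_left|apply Rmin_right]; lra.
Qed.

Lemma phi_symmetric t : 0 <= t <= 1 -> phi (1 - t) = 1 - phi t.
Proof. intros Ht. now apply Hh. Qed.

(** Corner values are interpolated first, with traces affine in the brick trace on every side; the
    four side corrections then supply the remainders. *)
Lemma boundary_extension_brick u B0 B1 B2 B3 :
  cont01 (fun t => u (t, 0)) -> cont01 (fun t => u (1, t)) ->
  cont01 (fun t => u (1 - t, 1)) -> cont01 (fun t => u (0, 1 - t)) ->
  (forall n, Tn k r n (fun t => u (t, 0)) <= B0) -> (forall n, Tn k r n (fun t => u (1, t)) <= B1) ->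
  (forall n, Tn k r n (fun t => u (1 - t, 1)) <= B2) ->
  (forall n, Tn k r n (fun t => u (0, 1 - t)) <= B3) ->
  exists f, F f /\ (forall p, on_bdry p -> f p = u p) /\
    E f <= 20000 * INR k ^ 5 * (B0 + B1 + B2 + B3).
Proof.
  intros C0 C1 C2 C3 H0 H1 H2 H3.
  destruct (side_correction _ _ C0 H0) as (W0 & F0 & V0 & Z0 & E0).
  destruct (side_correction _ _ C1 H1) as (W1 & F1 & V1 & Z1 & E1).
  destruct (side_correction _ _ C2 H2) as (W2 & F2 & V2 & Z2 & E2).
  destruct (side_correction _ _ C3 H3) as (W3 & F3 & V3 & Z3 & E3).
  cbv beta in V0, V1, V2, V3.
  destruct corner_brick as (b & Fb & Ebb & Hb).
  (* Rotations taking the right, top and left sides to the bottom, with the orientations used in the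
     hypotheses. *)
  set (I1 := fun p : pt => (snd p, 1 - fst p)). set (I2 := fun p : pt => (1 - fst p, 1 - snd p)).
  set (I3 := fun p : pt => (1 - snd p, fst p)).
  assert (D1 : In I1 D4) by (simpl; tauto). assert (D2 : In I2 D4) by (simpl; tauto).
  assert (D3 : In I3 D4) by (simpl; tauto).
  pose proof (F_D4 _ _ D1 F1) as F1'. pose proof (E_D4 _ _ D1 F1) as E1'.
  pose proof (F_D4 _ _ D2 F2) as F2'. pose proof (E_D4 _ _ D2 F2) as E2'.
  pose proof (F_D4 _ _ D3 F3) as F3'. pose proof (E_D4 _ _ D3 F3) as E3'.
  pose proof (F_D4 _ _ D4_refy Fb) as Fy. pose proof (E_D4 _ _ D4_refy Fb) as Ey.
  pose proof (F_D4 _ _ D4_refx Fb) as Fx. pose proof (E_D4 _ _ D4_refx Fb) as Ex.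
  cbv beta in *.
  set (a2 := u (1, 0) - u (0, 0)). set (a3 := u (1, 1) - u (0, 0)). set (a4 := u (0, 1) - u (0, 0)).
  (* Only three corners get a bump: the fourth enters through the constant [u (0, 0)], thanks to
     [phi_symmetric]. *)
  set (X := fun p : pt => a2 * b (fst p, 1 - snd p)). set (Y := fun p => a3 * b p).
  set (Z := fun p : pt => a4 * b (1 - fst p, snd p) + u (0, 0)).
  assert (FX : F X) by now apply F_scal. assert (FY : F Y) by now apply F_scal.
  assert (FZ : F Z) by now apply F_aff.
  assert (EX : E X <= 24 * a2 ^ 2).
  { unfold X. rewrite E_scal, Ey by easy. pose proof (pow2_ge_0 a2).
    apply (Rmult_le_compat_l (a2 ^ 2)) in Ebb; lra. }
  assert (EY : E Y <= 24 * a3 ^ 2).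
  { unfold Y. rewrite E_scal by easy. pose proof (pow2_ge_0 a3).
    apply (Rmult_le_compat_l (a3 ^ 2)) in Ebb; lra. }
  assert (EZ : E Z <= 24 * a4 ^ 2).
  { unfold Z. rewrite E_aff, Ex by easy. pose proof (pow2_ge_0 a4).
    apply (Rmult_le_compat_l (a4 ^ 2)) in Ebb; lra. }
  assert (FXY : F (fun p => X p + Y p)) by now apply F_plus.
  assert (FC : F (fun p => (X p + Y p) + Z p)) by now apply (F_plus (fun p => X p + Y p)).
  assert (FA : F (fun p => W0 p + W1 (I1 p))) by now apply F_plus.
  assert (FB : F (fun p => W2 (I2 p) + W3 (I3 p))) by now apply F_plus.
  assert (FW : F (fun p => (W0 p + W1 (I1 p)) + (W2 (I2 p) + W3 (I3 p))))
    by now apply (F_plus (fun p => W0 p + W1 (I1 p))).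
  exists (fun p => ((X p + Y p) + Z p) + ((W0 p + W1 (I1 p)) + (W2 (I2 p) + W3 (I3 p)))).
  split; [now apply (F_plus (fun p => (X p + Y p) + Z p))|]. split.
  - intros [x y] [[Hx [Hy|Hy]]|[Hy [Hx|Hx]]]; simpl in Hx, Hy; subst; unfold X, Y, Z, I1, I2, I3; simpl.
    + replace (1 - 0) with 1 by ring. assert (Hx' : 0 <= 1 - x <= 1) by lra.
      destruct (Hb x Hx) as (b1 & b2 & _). destruct (Hb (1 - x) Hx') as (b3 & _).
      destruct (Z1 (1 - x) Hx') as (_ & z1 & _). destruct (Z2 (1 - x) Hx') as (z2 & _).
      destruct (Z3 x Hx) as (_ & _ & z3).
      rewrite b1, b2, b3, z1, z2, z3, V0 by easy. unfold a2. ring.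
    + replace (1 - 1) with 0 by ring. assert (Hx' : 0 <= 1 - x <= 1) by lra.
      destruct (Hb x Hx) as (b1 & b2 & _). destruct (Hb (1 - x) Hx') as (_ & b3 & _).
      destruct (Z1 (1 - x) Hx') as (_ & _ & z1). destruct (Z0 x Hx) as (z0 & _).
      destruct (Z3 x Hx) as (_ & z3 & _).
      rewrite b1, b2, b3, z1, z0, z3, V2, phi_symmetric by easy.
      replace (1 - (1 - x)) with x by ring. replace (1 - 0) with 1 by ring.
      replace (1 - 1) with 0 by ring. unfold a3, a4. ring.
    + replace (1 - 0) with 1 by ring. assert (Hy' : 0 <= 1 - y <= 1) by lra.
      destruct (Hb y Hy) as (_ & _ & b1 & b2). destruct (Hb (1 - y) Hy') as (_ & _ & b3 & _).
      destruct (Z1 y Hy) as (z1 & _). destruct (Z0 y Hy) as (_ & z0 & _).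
      destruct (Z2 (1 - y) Hy') as (_ & _ & z2).
      rewrite b1, b2, b3, z1, z0, z2, V3, phi_symmetric by easy.
      replace (1 - (1 - y)) with y by ring. replace (1 - 0) with 1 by ring.
      replace (1 - 1) with 0 by ring. unfold a4. ring.
    + replace (1 - 1) with 0 by ring. assert (Hy' : 0 <= 1 - y <= 1) by lra.
      destruct (Hb y Hy) as (_ & _ & b1 & b2). destruct (Hb (1 - y) Hy') as (_ & _ & _ & b3).
      destruct (Z0 y Hy) as (_ & _ & z0). destruct (Z2 (1 - y) Hy') as (_ & z2 & _).
      destruct (Z3 (1 - y) Hy') as (z3 & _).
      rewrite b1, b2, b3, z0, z2, z3, V1, phi_symmetric by easy. unfold a2, a3. ring.
  - pose proof (E_plus_le _ _ FC FW) as A1. pose proof (E_plus_le _ _ FXY FZ) as A2.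
    pose proof (E_plus_le _ _ FX FY) as A3. pose proof (E_plus_le _ _ FA FB) as A4.
    pose proof (E_plus_le _ _ F0 F1') as A5. pose proof (E_plus_le _ _ F2' F3') as A6.
    cbv beta in *.
    pose proof (H0 1%nat) as T0. pose proof (H1 1%nat) as T1.
    pose proof (H2 1%nat) as T2. pose proof (H3 1%nat) as T3.
    rewrite Tn_1, Dm_0 in T0, T1, T2, T3.
    replace (1 - 0) with 1 in T3 by ring. replace (1 - 1) with 0 in T3 by ring.
    assert (S2 : a2 ^ 2 <= B0) by (unfold a2; lra).
    assert (S4 : a4 ^ 2 <= B3) by (unfold a4; lra).
    assert (S3 : a3 ^ 2 <= 2 * B0 + 2 * B1).
    { assert (0 <= ((u (1, 0) - u (0, 0)) - (u (1, 1) - u (1, 0))) ^ 2) by apply pow2_ge_0.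
      unfold a3. lra. }
    pose proof (pow2_ge_0 (u (1 - 0, 1) - u (1 - 1, 1))).
    pose proof (pow2_ge_0 (u (0, 0) - u (1, 0))). pose proof (pow2_ge_0 (u (1, 0) - u (1, 1))).
    pose proof (pow2_ge_0 (u (0, 1) - u (0, 0))).
    assert (1 <= INR k ^ 5) by (apply pow_R1_Rle; pose proof kR_ge3; lra).
    assert (1 * (B0 + B1 + B2 + B3) <= INR k ^ 5 * (B0 + B1 + B2 + B3))
      by (apply Rmult_le_compat_r; lra).
    lra.
Qed.

End Extension.

Lemma r_upper : r <= 1 - ik ^ 2.
Proof. destruct horizontal_brick_exists as [h Hh]. exact (r_upper_brick h Hh). Qed.

Lemma boundary_extension u B0 B1 B2 B3 :
  cont01 (fun t => u (t, 0)) -> cont01 (fun t => u (1, t)) ->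
  cont01 (fun t => u (1 - t, 1)) -> cont01 (fun t => u (0, 1 - t)) ->
  (forall n, Tn k r n (fun t => u (t, 0)) <= B0) -> (forall n, Tn k r n (fun t => u (1, t)) <= B1) ->
  (forall n, Tn k r n (fun t => u (1 - t, 1)) <= B2) ->
  (forall n, Tn k r n (fun t => u (0, 1 - t)) <= B3) ->
  exists f, F f /\ (forall p, on_bdry p -> f p = u p) /\
    E f <= 20000 * INR k ^ 5 * (B0 + B1 + B2 + B3).
Proof.
  destruct horizontal_brick_exists as [h Hh]. exact (boundary_extension_brick h Hh u B0 B1 B2 B3).
Qed.

(** * Uniform resistance between corners *)

Lemma corner_bound_abs rho f : corner_bound rho -> F f ->
  Rabs (f (0, 0) - f (1, 0)) <= sqrt (rho * E f).
Proof.
  intros H Hf. rewrite <- sqrt_Rsqr_abs. apply sqrt_le_1_alt. rewrite Rsqr_pow2. now apply H.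
Qed.

(** Since r <= 1 - 1/k^2 <= (1 - 1/(2 k^2))^2, oscillation bounds contract from a cell to its
    subcells at a rate depending on k alone. *)
Lemma sqrt_energy_scaled rho e e' : 0 <= rho -> 0 <= e -> e' <= r * e ->
  sqrt (rho * e') <= (1 - ik ^ 2 / 2) * sqrt (rho * e).
Proof.
  intros Hrho He He'. pose proof ik_range. pose proof r_pos. pose proof r_upper.
  assert (Hi2 : 0 <= ik ^ 2 <= / 3 * / 3).
  { split; [apply pow_le; lra|]. simpl. rewrite Rmult_1_r. apply Rmult_le_compat; lra. }
  assert (H2 : r <= (1 - ik ^ 2 / 2) ^ 2) by (pose proof (pow2_ge_0 (ik ^ 2)); lra).
  rewrite <- (sqrt_pow2 (1 - ik ^ 2 / 2)) by lra. rewrite <- sqrt_mult_alt by apply pow2_ge_0.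
  apply sqrt_le_1_alt.
  apply Rle_trans with (rho * (r * e)); [now apply Rmult_le_compat_l|].
  assert (0 <= rho * e) by now apply Rmult_le_pos.
  apply (Rmult_le_compat_r (rho * e)) in H2; lra.
Qed.

Lemma bottom_chain rho f i : 0 <= rho -> corner_bound rho -> F f -> (i <= k)%nat ->
  Rabs (f (INR i / INR k, 0) - f (0, 0)) <= INR i * sqrt (rho * E f).
Proof.
  intros Hrho H Hf. pose proof kR_ge3. induction i as [|i IH]; intros Hi.
  - simpl INR. replace (0 / INR k) with 0 by (field; lra). rewrite Rminus_diag, Rabs_R0. lra.
  - specialize (IH ltac:(lia)). destruct (bot_spec i ltac:(lia)) as [Hb _].
    pose proof (corner_bound_abs rho _ H (F_Ps f (bot i) Hf Hb)) as H1. cbv beta in H1.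
    rewrite !Ps_bot_grid, Rplus_0_r in H1 by lia.
    pose proof (sqrt_energy_scaled rho _ _ Hrho (E_nonneg f Hf) (E_Ps_le f (bot i) Hf Hb)) as H2.
    pose proof (sqrt_pos (rho * E f)). pose proof ik_range.
    assert (0 <= ik ^ 2 / 2 * sqrt (rho * E f)).
    { apply Rmult_le_pos; [|easy]. pose proof (pow2_ge_0 ik); lra. }
    replace (f (INR (S i) / INR k, 0) - f (0, 0)) with
      ((f (INR i / INR k, 0) - f (0, 0)) + - (f (INR i / INR k, 0) - f (INR (S i) / INR k, 0))) by ring.
    eapply Rle_trans; [apply Rabs_triang|]. rewrite Rabs_Ropp, (S_INR i). lra.
Qed.

(** The value [l = a * b] is put at the right end of the last block, as the grid includes the
    endpoint 1. *)
Lemma div_mod_closed a b l : (0 < a)%nat -> (l <= a * b)%nat ->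
  exists i l', (i < a)%nat /\ (l' <= b)%nat /\ l = (i * b + l')%nat.
Proof.
  intros Ha. destruct (Nat.eq_dec l (a * b)) as [->|Hne].
  - intros _. exists (a - 1)%nat, b. repeat split; nia.
  - intros Hl. exists (l / b)%nat, (l mod b)%nat.
    assert (b <> 0%nat) by (intros ->; lia).
    pose proof (Nat.mod_upper_bound l b H). pose proof (Nat.div_mod_eq l b).
    repeat split; [|lia|lia]. apply Nat.Div0.div_lt_upper_bound. lia.
Qed.

(** A grid point is reached by at most k steps along the row and then a path inside one cell. The
    constant D = 2 k^3 solves D = k + (1 - 1/(2 k^2)) D, so it does not depend on the depth. *)
Lemma grid_oscillation rho M : 0 <= rho -> corner_bound rho -> forall f l, F f ->
  (l <= k ^ M)%nat ->
  Rabs (f (INR l / INR (k ^ M), 0) - f (0, 0)) <= 2 * INR k ^ 3 * sqrt (rho * E f).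
Proof.
  intros Hrho H. pose proof kR_ge3. pose proof k_cube_ge. pose proof ik_range.
  induction M as [|M IH]; intros f l Hf Hl.
  - pose proof (sqrt_pos (rho * E f)).
    assert (1 * sqrt (rho * E f) <= INR k ^ 3 * sqrt (rho * E f)) by (apply Rmult_le_compat_r; lra).
    simpl (k ^ 0)%nat in *. simpl (INR 1). rewrite Rdiv_1_r.
    destruct l as [|[|l]]; [| |lia]; simpl INR.
    + rewrite Rminus_diag, Rabs_R0. lra.
    + rewrite Rabs_minus_sym. pose proof (corner_bound_abs rho f H Hf). lra.
  - destruct (div_mod_closed k (k ^ M) l k_pos Hl) as (i & l' & Hi & Hl' & ->).
    destruct (bot_spec i Hi) as [Hb _].
    specialize (IH _ l' (F_Ps f (bot i) Hf Hb) Hl'). cbv beta in IH.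
    pose proof (INR_pow_pos k M k_pos) as Hp.
    rewrite !Ps_bot_grid, Rplus_0_r in IH by easy.
    replace ((INR i + INR l' / INR (k ^ M)) / INR k) with
      (INR (i * k ^ M + l') / INR (k ^ S M)) in IH.
    2:{ simpl (k ^ S M)%nat. rewrite plus_INR, !mult_INR. field. lra. }
    pose proof (bottom_chain rho f i Hrho H Hf ltac:(lia)) as Hch.
    pose proof (sqrt_energy_scaled rho _ _ Hrho (E_nonneg f Hf) (E_Ps_le f (bot i) Hf Hb)) as H3.
    cbv beta in H3. set (s := sqrt (rho * E f)) in *.
    pose proof (sqrt_pos (rho * E f)) as Hs. fold s in Hs.
    assert (H4 : INR i * s <= INR k * s) by (apply Rmult_le_compat_r; [easy|apply le_INR; lia]).
    apply (Rmult_le_compat_l (2 * INR k ^ 3)) in H3; [|lra].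
    replace (2 * INR k ^ 3 * ((1 - ik ^ 2 / 2) * s)) with (2 * INR k ^ 3 * s - INR k * s) in H3
      by (field; lra).
    replace (f (INR (i * k ^ M + l') / INR (k ^ S M), 0) - f (0, 0)) with
      ((f (INR (i * k ^ M + l') / INR (k ^ S M), 0) - f (INR i / INR k, 0)) +
       (f (INR i / INR k, 0) - f (0, 0))) by ring.
    eapply Rle_trans; [apply Rabs_triang|]. lra.
Qed.

(** The grid points of all generations are dense in the side and [f] is continuous. *)
Lemma bottom_oscillation rho f t : 0 <= rho -> corner_bound rho -> F f -> 0 <= t <= 1 ->
  Rabs (f (t, 0) - f (0, 0)) <= 2 * INR k ^ 3 * sqrt (rho * E f).
Proof.
  intros Hrho H Hf Ht. apply le_epsilon. intros eps Heps.
  destruct (F_continuous f Hf (t, 0) (bottom_in_K t Ht) eps Heps) as [del [Hdel Hc]].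
  pose proof ik_range. destruct (geometric_small ik 1 del) as [M HM]; try lra.
  pose proof (INR_pow_pos k M k_pos) as Hp.
  rewrite Rmult_1_l, pow_inv, <- pow_INR in HM.
  destruct (nfloor_ex (t * INR (k ^ M))) as [l Hl]; [apply Rmult_le_pos; lra|].
  assert (Hlk : (l <= k ^ M)%nat).
  { apply INR_le. apply Rle_trans with (t * INR (k ^ M)); [easy|].
    rewrite <- (Rmult_1_l (INR (k ^ M))) at 2. apply Rmult_le_compat_r; lra. }
  set (y := INR l / INR (k ^ M)).
  assert (Hy : 0 <= t - y <= / INR (k ^ M)).
  { replace (t - y) with ((t * INR (k ^ M) - INR l) * / INR (k ^ M)) by (unfold y; field; lra).
    pose proof (Rinv_0_lt_compat _ Hp). split; [apply Rmult_le_pos; lra|].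
    rewrite <- (Rmult_1_l (/ INR (k ^ M))) at 2. apply Rmult_le_compat_r; lra. }
  assert (Hy0 : 0 <= y) by (apply Rmult_le_pos; [apply pos_INR|left; now apply Rinv_0_lt_compat]).
  assert (Hcy : Rabs (f (y, 0) - f (t, 0)) < eps).
  { apply Hc; [apply bottom_in_K; lra|]. eapply Rle_lt_trans; [apply edist_le|]. simpl.
    rewrite Rminus_diag, Rabs_R0, (Rabs_right (t - y)) by lra. lra. }
  pose proof (grid_oscillation rho M Hrho H f l Hf Hlk) as Hg. fold y in Hg.
  replace (f (t, 0) - f (0, 0)) with ((f (y, 0) - f (0, 0)) + - (f (y, 0) - f (t, 0))) by ring.
  eapply Rle_trans; [apply Rabs_triang|]. rewrite Rabs_Ropp. lra.
Qed.

Lemma vertical_oscillation rho f y : 0 <= rho -> corner_bound rho -> F f -> 0 <= y <= 1 ->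
  Rabs (f (0, y) - f (0, 0)) <= 2 * INR k ^ 3 * sqrt (rho * E f) /\
  Rabs (f (1, y) - f (1, 0)) <= 2 * INR k ^ 3 * sqrt (rho * E f).
Proof.
  intros Hrho H Hf Hy.
  assert (Hrot : In (fun p : pt => (1 - snd p, fst p)) D4) by (simpl; tauto).
  pose proof (bottom_oscillation rho _ y Hrho H (F_D4 _ _ D4_swap Hf) Hy) as H1.
  pose proof (bottom_oscillation rho _ y Hrho H (F_D4 _ _ Hrot Hf) Hy) as H2.
  cbv beta in H1, H2. rewrite (E_D4 _ _ D4_swap Hf) in H1. rewrite (E_D4 _ _ Hrot Hf) in H2.
  simpl in H1, H2.
  replace (1 - 0) with 1 in H2 by ring. now split.
Qed.

(** * Folding a row of cells and improving the corner resistance *)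

Definition Phi (p l : nat) (x : pt) : pt :=
  ((fst x + INR l) / INR (k ^ p), snd x / INR (k ^ p)).

Lemma Phi_S p i l x : (i < k)%nat -> Phi (S p) (i * k ^ p + l) x = Ps (bot i) (Phi p l x).
Proof.
  intros Hi. rewrite Ps_bot by easy. unfold Phi. simpl (k ^ S p)%nat. simpl.
  pose proof (INR_pow_pos k p k_pos). pose proof kR_ge3.
  rewrite plus_INR, !mult_INR. f_equal; field; lra.
Qed.

Lemma Phi_F p : forall f l, F f -> (l < k ^ p)%nat -> F (fun x => f (Phi p l x)).
Proof.
  induction p as [|p IH]; intros f l Hf Hl.
  - simpl in Hl. replace l with 0%nat by lia. apply F_local with f; [easy|].
    intros [x y] _. unfold Phi; simpl. f_equal. f_equal; field.
  - assert (Hp : (0 < k ^ p)%nat) by (apply INR_lt; apply INR_pow_pos, k_pos).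
    pose proof (Nat.div_mod_eq l (k ^ p)) as Hd.
    assert (Hi : (l / k ^ p < k)%nat).
    { apply Nat.Div0.div_lt_upper_bound. simpl in Hl. lia. }
    replace l with (l / k ^ p * k ^ p + l mod k ^ p)%nat by lia.
    apply F_local with (fun x => f (Ps (bot (l / k ^ p)) (Phi p (l mod k ^ p) x))).
    + apply (IH (fun x => f (Ps (bot (l / k ^ p)) x))).
      * apply F_Ps; [easy|now apply bot_spec].
      * apply Nat.mod_upper_bound. lia.
    + intros x _. now rewrite Phi_S.
Qed.

Lemma Phi_E p : forall f, F f -> rsum (k ^ p) (fun l => E (fun x => f (Phi p l x))) <= r ^ p * E f.
Proof.
  induction p as [|p IH]; intros f Hf.
  - simpl (k ^ 0)%nat. rewrite rsum_1. simpl pow. rewrite Rmult_1_l. apply Req_le.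
    symmetry. apply E_local; [easy|]. intros [x y] _. unfold Phi; simpl. f_equal. f_equal; field.
  - simpl (k ^ S p)%nat. rewrite rsum_mul.
    apply Rle_trans with (rsum k (fun i => r ^ p * E (fun x => f (Ps (bot i) x)))).
    + apply rsum_le; intros i Hi. destruct (bot_spec i Hi) as [Hb _].
      eapply Rle_trans; [|apply (IH (fun x => f (Ps (bot i) x))); now apply F_Ps].
      apply Req_le, rsum_ext. intros l Hl. apply E_local.
      * apply Phi_F; [easy|]. simpl. nia.
      * intros x _. now rewrite <- Phi_S.
    + rewrite rsum_scal. pose proof (bottom_le f Hf) as A. pose proof r_pos.
      apply (Rmult_le_compat_l r) in A; [|lra].
      rewrite <- Rmult_assoc, Rinv_r, Rmult_1_l in A by lra.
      apply (Rmult_le_compat_l (r ^ p)) in A; [|apply pow_le; lra]. simpl. lra.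
Qed.

(* Folding the bottom row of k^p cells accordion-wise onto one square, with alternating
   signs, cancels the values on all interior common sides. *)
Definition fold_row (p : nat) (f : pt -> R) (n : nat) (x : pt) : R :=
  rsum n (fun l => (-1) ^ l *
    f (Phi p l (if Nat.even l then x else (1 - fst x, snd x)))).

(** Each added cell doubles the constant through [E_plus_le]. This is crude, but with [n = k ^ p] it
    depends only on k and p. *)
Lemma fold_row_F p f n : F f -> (n <= k ^ p)%nat -> F (fold_row p f n) /\
  E (fold_row p f n) <= 2 ^ n * rsum n (fun l => E (fun x => f (Phi p l x))).
Proof.
  intros Hf. induction n as [|n IH]; intros Hn.
  - assert (Ha : agree K (fun _ => 0) (fold_row p f 0)) by (intros x _; reflexivity).
    split; [apply (F_local _ _ (F_const 0) Ha)|].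
    rewrite <- (E_local _ _ (F_const 0) Ha), E_const, rsum_0. lra.
  - destruct (IH ltac:(lia)) as [FG EG].
    set (g := fun x => f (Phi p n (if Nat.even n then x else (1 - fst x, snd x)))).
    assert (Fp : F (fun x => f (Phi p n x))) by (apply Phi_F; [easy|lia]).
    assert (Fg : F g /\ E g = E (fun x => f (Phi p n x))).
    { unfold g. destruct (Nat.even n); [easy|]. split.
      - apply (F_D4 _ _ D4_refx Fp).
      - apply (E_D4 _ _ D4_refx Fp). }
    destruct Fg as [Fg Eg].
    assert (Fsg : F (fun x => (-1) ^ n * g x)) by now apply F_scal.
    assert (Ha : agree K (fun x => fold_row p f n x + (-1) ^ n * g x) (fold_row p f (S n))).
    { intros x _. unfold fold_row. now rewrite rsum_S. }
    pose proof (F_plus _ _ FG Fsg) as FS.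
    split; [apply (F_local _ _ FS Ha)|]. rewrite <- (E_local _ _ FS Ha).
    eapply Rle_trans; [apply (E_plus_le _ _ FG Fsg)|].
    rewrite E_scal, Eg by easy. rewrite rsum_S.
    assert (Hone : ((-1) ^ n) ^ 2 = 1).
    { rewrite <- pow_mult, Nat.mul_comm, pow_mult. replace ((-1) ^ 2) with 1 by ring. apply pow1. }
    rewrite Hone. pose proof (E_nonneg _ Fp) as Hnn. cbv beta in Hnn.
    assert (1 * E (fun x => f (Phi p n x)) <= 2 ^ n * E (fun x => f (Phi p n x))).
    { apply Rmult_le_compat_r; [easy|]. apply pow_R1_Rle; lra. }
    simpl (2 ^ S n). lra.
Qed.

(** On each side of the folded square consecutive terms cancel in pairs. Parity decides on which
    side the far end of the row lands, but the difference of the two sides is the same in both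
    cases. *)
Lemma fold_row_sides p f n y :
  fold_row p f n (1, y) = (if Nat.even n then 0 else f (INR n / INR (k ^ p), y / INR (k ^ p))) /\
  fold_row p f n (0, y) - fold_row p f n (1, y) =
    f (0, y / INR (k ^ p)) - f (INR n / INR (k ^ p), y / INR (k ^ p)).
Proof.
  pose proof (INR_pow_pos k p k_pos) as Hp.
  induction n as [|n [IH1 IH2]].
  - unfold fold_row. rewrite !rsum_0. split; [easy|]. simpl INR.
    replace (0 / INR (k ^ p)) with 0 by (field; lra). ring.
  - assert (Hstep : forall x, fold_row p f (S n) x = fold_row p f n x + (-1) ^ n *
      f (Phi p n (if Nat.even n then x else (1 - fst x, snd x)))).
    { intros x. unfold fold_row. now rewrite rsum_S. }
    assert (Hs : Nat.even (S n) = negb (Nat.even n)) by (rewrite Nat.even_succ, <- Nat.negb_even; easy).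
    assert (Hsg : (-1) ^ n = if Nat.even n then 1 else -1).
    { clear. induction n as [|n IH]; [easy|].
      assert (Nat.even (S n) = negb (Nat.even n)) as -> by (rewrite Nat.even_succ, <- Nat.negb_even; easy).
      simpl. rewrite IH. destruct (Nat.even n); simpl; ring. }
    rewrite !Hstep, Hs, S_INR, Hsg.
    destruct (Nat.even n); simpl; unfold Phi; simpl; split.
    + rewrite IH1. rewrite (Rplus_comm 1). ring.
    + rewrite (Rplus_comm 1), Rplus_0_l. lra.
    + rewrite IH1. replace (1 - 1 + INR n) with (INR n) by ring. ring.
    + replace (1 - 1 + INR n) with (INR n) by ring.
      replace (1 - 0 + INR n) with (INR n + 1) by ring. lra.
Qed.

Section UniformCornerBound.

Variable p : nat.
Hypothesis Hp : 8 * INR k ^ 6 * (1 - ik ^ 2) ^ p <= / 64.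

Notation C0 := (8 * 2 ^ (k ^ p)).

(** Otherwise the energy is below 2/rho, and the choice of p makes [f] vary by at most 1/8 on the
    vertical sides of the cells of the row. Folding then gives a function separating opposite sides
    by 1/2 with energy below 2^(k^p) * 2/rho <= 1/4, against the normalization; this explains the 8
    in [C0]. *)
Lemma corner_bound_normalized rho f : corner_bound rho -> C0 <= rho -> F f ->
  f (0, 0) = 1 -> f (1, 0) = 0 -> 1 <= rho / 2 * E f.
Proof.
  intros H HC Hf H0 H1. apply Rnot_lt_le. intros Hlt.
  pose proof ik_range. pose proof r_pos. pose proof r_upper. pose proof k_cube_ge.
  assert (H2k : 1 <= 2 ^ (k ^ p)) by (apply pow_R1_Rle; lra).
  assert (Hrho : 0 <= rho) by lra.
  assert (He : 0 <= E f) by now apply E_nonneg.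
  assert (Hrp : 0 <= r ^ p <= 1).
  { split; [apply pow_le; lra|]. rewrite <- (pow1 p). apply pow_incr.
    pose proof (pow2_ge_0 ik). lra. }
  assert (Hrp2 : r ^ p <= (1 - ik ^ 2) ^ p) by (apply pow_incr; lra).
  assert (Hpn : (0 < k ^ p)%nat) by (apply INR_lt, INR_pow_pos, k_pos).
  pose proof (INR_pow_pos k p k_pos) as HpR.
  assert (Hcell : forall l y, (l < k ^ p)%nat -> 0 <= y <= 1 ->
    Rabs (f (Phi p l (0, y)) - f (Phi p l (0, 0))) <= / 8 /\
    Rabs (f (Phi p l (1, y)) - f (Phi p l (1, 0))) <= / 8).
  { intros l y Hl Hy. pose proof (Phi_F p f l Hf Hl) as Fg.
    assert (Eg : E (fun x => f (Phi p l x)) <= r ^ p * E f).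
    { eapply Rle_trans; [|apply Phi_E; easy].
      apply (rsum_term_le (k ^ p) (fun l => E (fun x => f (Phi p l x)))); [easy|].
      intros j Hj. now apply E_nonneg, Phi_F. }
    destruct (vertical_oscillation rho _ y Hrho H Fg Hy) as [A B].
    (* Squared, the left side is at most 4 k^6 r^p * rho * E f, and [rho * E f < 2]. *)
    assert (Hs : 2 * INR k ^ 3 * sqrt (rho * E (fun x => f (Phi p l x))) <= / 8).
    { rewrite <- (sqrt_pow2 (2 * INR k ^ 3)) by lra. rewrite <- sqrt_mult_alt by apply pow2_ge_0.
      rewrite <- (sqrt_pow2 (/ 8)) by lra. apply sqrt_le_1_alt.
      apply Rle_trans with (4 * INR k ^ 6 * (rho * (r ^ p * E f))).
      - replace ((2 * INR k ^ 3) ^ 2) with (4 * INR k ^ 6) by ring.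
        apply Rmult_le_compat_l; [apply Rmult_le_pos; [lra|apply pow_le, pos_INR]|].
        now apply Rmult_le_compat_l.
      - replace (4 * INR k ^ 6 * (rho * (r ^ p * E f))) with
          ((8 * INR k ^ 6 * r ^ p) * (rho / 2 * E f)) by field.
        assert (Hk6 : 0 <= 8 * INR k ^ 6) by (apply Rmult_le_pos; [lra|apply pow_le, pos_INR]).
        assert (A1 : 8 * INR k ^ 6 * r ^ p <= / 64).
        { eapply Rle_trans; [|exact Hp]. now apply Rmult_le_compat_l. }
        assert (A2 : 0 <= 8 * INR k ^ 6 * r ^ p) by (apply Rmult_le_pos; lra).
        apply Rle_trans with (8 * INR k ^ 6 * r ^ p * 1); [apply Rmult_le_compat_l; lra|lra]. }
    cbv beta in A, B. lra. }
  assert (HL : forall y, 0 <= y <= 1 -> 7 / 8 <= f (0, y / INR (k ^ p))).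
  { intros y Hy. destruct (Hcell 0%nat y Hpn Hy) as [A _]. unfold Phi in A. simpl in A.
    rewrite Rplus_0_r in A. replace (0 / INR (k ^ p)) with 0 in A by (field; lra).
    rewrite H0 in A. apply Rabs_le_between in A. lra. }
  assert (HRt : forall y, 0 <= y <= 1 -> - / 8 <= f (INR (k ^ p) / INR (k ^ p), y / INR (k ^ p)) <= / 8).
  { intros y Hy. destruct (Hcell (k ^ p - 1)%nat y ltac:(lia) Hy) as [_ A].
    unfold Phi in A. simpl in A. rewrite minus_INR in A by lia. simpl (INR 1) in A.
    replace (1 + (INR (k ^ p) - 1)) with (INR (k ^ p)) in A by ring.
    replace (0 / INR (k ^ p)) with 0 in A by (field; lra).
    replace (INR (k ^ p) / INR (k ^ p)) with 1 in * by (field; lra).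
    rewrite H1 in A. apply Rabs_le_between in A. lra. }
  destruct (fold_row_F p f (k ^ p) Hf (le_n _)) as [FG EG].
  (* For an odd number of cells the two sides are near 1 and 0; for an even number the right side is
     0 and the left at least 3/4. The levels 5/8 and 1/8 serve both. *)
  assert (HG : (5 / 8 - / 8) ^ 2 <= E (fold_row p f (k ^ p))).
  { apply E_separates_sides; [easy|lra| |]; intros y Hy;
      destruct (fold_row_sides p f (k ^ p) y) as [S1 S2];
      specialize (HL y Hy); specialize (HRt y Hy); destruct (Nat.even (k ^ p)); lra. }
  assert (HE2 : E (fold_row p f (k ^ p)) <= 2 ^ (k ^ p) * E f).
  { eapply Rle_trans; [exact EG|]. apply Rmult_le_compat_l; [lra|].
    eapply Rle_trans; [apply Phi_E; easy|].
    rewrite <- (Rmult_1_l (E f)) at 2. apply Rmult_le_compat_r; lra. }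
  apply (Rmult_le_compat_r (E f)) in HC; lra.
Qed.

Lemma corner_bound_halve rho : corner_bound rho -> C0 <= rho -> corner_bound (rho / 2).
Proof.
  intros H HC f Hf. set (d := f (0, 0) - f (1, 0)).
  assert (H2k : 1 <= 2 ^ (k ^ p)) by (apply pow_R1_Rle; lra).
  destruct (Req_dec d 0) as [->|Hd].
  - pose proof (E_nonneg f Hf). assert (0 <= rho / 2 * E f) by (apply Rmult_le_pos; lra).
    simpl; lra.
  - pose proof (corner_bound_normalized rho (fun x => / d * f x + - (f (1, 0) / d)) H HC
      (F_aff _ _ f Hf)) as A.
    cbv beta in A. rewrite E_aff in A by easy.
    assert (A' : 1 <= rho / 2 * ((/ d) ^ 2 * E f)).
    { apply A; unfold d in *; field; easy. }
    apply (Rmult_le_compat_l (d ^ 2)) in A'; [|apply pow2_ge_0].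
    replace (d ^ 2 * (rho / 2 * ((/ d) ^ 2 * E f))) with (rho / 2 * E f) in A' by (field; easy).
    lra.
Qed.

Lemma corner_bound_weaken rho rho' : rho <= rho' -> corner_bound rho -> corner_bound rho'.
Proof.
  intros Hle H f Hf. eapply Rle_trans; [now apply H|].
  apply Rmult_le_compat_r; [now apply E_nonneg|easy].
Qed.

(** The initial bound depends on the form, but halving it finitely often brings it below [C0]. *)
Lemma corner_bound_uniform : corner_bound C0.
Proof.
  assert (H2k : 1 <= 2 ^ (k ^ p)) by (apply pow_R1_Rle; lra).
  destruct corner_bound_exists as [rho [Hrho H]].
  destruct (geometric_small (/ 2) rho C0) as [n Hn]; try lra.
  revert rho Hrho H Hn. induction n as [|n IH]; intros rho Hrho H Hn.
  - apply corner_bound_weaken with rho; [simpl in Hn; lra|easy].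
  - destruct (Rle_dec C0 rho) as [Hle|Hle].
    + apply (IH (rho / 2)); [lra|now apply corner_bound_halve|]. simpl in Hn. lra.
    + apply corner_bound_weaken with rho; [lra|easy].
Qed.

End UniformCornerBound.

(** * Trace on one side *)

Lemma Tn_bot n l f : (l < k)%nat ->
  Tn k r n (fun t => f (INR l / INR k + t / INR k, 0)) = Tn k r n (fun t => f (Ps (bot l) (t, 0))).
Proof.
  intros Hl. apply Tn_ext; [apply k_pos|]. intros t _. rewrite Ps_bot by easy. simpl.
  f_equal. f_equal. unfold Rdiv; ring.
Qed.

Section TraceBound.

Variable rho : R.
Hypothesis Hrho : 0 <= rho.
Hypothesis Hcb : corner_bound rho.

Lemma vertical_corner_bound e f : e = 0 \/ e = 1 -> F f ->
  (f (e, 0) - f (e, 1)) ^ 2 <= rho * E f.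
Proof.
  intros [-> | ->] Hf.
  - pose proof (Hcb _ (F_D4 _ _ D4_swap Hf)) as A. cbv beta in A.
    now rewrite (E_D4 _ _ D4_swap Hf) in A.
  - assert (Hrot : In (fun p : pt => (1 - snd p, fst p)) D4) by (simpl; tauto).
    pose proof (Hcb _ (F_D4 _ _ Hrot Hf)) as A. cbv beta in A.
    rewrite (E_D4 _ _ Hrot Hf) in A. simpl in *. now rewrite Rminus_0_r in A.
Qed.

Lemma top_corner_bound f : F f -> (f (0, 1) - f (1, 1)) ^ 2 <= rho * E f.
Proof.
  intros Hf. pose proof (Hcb _ (F_D4 _ _ D4_refy Hf)) as A. cbv beta in A.
  rewrite (E_D4 _ _ D4_refy Hf) in A. simpl in *. now rewrite Rminus_0_r in A.
Qed.

(** Series law through at most k cells off the bottom; the factor r is dropped since r <= 1. *)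
Lemma chain_bound n g f : F f -> (n <= k)%nat ->
  (forall l, (l < n)%nat -> (g l - g (S l)) ^ 2 <= rho * (r * nonbottom_energy f)) ->
  (g 0%nat - g n) ^ 2 <= INR k ^ 2 * rho * nonbottom_energy f.
Proof.
  intros Hf Hn H. rewrite <- rsum_telescope. eapply Rle_trans; [apply rsum_square|].
  pose proof (nonbottom_nonneg f Hf) as HA. pose proof r_upper. pose proof (pow2_ge_0 ik).
  assert (Hb : 0 <= rho * nonbottom_energy f) by now apply Rmult_le_pos.
  assert (Hrb : r * (rho * nonbottom_energy f) <= 1 * (rho * nonbottom_energy f))
    by (apply Rmult_le_compat_r; lra).
  replace (INR k ^ 2 * rho * nonbottom_energy f) with (INR k * (INR k * (rho * nonbottom_energy f))) by ring.
  assert (Hnk : INR n <= INR k) by now apply le_INR.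
  apply Rmult_le_compat; [apply pos_INR|apply rsum_nonneg; intros; apply pow2_ge_0|easy|].
  apply Rle_trans with (INR n * (rho * nonbottom_energy f)); [|now apply Rmult_le_compat_r].
  rewrite <- rsum_const. apply rsum_le; intros l Hl. specialize (H l Hl). lra.
Qed.

Lemma column_bound e f : e = 0 \/ e = 1 -> F f ->
  (f (e, ik) - f (e, 1)) ^ 2 <= INR k ^ 2 * rho * nonbottom_energy f.
Proof.
  intros He Hf. pose proof kR_ge3. pose proof ik_range.
  pose proof (chain_bound (k - 1) (fun l => f (e, INR (S l) / INR k)) f Hf ltac:(lia)) as A.
  cbv beta in A. replace (S (k - 1)) with k in A by (pose proof k_pos; lia).
  replace (INR 1 / INR k) with ik in A by (simpl; field; lra).
  replace (INR k / INR k) with 1 in A by (field; lra). apply A. clear A.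
  intros l Hl.
  assert (Hi : exists i, (i < N)%nat /\ c i = (e * (1 - ik), INR (S l) / INR k)).
  { destruct He as [-> | ->].
    - rewrite Rmult_0_l. apply left_exists; lia.
    - rewrite Rmult_1_l. apply right_exists; lia. }
  destruct Hi as [i [Hi Hc]].
  pose proof (vertical_corner_bound e _ He (F_Ps f i Hf Hi)) as B. cbv beta in B.
  assert (Hne : snd (c i) <> 0).
  { rewrite Hc. cbn [snd]. unfold Rdiv. apply Rmult_integral_contrapositive.
    split; [|lra]. apply not_0_INR. lia. }
  pose proof (E_Ps_nonbottom f i Hf Hi Hne) as D.
  apply (Rmult_le_compat_l rho) in D; [|easy].
  assert (P0 : Ps i (e, 0) = (e, INR (S l) / INR k)).
  { unfold Psi. rewrite Hc. cbn [fst snd]. f_equal; destruct He as [-> | ->]; field; lra. }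
  assert (P1 : Ps i (e, 1) = (e, INR (S (S l)) / INR k)).
  { unfold Psi. rewrite Hc. cbn [fst snd]. rewrite (S_INR (S l)).
    f_equal; destruct He as [-> | ->]; field; lra. }
  rewrite P0, P1 in B. lra.
Qed.

Lemma top_row_bound f : F f ->
  (f (0, 1) - f (1, 1)) ^ 2 <= INR k ^ 2 * rho * nonbottom_energy f.
Proof.
  intros Hf. pose proof kR_ge3. pose proof ik_range.
  pose proof (chain_bound k (fun l => f (INR l / INR k, 1)) f Hf ltac:(lia)) as A.
  cbv beta in A. replace (INR 0 / INR k) with 0 in A by (simpl; field; lra).
  replace (INR k / INR k) with 1 in A by (field; lra). apply A. clear A.
  intros l Hl. destruct top_row as [Hex _]. destruct (Hex l Hl) as [i [Hi Hc]].
  pose proof (top_corner_bound _ (F_Ps f i Hf Hi)) as B. cbv beta in B.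
  assert (Hne : snd (c i) <> 0) by (rewrite Hc; simpl; lra).
  pose proof (E_Ps_nonbottom f i Hf Hi Hne) as D.
  apply (Rmult_le_compat_l rho) in D; [|easy].
  assert (P0 : Ps i (0, 1) = (INR l / INR k, 1)).
  { unfold Psi. rewrite Hc. cbn [fst snd]. f_equal; field; lra. }
  assert (P1 : Ps i (1, 1) = (INR (S l) / INR k, 1)).
  { unfold Psi. rewrite Hc. cbn [fst snd]. rewrite (S_INR l). f_equal; field; lra. }
  rewrite P0, P1 in B. lra.
Qed.

(** The part of the climb that the energy off the bottom row does not pay for: along a vertical side
    it starts inside a corner cell, which touches the bottom. *)
Definition corner_drops (f : pt -> R) : R := (f (0, 0) - f (0, 1)) ^ 2 + (f (1, 0) - f (1, 1)) ^ 2.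

Lemma weighted_square x v d : 0 < d -> (v + x) ^ 2 <= (1 + d) * v ^ 2 + (1 + / d) * x ^ 2.
Proof.
  intros Hd. assert (0 <= (d * v - x) ^ 2 * / d).
  { apply Rmult_le_pos; [apply pow2_ge_0|left; now apply Rinv_0_lt_compat]. }
  replace ((d * v - x) ^ 2 * / d) with (d * v ^ 2 - 2 * v * x + / d * x ^ 2) in H by (field; lra).
  replace ((v + x) ^ 2) with (v ^ 2 + 2 * v * x + x ^ 2) by ring. lra.
Qed.

(** Solution of (3 + lam)(1 + 1/(2 k^2)) = lam (1 + 1/k^2), whose right side is at most lam/r. *)
Notation lam := (6 * INR k ^ 2 + 3).

(** Each drop is the drop inside its corner cell plus a climb through cells off the bottom. The
    first is charged to the next generation, where the weight 1/r outweighs the loss from the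
    splitting. *)
Lemma corner_drops_step f : F f ->
  (3 + lam) * corner_drops f <= 57 * INR k ^ 6 * rho * nonbottom_energy f +
   lam / r * ((f (Ps (bot 0) (0, 0)) - f (Ps (bot 0) (0, 1))) ^ 2 +
     (f (Ps (bot (k - 1)) (1, 0)) - f (Ps (bot (k - 1)) (1, 1))) ^ 2).
Proof.
  intros Hf. pose proof kR_ge3 as Hk. pose proof ik_range as Hik. pose proof k_pos.
  pose proof r_upper as Hr. pose proof r_pos as Hr0.
  rewrite !Ps_bot by lia. cbn [fst snd]. rewrite minus_INR by lia. simpl (INR 1). simpl (INR 0).
  replace (0 / INR k) with 0 by (field; lra). replace (0 + 0) with 0 by ring.
  replace (1 / INR k) with ik by (field; lra).
  replace ((INR k - 1) / INR k + ik) with 1 by (field; lra).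
  pose proof (nonbottom_nonneg f Hf) as HA. set (A := nonbottom_energy f) in *.
  assert (Hb : 0 <= rho * A) by now apply Rmult_le_pos.
  assert (Hs2 : 0 < ik ^ 2) by (apply pow_lt; lra).
  assert (HV : forall e, e = 0 \/ e = 1 -> (f (e, 0) - f (e, 1)) ^ 2 <=
     (1 + ik ^ 2 / 2) * (f (e, 0) - f (e, ik)) ^ 2 + 3 * INR k ^ 4 * (rho * A)).
  { intros e He. pose proof (column_bound e f He Hf) as Hc. fold A in Hc.
    replace (f (e, 0) - f (e, 1)) with ((f (e, 0) - f (e, ik)) + (f (e, ik) - f (e, 1))) by ring.
    (* Half of the margin 1/k^2 by which 1/r exceeds 1 is spent on the splitting; the other half
       leaves room for the extra 3 in [3 + lam]. *)
    eapply Rle_trans; [apply (weighted_square _ _ (ik ^ 2 / 2)); lra|].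
    apply Rplus_le_compat_l.
    replace (/ (ik ^ 2 / 2)) with (2 * INR k ^ 2) by (field; lra).
    pose proof kR_sq_ge as H9.
    apply Rle_trans with (3 * INR k ^ 2 * (INR k ^ 2 * rho * A)); [|apply Req_le; ring].
    apply Rmult_le_compat; try lra. apply pow2_ge_0. }
  pose proof (HV 0 (or_introl eq_refl)) as V0. pose proof (HV 1 (or_intror eq_refl)) as V1.
  unfold corner_drops. set (w0 := (f (0, 0) - f (0, ik)) ^ 2) in *.
  set (w1 := (f (1, 0) - f (1, ik)) ^ 2) in *.
  assert (W0 : 0 <= w0) by apply pow2_ge_0. assert (W1 : 0 <= w1) by apply pow2_ge_0.
  pose proof kR_sq_ge as Hk2.
  assert (Hrinv : 1 + ik ^ 2 <= / r).
  { apply (Rmult_le_reg_r r); [easy|]. rewrite Rinv_l by lra.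
    apply Rle_trans with ((1 + ik ^ 2) * (1 - ik ^ 2)); [apply Rmult_le_compat_l; lra|].
    pose proof (pow2_ge_0 (ik ^ 2)). lra. }
  assert (Hlam : (3 + lam) * (1 + ik ^ 2 / 2) <= lam / r).
  { apply Rle_trans with (lam * (1 + ik ^ 2)); [|apply Rmult_le_compat_l; lra].
    assert (Hkk : INR k ^ 2 * ik ^ 2 = 1) by (field; lra).
    replace ((3 + lam) * (1 + ik ^ 2 / 2)) with (6 * INR k ^ 2 + 6 + 3 * (INR k ^ 2 * ik ^ 2) + 3 * ik ^ 2)
      by (field; lra).
    replace (lam * (1 + ik ^ 2)) with (6 * INR k ^ 2 + 3 + 6 * (INR k ^ 2 * ik ^ 2) + 3 * ik ^ 2) by ring.
    rewrite Hkk. lra. }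
  apply (Rmult_le_compat_r (w0 + w1)) in Hlam; [|lra].
  assert (Hsum : (f (0, 0) - f (0, 1)) ^ 2 + (f (1, 0) - f (1, 1)) ^ 2 <=
    (1 + ik ^ 2 / 2) * (w0 + w1) + 6 * INR k ^ 4 * (rho * A)) by lra.
  apply (Rmult_le_compat_l (3 + lam)) in Hsum; [|lra].
  (* Together with the 3 needed for the crossing along the top, 57 makes up the 60 of the trace
     bound. *)
  assert (Hc : (3 + lam) * (6 * INR k ^ 4 * (rho * A)) <= 57 * INR k ^ 6 * (rho * A)).
  { assert (H4 : 0 <= INR k ^ 4 * (rho * A)) by (apply Rmult_le_pos; [apply pow_le; lra|easy]).
    assert (H6 : (36 * INR k ^ 2 + 36) * (INR k ^ 4 * (rho * A)) <=
                 57 * INR k ^ 2 * (INR k ^ 4 * (rho * A))) by (apply Rmult_le_compat_r; lra).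
    lra. }
  lra.
Qed.

(** The induction hypothesis brings minus lam/r times the drops of all bottom cells; those of the
    two corner cells pay, through [corner_drops_step], for the drops of [f], including the three
    copies spent on generation 0. *)
Lemma bottom_trace_bound n : forall f, F f ->
  Tn k r n (fun t => f (t, 0)) <= 60 * INR k ^ 6 * rho * E f - lam * corner_drops f.
Proof.
  pose proof kR_ge3 as Hk. pose proof r_inv_pos as Hri. pose proof k_pos as Hk0.
  pose proof kR_sq_ge as Hk2.
  assert (Hk6 : INR k ^ 2 <= INR k ^ 6).
  { replace (INR k ^ 6) with (INR k ^ 2 * (INR k ^ 2 * INR k ^ 2)) by ring.
    rewrite <- (Rmult_1_r (INR k ^ 2)) at 1. apply Rmult_le_compat_l; [lra|].
    rewrite <- (Rmult_1_r 1). apply Rmult_le_compat; lra. }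
  induction n as [|n IH]; intros f Hf.
  (* With no generation to sum, the claim is that the functional itself is nonnegative. *)
  - unfold Tn. rewrite rsum_0.
    pose proof (vertical_corner_bound 0 f (or_introl eq_refl) Hf) as A.
    pose proof (vertical_corner_bound 1 f (or_intror eq_refl) Hf) as B.
    assert (Hnn : 0 <= rho * E f) by (apply Rmult_le_pos; [easy|now apply E_nonneg]).
    assert (HD2 : lam * corner_drops f <= lam * (2 * (rho * E f))).
    { apply Rmult_le_compat_l; [lra|]. unfold corner_drops. lra. }
    assert (lam * (2 * (rho * E f)) <= 60 * INR k ^ 6 * (rho * E f)).
    { rewrite <- Rmult_assoc. apply Rmult_le_compat_r; lra. }
    lra.
  - rewrite Tn_S by (easy || apply r_pos). rewrite Dm_0.
    set (fl := fun l x => f (Ps (bot l) x)).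
    assert (Fl : forall l, (l < k)%nat -> F (fl l)) by (intros; apply F_Ps; [easy|now apply bot_spec]).
    assert (H1 : rsum k (fun l => Tn k r n (fun t => f (INR l / INR k + t / INR k, 0))) <=
      60 * INR k ^ 6 * rho * rsum k (fun l => E (fl l)) - lam * rsum k (fun l => corner_drops (fl l))).
    { replace (60 * INR k ^ 6 * rho * rsum k (fun l => E (fl l)) - lam * rsum k (fun l => corner_drops (fl l)))
        with (rsum k (fun l => 60 * INR k ^ 6 * rho * E (fl l) + - lam * corner_drops (fl l))).
      2:{ rewrite rsum_plus, !rsum_scal. ring. }
      apply rsum_le; intros l Hl. rewrite Tn_bot by easy.
      eapply Rle_trans; [apply (IH (fl l) (Fl l Hl))|]. lra. }
    assert (H2 : (fl 0%nat (0, 0) - fl 0%nat (0, 1)) ^ 2 +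
       (fl (k - 1)%nat (1, 0) - fl (k - 1)%nat (1, 1)) ^ 2 <= rsum k (fun l => corner_drops (fl l))).
    { unfold corner_drops. rewrite rsum_plus. apply Rplus_le_compat.
      - apply (rsum_term_le k (fun l => (fl l (0, 0) - fl l (0, 1)) ^ 2)); [easy|].
        intros; apply pow2_ge_0.
      - apply (rsum_term_le k (fun l => (fl l (1, 0) - fl l (1, 1)) ^ 2)); [lia|].
        intros; apply pow2_ge_0. }
    pose proof (corner_drops_step f Hf) as H3. unfold fl in H2 at 1 2 3 4.
    pose proof (E_split f Hf) as HE1. pose proof (top_row_bound f Hf) as HT.
    apply (Rmult_le_compat_l (/ r)) in H1; [|lra].
    apply (Rmult_le_compat_l (lam / r)) in H2; [|unfold Rdiv; apply Rmult_le_pos; lra].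
    (* Route from one bottom corner to the other: up the left side, along the top, down the right
       side. *)
    assert (Htri : (f (0, 0) - f (1, 0)) ^ 2 <= 3 * corner_drops f + 3 * (f (0, 1) - f (1, 1)) ^ 2).
    { unfold corner_drops.
      set (x := f (0, 0) - f (0, 1)). set (y := f (1, 0) - f (1, 1)). set (z := f (0, 1) - f (1, 1)).
      replace (f (0, 0) - f (1, 0)) with (x + z - y) by (unfold x, y, z; ring).
      pose proof (pow2_ge_0 (x - z)). pose proof (pow2_ge_0 (x + y)). pose proof (pow2_ge_0 (y + z)).
      lra. }
    pose proof (nonbottom_nonneg f Hf) as HA.
    assert (Hb : 0 <= rho * nonbottom_energy f) by now apply Rmult_le_pos.
    assert (Hb6 : INR k ^ 2 * (rho * nonbottom_energy f) <= INR k ^ 6 * (rho * nonbottom_energy f))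
      by now apply Rmult_le_compat_r.
    rewrite HE1. fold (fl 0%nat) in *. unfold fl in *. lra.
Qed.

Lemma bottom_trace_bound_simple n f : F f ->
  Tn k r n (fun t => f (t, 0)) <= 60 * INR k ^ 6 * rho * E f.
Proof.
  intros Hf. pose proof (bottom_trace_bound n f Hf) as H.
  assert (0 <= lam * corner_drops f); [|lra].
  apply Rmult_le_pos; [pose proof (pow2_ge_0 (INR k)); lra|].
  unfold corner_drops. apply Rplus_le_le_0_compat; apply pow2_ge_0.
Qed.

End TraceBound.

(** * Higher generations *)

Lemma besov_weight m : Rpower (INR k) ((2 * sigma_r k r - 1) * INR m) = / r ^ m.
Proof.
  pose proof kR_ge3. pose proof r_pos.
  assert (0 < ln (INR k)) by (rewrite <- ln_1; apply ln_increasing; lra).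
  rewrite <- (Rpower_pow m r) by easy. unfold Rpower. rewrite <- exp_Ropp. f_equal.
  unfold sigma_r. field. lra.
Qed.

Lemma besov01_term_Dm g m : besov01_term k (sigma_r k r) g m = / r ^ m * Dm k m g.
Proof. unfold besov01_term. now rewrite besov_weight. Qed.

Lemma sum_besov_terms g n : sum_n (besov01_term k (sigma_r k r) g) n = Tn k r (S n) g.
Proof.
  unfold Tn. rewrite <- rsum_sum_n. apply rsum_ext. intros m _. apply besov01_term_Dm.
Qed.

Lemma besov_series_bounded g B : (forall n, Tn k r n g <= B) ->
  ex_series (besov01_term k (sigma_r k r) g) /\ besov01_sq k (sigma_r k r) g <= B.
Proof.
  intros HB.
  assert (He : ex_series (besov01_term k (sigma_r k r) g)).
  { apply (ex_finite_lim_seq_incr _ B).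
    - intros n. rewrite !sum_besov_terms. apply Tn_mono; [apply r_pos|lia].
    - intros n. rewrite sum_besov_terms. apply HB. }
  split; [easy|]. pose proof (Series_correct _ He) as Hs.
  assert (Hle : Rbar_le (Series (besov01_term k (sigma_r k r) g)) B); [|exact Hle].
  apply (is_lim_seq_le (sum_n (besov01_term k (sigma_r k r) g)) (fun _ => B)).
  - intros n. rewrite sum_besov_terms. apply HB.
  - exact Hs.
  - apply is_lim_seq_const.
Qed.

Lemma Tn_le_besov g n : ex_series (besov01_term k (sigma_r k r) g) ->
  Tn k r n g <= besov01_sq k (sigma_r k r) g.
Proof.
  intros He. apply Rle_trans with (Tn k r (S n) g); [apply Tn_mono; [apply r_pos|lia]|].
  rewrite <- sum_besov_terms.
  apply (is_lim_seq_incr_compare (sum_n (besov01_term k (sigma_r k r) g))).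
  - exact (Series_correct _ He).
  - intros m. rewrite !sum_besov_terms. apply Tn_mono; [apply r_pos|lia].
Qed.

Lemma besov01_term_ext g g' m : (forall t, 0 <= t <= 1 -> g t = g' t) ->
  besov01_term k (sigma_r k r) g m = besov01_term k (sigma_r k r) g' m.
Proof. intros H. rewrite !besov01_term_Dm. f_equal. apply Dm_ext; [apply k_pos|easy]. Qed.

Lemma besov01_sq_ext g g' : (forall t, 0 <= t <= 1 -> g t = g' t) ->
  besov01_sq k (sigma_r k r) g = besov01_sq k (sigma_r k r) g'.
Proof. intros H. apply Series_ext. intros m. now apply besov01_term_ext. Qed.

Lemma Ps_gamma i x y t : Ps i (gamma x y t) = gamma (Ps i x) (Ps i y) t.
Proof. unfold Psi, gamma; simpl. pose proof kR_ge3. f_equal; field; lra. Qed.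

Lemma edist_Ps i x y : edist (Ps i x) (Ps i y) = ik * edist x y.
Proof.
  pose proof ik_range. unfold edist. rewrite <- (sqrt_pow2 ik) at 1 by lra.
  rewrite <- sqrt_mult_alt by apply pow2_ge_0. f_equal. unfold Psi; simpl.
  unfold Rdiv. ring.
Qed.

Definition wpt (w : list nat) (j : nat) : pt := PsiW k c w (qq j).

Lemma wpt_cons i w j : wpt (i :: w) j = Ps i (wpt w j).
Proof. reflexivity. Qed.

Lemma wpt_edist w j : (j < 4)%nat -> 0 < edist (wpt w j) (wpt w (S j mod 4)).
Proof.
  intros Hj. pose proof ik_range. induction w as [|i w IH].
  - assert (Hq : edist (qq j) (qq (S j mod 4)) = 1); [|change (0 < edist (qq j) (qq (S j mod 4))); lra].
    unfold edist. rewrite <- sqrt_1. f_equal.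
    destruct j as [|[|[|[|j]]]]; try lia; simpl; ring.
  - rewrite !wpt_cons, edist_Ps. apply Rmult_lt_0_compat; lra.
Qed.

(** The length factor contributes k^(2 sigma - 1) = 1/r, the scaling factor of the energy. Both
    sides of the estimate thus scale alike, and the constants do not depend on n. *)
Lemma besov_seg_Ps i x y u : 0 < edist x y ->
  besov_seg_sq k (sigma_r k r) (Ps i x) (Ps i y) u =
  / r * besov_seg_sq k (sigma_r k r) x y (fun p => u (Ps i p)).
Proof.
  intros Hd. pose proof kR_ge3. pose proof r_pos. pose proof ik_range.
  assert (Hln : 0 < ln (INR k)) by (rewrite <- ln_1; apply ln_increasing; lra).
  unfold besov_seg_sq. rewrite edist_Ps, <- Rpower_mult_distr by lra.
  assert (Hw : Rpower ik (/ 2 - sigma_r k r) ^ 2 = / r).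
  { rewrite <- (exp_ln (/ r)) by apply r_inv_pos. rewrite ln_Rinv by easy.
    unfold Rpower. simpl. rewrite Rmult_1_r, <- exp_plus. f_equal.
    rewrite ln_Rinv by lra. unfold sigma_r. field. lra. }
  rewrite Rpow_mult_distr, Hw.
  rewrite (besov01_sq_ext (fun t => u (gamma (Ps i x) (Ps i y) t))
    (fun t => u (Ps i (gamma x y t)))); [ring|].
  intros t _. now rewrite Ps_gamma.
Qed.

Lemma besov_bdry_S n u : besov_bdry_sq k N c (sigma_r k r) (S n) u =
  / r * rsum N (fun i => besov_bdry_sq k N c (sigma_r k r) n (fun p => u (Ps i p))).
Proof.
  unfold besov_bdry_sq, rsum. simpl words. rewrite sumR_flat_map, <- sumR_map_scal.
  apply sumR_map_ext. intros i _. rewrite map_map, <- sumR_map_scal.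
  apply sumR_map_ext. intros w _. rewrite <- sumR_map_scal.
  apply sumR_map_ext. intros j Hj. apply in_seq in Hj.
  apply (besov_seg_Ps i (wpt w j) (wpt w (S j mod 4))). apply wpt_edist. lia.
Qed.

Definition side_trace (u : pt -> R) (j : nat) (t : R) : R := u (gamma (qq j) (qq (S j mod 4)) t).

Lemma besov_bdry_0 u : besov_bdry_sq k N c (sigma_r k r) 0 u =
  rsum 4 (fun j => besov01_sq k (sigma_r k r) (side_trace u j)).
Proof.
  unfold besov_bdry_sq. simpl words. cbn [map sumR fold_right]. rewrite Rplus_0_r.
  apply sumR_map_ext. intros j Hj. apply in_seq in Hj. unfold besov_seg_sq.
  change (PsiW k c [] (qq j)) with (qq j).
  change (PsiW k c [] (qq (S j mod 4))) with (qq (S j mod 4)).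
  assert (Hq : edist (qq j) (qq (S j mod 4)) = 1).
  { unfold edist. rewrite <- sqrt_1. f_equal.
    destruct j as [|[|[|[|j]]]]; try lia; simpl; ring. }
  rewrite Hq. unfold Rpower. rewrite ln_1, Rmult_0_r, exp_0. unfold side_trace. ring.
Qed.

Lemma words_S n w : In w (words N (S n)) <->
  exists i w', (i < N)%nat /\ In w' (words N n) /\ w = i :: w'.
Proof.
  simpl. rewrite in_flat_map. split.
  - intros [i [Hi Hw]]. apply in_seq in Hi. apply in_map_iff in Hw as [w' [<- Hw']].
    exists i, w'. repeat split; [lia|easy].
  - intros (i & w' & Hi & Hw' & ->). exists i. split; [apply in_seq; lia|].
    now apply in_map.
Qed.

Lemma bdry_S n p : bdry k N c (S n) p <->
  exists i x, (i < N)%nat /\ bdry k N c n x /\ p = Ps i x.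
Proof.
  split.
  - intros (w & j & Hw & Hj & t & Ht & ->). apply words_S in Hw as (i & w' & Hi & Hw' & ->).
    exists i, (gamma (wpt w' j) (wpt w' (S j mod 4)) t). split; [easy|]. split.
    + exists w', j. repeat split; try easy. now exists t.
    + rewrite Ps_gamma. reflexivity.
  - intros (i & x & Hi & (w & j & Hw & Hj & t & Ht & ->) & ->).
    exists (i :: w), j. split; [apply words_S; now exists i, w|]. split; [easy|].
    exists t. split; [easy|]. apply Ps_gamma.
Qed.

Lemma bdry_0 p : bdry k N c 0 p <-> on_bdry p.
Proof.
  split.
  - intros (w & j & [<-|[]] & Hj & t & Ht & ->). unfold gamma, on_bdry.
    destruct j as [|[|[|[|j]]]]; try lia; simpl; [left|right|left|right]; split; try lra.
  - intros Hp. destruct p as [x y]. unfold on_bdry in Hp; simpl in Hp.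
    destruct Hp as [[Hx [Hy|Hy]]|[Hy [Hx|Hx]]]; subst.
    + exists [], 0%nat. repeat split; [now left|lia|]. exists x. split; [easy|].
      unfold gamma; simpl. f_equal; ring.
    + exists [], 2%nat. repeat split; [now left|lia|]. exists (1 - x). split; [lra|].
      unfold gamma; simpl. f_equal; ring.
    + exists [], 3%nat. repeat split; [now left|lia|]. exists (1 - y). split; [lra|].
      unfold gamma; simpl. f_equal; ring.
    + exists [], 1%nat. repeat split; [now left|lia|]. exists y. split; [easy|].
      unfold gamma; simpl. f_equal; ring.
Qed.

Lemma bdry_n_in_K n : forall p, bdry k N c n p -> K p.
Proof.
  induction n as [|n IH]; intros p Hp.
  - now apply bdry_in_K, bdry_0.
  - apply bdry_S in Hp as (i & x & Hi & Hx & ->). apply K_image; auto.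
Qed.

Lemma on_bdry_bdry n : forall p, on_bdry p -> bdry k N c n p.
Proof.
  induction n as [|n IH]; intros p Hp; [now apply bdry_0|].
  destruct (K_preimage p (bdry_in_K p Hp)) as (i & x & Hi & Hx & ->).
  apply bdry_S. exists i, x. repeat split; try easy. apply IH.
  now apply (bdry_preimage i).
Qed.

Lemma in_Lambda_Ps n u i : in_Lambda k N c (sigma_r k r) (S n) u -> (i < N)%nat ->
  in_Lambda k N c (sigma_r k r) n (fun p => u (Ps i p)).
Proof.
  intros [Hc He] Hi. pose proof ik_range. split.
  - intros x Hx eps Heps.
    destruct (Hc (Ps i x)) with (eps := eps) as [del [Hdel H1]]; [apply bdry_S; now exists i, x|easy|].
    exists del; split; [easy|]. intros y Hy Hxy. apply H1; [apply bdry_S; now exists i, y|].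
    rewrite edist_Ps. assert (0 <= edist x y) by apply sqrt_pos.
    apply Rle_lt_trans with (1 * edist x y); [apply Rmult_le_compat_r; lra|lra].
  - intros w j Hw Hj. eapply ex_series_ext; [|apply (He (i :: w) j); [|easy]].
    + intros m. apply besov01_term_ext. intros t _. rewrite Ps_gamma. reflexivity.
    + apply words_S. now exists i, w.
Qed.

Section LevelN.

Variable rho : R.
Hypothesis Hrho : 0 <= rho.
Hypothesis Hcb : corner_bound rho.

(** Each oriented side is the image of the bottom one under an element of [D4], which preserves the
    energy. *)
Lemma side_trace_bound f j n : F f -> (j < 4)%nat ->
  Tn k r n (side_trace f j) <= 60 * INR k ^ 6 * rho * E f.
Proof.
  intros Hf Hj.
  assert (Hg : exists g, In g D4 /\ forall t, gamma (qq j) (qq (S j mod 4)) t = g (t, 0)).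
  { destruct j as [|[|[|[|j]]]]; [| | | |lia].
    - exists (fun p => p). split; [simpl; tauto|]. intros t. unfold gamma; simpl. f_equal; ring.
    - exists (fun p => (1 - snd p, fst p)). split; [simpl; tauto|].
      intros t. unfold gamma; simpl. f_equal; ring.
    - exists (fun p => (1 - fst p, 1 - snd p)). split; [simpl; tauto|].
      intros t. unfold gamma; simpl. f_equal; ring.
    - exists (fun p => (snd p, 1 - fst p)). split; [simpl; tauto|].
      intros t. unfold gamma; simpl. f_equal; ring. }
  destruct Hg as [g [Hg Hgt]]. rewrite <- (E_D4 g f Hg Hf).
  rewrite (Tn_ext k r n (side_trace f j) (fun t => f (g (t, 0)))).
  - apply (bottom_trace_bound_simple rho Hrho Hcb n (fun p => f (g p))). now apply F_D4.
  - apply k_pos.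
  - intros t _. unfold side_trace. now rewrite Hgt.
Qed.

Lemma trace_bound n : forall f, F f ->
  (forall w j, In w (words N n) -> (j < 4)%nat ->
    ex_series (besov01_term k (sigma_r k r) (fun t => f (gamma (wpt w j) (wpt w (S j mod 4)) t)))) /\
  besov_bdry_sq k N c (sigma_r k r) n f <= 240 * INR k ^ 6 * rho * E f.
Proof.
  induction n as [|n IH]; intros f Hf.
  - assert (Hb : forall j, (j < 4)%nat -> ex_series (besov01_term k (sigma_r k r) (side_trace f j)) /\
      besov01_sq k (sigma_r k r) (side_trace f j) <= 60 * INR k ^ 6 * rho * E f).
    { intros j Hj. apply besov_series_bounded. intros n. now apply side_trace_bound. }
    split.
    + intros w j [<-|[]] Hj. now apply Hb.
    + rewrite besov_bdry_0. apply Rle_trans with (rsum 4 (fun _ => 60 * INR k ^ 6 * rho * E f)).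
      * apply rsum_le. intros j Hj. now apply Hb.
      * rewrite rsum_const. simpl INR. lra.
  - split.
    + intros w j Hw Hj. apply words_S in Hw as (i & w' & Hi & Hw' & ->).
      destruct (IH _ (F_Ps f i Hf Hi)) as [A _].
      eapply ex_series_ext; [|apply (A w' j Hw' Hj)].
      intros m. apply besov01_term_ext. intros t _. rewrite Ps_gamma. reflexivity.
    + rewrite besov_bdry_S, (E_self_similar f Hf).
      replace (240 * INR k ^ 6 * rho * (/ r * rsum N (fun i => E (fun x => f (Ps i x))))) with
        (/ r * (240 * INR k ^ 6 * rho * rsum N (fun i => E (fun x => f (Ps i x))))) by ring.
      apply Rmult_le_compat_l; [left; apply r_inv_pos|].
      rewrite <- rsum_scal. apply rsum_le. intros i Hi. apply IH. now apply F_Ps.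
Qed.

Lemma trace_in_Lambda n f u : F f -> agree (bdry k N c n) f u ->
  in_Lambda k N c (sigma_r k r) n u.
Proof.
  intros Hf Ha. split.
  - intros x Hx eps Heps.
    destruct (F_continuous f Hf x (bdry_n_in_K n x Hx) eps Heps) as [del [Hdel H]].
    exists del; split; [easy|]. intros y Hy Hxy. rewrite <- !Ha by easy.
    apply H; [now apply (bdry_n_in_K n)|easy].
  - intros w j Hw Hj. destruct (trace_bound n f Hf) as [A _].
    eapply ex_series_ext; [|apply (A w j Hw Hj)].
    intros m. apply besov01_term_ext. intros t Ht. apply Ha.
    exists w, j. repeat split; try easy. now exists t.
Qed.

End LevelN.

(** * Extension from the boundary of generation n *)

Lemma extension_0 u : in_Lambda k N c (sigma_r k r) 0 u ->
  exists f, F f /\ agree (bdry k N c 0) f u /\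
    E f <= 20000 * INR k ^ 5 * besov_bdry_sq k N c (sigma_r k r) 0 u.
Proof.
  intros [Hc He].
  assert (HT : forall j n, (j < 4)%nat ->
    Tn k r n (side_trace u j) <= besov01_sq k (sigma_r k r) (side_trace u j)).
  { intros j n Hj. apply Tn_le_besov. apply (He [] j); [now left|easy]. }
  assert (HC : forall (s : R -> pt), (forall t, 0 <= t <= 1 -> on_bdry (s t)) ->
    (forall t t', edist (s t) (s t') <= Rabs (t' - t)) -> cont01 (fun t => u (s t))).
  { intros s Hs Hd t Ht eps Heps.
    destruct (Hc (s t)) with (eps := eps) as [del [Hdel H]]; [now apply bdry_0, Hs|easy|].
    exists del; split; [easy|]. intros t' Ht' Htt. apply H; [now apply bdry_0, Hs|].
    eapply Rle_lt_trans; [apply Hd|easy]. }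
  assert (HTs : forall j (s : R -> pt), (j < 4)%nat ->
    (forall t, gamma (qq j) (qq (S j mod 4)) t = s t) ->
    forall n, Tn k r n (fun t => u (s t)) <= besov01_sq k (sigma_r k r) (side_trace u j)).
  { intros j s Hj Hs n. rewrite (Tn_ext k r n (fun t => u (s t)) (side_trace u j)).
    - now apply HT.
    - apply k_pos.
    - intros t _. unfold side_trace. now rewrite Hs. }
  destruct (boundary_extension u
    (besov01_sq k (sigma_r k r) (side_trace u 0)) (besov01_sq k (sigma_r k r) (side_trace u 1))
    (besov01_sq k (sigma_r k r) (side_trace u 2)) (besov01_sq k (sigma_r k r) (side_trace u 3)))
    as (f & Ff & Hf & Ef).
  1-4: apply HC;
    [intros t Ht; unfold on_bdry; simpl; lra
    |intros t t'; eapply Rle_trans; [apply edist_le|]; simpl;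
     rewrite ?Rminus_diag, ?Rabs_R0, ?Rplus_0_r, ?Rplus_0_l].
  - now rewrite Rabs_minus_sym; apply Rle_refl.
  - now rewrite Rabs_minus_sym; apply Rle_refl.
  - replace (1 - t - (1 - t')) with (t' - t) by ring. apply Rle_refl.
  - replace (1 - t - (1 - t')) with (t' - t) by ring. apply Rle_refl.
  - apply (HTs 0%nat (fun t => (t, 0))); [lia|]. intros t. unfold gamma; simpl. f_equal; ring.
  - apply (HTs 1%nat (fun t => (1, t))); [lia|]. intros t. unfold gamma; simpl. f_equal; ring.
  - apply (HTs 2%nat (fun t => (1 - t, 1))); [lia|]. intros t. unfold gamma; simpl. f_equal; ring.
  - apply (HTs 3%nat (fun t => (0, 1 - t))); [lia|]. intros t. unfold gamma; simpl. f_equal; ring.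
  - exists f. split; [easy|]. split; [intros p Hp; now apply Hf, bdry_0|].
    rewrite besov_bdry_0. rewrite !rsum_S, rsum_0, Rplus_0_l. exact Ef.
Qed.

(** Extensions of the data in the first-generation cells glue: common points lie on the boundary of
    the square, which is contained in that of generation n, so both pieces equal [u] there. *)
Lemma extension_n n : forall u, in_Lambda k N c (sigma_r k r) n u ->
  exists f, F f /\ agree (bdry k N c n) f u /\
    E f <= 20000 * INR k ^ 5 * besov_bdry_sq k N c (sigma_r k r) n u.
Proof.
  induction n as [|n IH]; intros u Hu; [now apply extension_0|].
  assert (Hex : forall i, exists f, (i < N)%nat -> F f /\
    agree (bdry k N c n) f (fun p => u (Ps i p)) /\
    E f <= 20000 * INR k ^ 5 * besov_bdry_sq k N c (sigma_r k r) n (fun p => u (Ps i p))).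
  { intros i. destruct (Nat.lt_ge_cases i N) as [Hi|Hi].
    - destruct (IH _ (in_Lambda_Ps n u i Hu Hi)) as [f Hf]. now exists f.
    - exists (fun _ => 0). lia. }
  set (f := fun i => proj1_sig (constructive_indefinite_description _ (Hex i))).
  assert (Hf : forall i, (i < N)%nat -> F (f i) /\
    agree (bdry k N c n) (f i) (fun p => u (Ps i p)) /\
    E (f i) <= 20000 * INR k ^ 5 * besov_bdry_sq k N c (sigma_r k r) n (fun p => u (Ps i p))).
  { intros i Hi. unfold f. destruct (constructive_indefinite_description _ _) as [g Hg].
    now apply Hg. }
  assert (HCf : compatible f).
  { intros i j x y Hi Hj Hx Hy Hij He.
    destruct (common_point i j x y Hi Hj Hx Hy Hij He) as [Bx By].
    destruct (Hf i Hi) as (_ & Ai & _). destruct (Hf j Hj) as (_ & Aj & _).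
    rewrite Ai, Aj by now apply on_bdry_bdry. now rewrite He. }
  assert (HFf : forall i, (i < N)%nat -> F (f i)) by (intros i Hi; now apply Hf).
  exists (glue f). split; [now apply F_glue|]. split.
  - intros p Hp. apply bdry_S in Hp as (i & x & Hi & Hx & ->).
    rewrite glue_spec by (try easy; now apply (bdry_n_in_K n)).
    now apply Hf.
  - rewrite E_glue, besov_bdry_S by easy.
    replace (20000 * INR k ^ 5 * (/ r * rsum N (fun i =>
      besov_bdry_sq k N c (sigma_r k r) n (fun p => u (Ps i p))))) with
      (/ r * (20000 * INR k ^ 5 * rsum N (fun i =>
        besov_bdry_sq k N c (sigma_r k r) n (fun p => u (Ps i p))))) by ring.
    apply Rmult_le_compat_l; [left; apply r_inv_pos|].
    rewrite <- rsum_scal. apply rsum_le. intros i Hi. now apply Hf.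
Qed.

End Carpet.

(** * Choice of constants depending only on k, and conclusion *)

Lemma exists_level k : (3 <= k)%nat ->
  exists p, 8 * INR k ^ 6 * (1 - (/ INR k) ^ 2) ^ p <= / 64.
Proof.
  intros Hk. assert (Hk3 : 3 <= INR k).
  { replace 3 with (INR 3) by (simpl; ring). now apply le_INR. }
  assert (Hi : 0 < / INR k <= / 3).
  { split; [apply Rinv_0_lt_compat; lra|apply Rinv_le_contravar; lra]. }
  assert (Hi2 : 0 < (/ INR k) ^ 2) by (apply pow_lt; lra).
  assert (Hi3 : (/ INR k) ^ 2 <= / 3 * / 3).
  { simpl. rewrite Rmult_1_r. apply Rmult_le_compat; lra. }
  destruct (geometric_small (1 - (/ INR k) ^ 2) (8 * INR k ^ 6) (/ 64)) as [p Hp]; try lra.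
  - apply Rmult_le_pos; [lra|apply pow_le; lra].
  - exists p. lra.
Qed.

Theorem theorem4p3 :
  forall k : nat, exists C1 C2 : R, 0 < C1 /\ 0 < C2 /\
  forall (N : nat) (c : nat -> pt) (K : pt -> Prop) (F : (pt -> R) -> Prop)
         (Eb : (pt -> R) -> (pt -> R) -> R) (r : R),
    USC k N c ->
    attractor k N c K ->
    resistance_form K F Eb ->
    self_similar k N c F Eb r ->
    D4_symmetric F Eb ->
    jointly_continuous K F Eb ->
    eff_res_is F Eb L2 L4 1 ->
    forall n : nat,
      (forall u : pt -> R,
         (exists f, F f /\ agree (bdry k N c n) f u) <-> in_Lambda k N c (sigma_r k r) n u) /\
      (forall h, harmonic_n k N c F Eb n h ->
         C1 * besov_bdry_sq k N c (sigma_r k r) n h <= Eb h h /\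
         Eb h h <= C2 * besov_bdry_sq k N c (sigma_r k r) n h).
Proof.
  intros k. destruct (Nat.lt_ge_cases k 3) as [Hk|Hk].
  (* For k < 3 there is no carpet, so any positive constants serve. *)
  { exists 1, 1. split; [lra|]. split; [lra|]. intros N c K F Eb r [H3 _]. lia. }
  destruct (exists_level k Hk) as [p Hp].
  assert (Hk0 : 0 < INR k) by (apply lt_0_INR; lia).
  set (rho := 8 * 2 ^ (k ^ p)).
  assert (Hrho : 0 < rho) by (assert (0 < 2 ^ (k ^ p)) by (apply pow_lt; lra); unfold rho; lra).
  set (C := 240 * INR k ^ 6 * rho).
  assert (HC : 0 < C) by (apply Rmult_lt_0_compat; [apply Rmult_lt_0_compat; [lra|now apply pow_lt]|easy]).
  exists (/ C), (20000 * INR k ^ 5). split; [now apply Rinv_0_lt_compat|].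
  split; [apply Rmult_lt_0_compat; [lra|now apply pow_lt]|].
  intros N c K F Eb r HU HK HR HS HD HJ HE n.
  assert (Hcb : corner_bound F Eb rho) by (eapply corner_bound_uniform; eauto).
  assert (Htr : forall f u, F f -> agree (bdry k N c n) f u -> in_Lambda k N c (sigma_r k r) n u).
  { intros f u Hf Ha. eapply trace_in_Lambda with (rho := rho); eauto. lra. }
  assert (Hext : forall u, in_Lambda k N c (sigma_r k r) n u -> exists f, F f /\
    agree (bdry k N c n) f u /\ Eb f f <= 20000 * INR k ^ 5 * besov_bdry_sq k N c (sigma_r k r) n u).
  { intros u Hu. eapply extension_n; eauto. }
  split.
  - intros u. split.
    + intros [f [Hf Ha]]. now apply (Htr f).
    + intros Hu. destruct (Hext u Hu) as (f & Hf & Ha & _). now exists f.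
  - intros h [Hh Hinf]. split.
    + assert (Hb : besov_bdry_sq k N c (sigma_r k r) n h <= C * Eb h h).
      { eapply (trace_bound k N c K F Eb r) with (rho := rho); eauto. lra. }
      apply (Rmult_le_reg_l C); [easy|].
      rewrite <- Rmult_assoc, Rinv_r, Rmult_1_l by lra. easy.
    + destruct (Hext h) as (f & Hf & Ha & He).
      { apply (Htr h); [easy|]. intros x _; reflexivity. }
      eapply Rle_trans; [|exact He]. apply Hinf. now exists f.
Qed.
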